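(* Let $\psi(y) = \left(\frac{\sin(\pi y)}{\pi y}\right)^2$, so that $\widehat\psi(\xi) = (1-|\xi|)\mathbb{1}_{[-1,1]}(\xi)$. For each $G \in \{SO(\mathrm{even}), SO(\mathrm{odd}), U, O, USp\}$ define the constant \[ c_{G,\psi} = \begin{cases} \tfrac12, & G = USp,\\ 1, & G = U,\\ \tfrac32, & G = SO(\mathrm{even}), SO(\mathrm{odd}), O,\end{cases} \] and the function $g_{G,\psi} \in L^2[-1/2,1/2]$ by \begin{align*} g_{SO(\mathrm{even}),\psi}(x) &= \frac{216\cos(4x/\sqrt3) + 36\sqrt3\sin(2/\sqrt3)}{162\cos(2/\sqrt3) - 5\sqrt3\sin(2/\sqrt3)},\\ g_{SO(\mathrm{odd}),\psi}(x) &= \frac{8\cos(4x/\sqrt3) + 12\sqrt3\sin(2/\sqrt3)}{11\sqrt3\sin(2/\sqrt3) + 2\cos(2/\sqrt3)},\\ g_{U,\psi}(x) &= \frac{6\cos(2x) + 6\sin(1)}{3\cos(1) + 4\sin(1)},\\ g_{O,\psi}(x) &= \frac{36\cos(4x/\sqrt3) + 18\sqrt3\sin(2/\sqrt3)}{18\cos(2/\sqrt3) + 13\sqrt3\sin(2/\sqrt3)},\\ g_{USp,\psi}(x) &= \frac{8\cos(4x) + 12\sin(2)}{2\cos(2) + 3\sin(2)}. \end{align*} Then for each such $G$, \[ \frac{c_{G,\psi}}{\int_{-1/2}^{1/2} g_{G,\psi}(x)\,dx} = \inf_{\phi} \frac{1}{\phi(0)\psi(0)} \int_{\mathbb{R}^2}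 \phi(x)\psi(y) W_{2,G}(x,y)\,dx\,dy, \] where the infimum is over all test functions $\phi$ with $\operatorname{supp}\widehat\phi \subseteq [-1,1]$. Moreover, the infimum is attained by the test function $\phi_{G,\psi}$ whose Fourier transform is $\widehat{\phi_{G,\psi}} = g_{G,\psi} * g_{G,\psi}$ (with $g_{G,\psi}$ regarded as a function on $\mathbb{R}$ vanishing outside $[-1/2,1/2]$).
   Context: Fourier transform convention: $\widehat f(\xi) = \int_{\mathbb{R}} f(x) e^{-2\pi i x\xi}\,dx$. A test function is a non-negative even Schwartz function $\phi:\mathbb{R}\to\mathbb{R}$ with compactly supported Fourier transform and $\phi(0)>0$. Let $K(y) = \frac{\sin(\pi y)}{\pi y}$ (with $K(0)=1$) and, for $\epsilon \in \{0, 1, -1\}$, $K_\epsilon(x,y) = K(x-y) + \epsilon K(x+y)$. The 2-level densities are \begin{align*} W_{2,SO(\mathrm{even})}(x,y) &= \det\begin{pmatrix} K_1(x,x) & K_1(x,y)\\ K_1(y,x) & K_1(y,y)\end{pmatrix},\\ W_{2,SO(\mathrm{odd})}(x,y) &= \det\begin{pmatrix} K_{-1}(x,x) & K_{-1}(x,y)\\ K_{-1}(y,x) & K_{-1}(y,y)\end{pmatrix} + \delta(x) K_{-1}(y,y) + \delta(y) K_{-1}(x,x),\\ W_{2,O}(x,y) &= \tfrac12 W_{2,SO(\mathrm{even})}(x,y) + \tfrac12 W_{2,SO(\mathrm{odd})}(x,y),\\ W_{2,U}(x,y) &= \det\begin{pmatrix} K_0(x,x) & K_0(x,y)\\ K_0(y,x)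 & K_0(y,y)\end{pmatrix},\\ W_{2,USp}(x,y) &= \det\begin{pmatrix} K_{-1}(x,x) & K_{-1}(x,y)\\ K_{-1}(y,x) & K_{-1}(y,y)\end{pmatrix}, \end{align*} where $\delta$ is the Dirac delta, so integrals against the delta terms are understood distributionally (e.g. $\int_{\mathbb{R}^2}\phi(x)\psi(y)\delta(x)K_{-1}(y,y)\,dx\,dy = \phi(0)\int_{\mathbb{R}}\psi(y)K_{-1}(y,y)\,dy$).
   Formalization: The infimum is attained by the continuous integrable function φ_{G,ψ} with Fourier transform g*g; it is not claimed to be a test function, since g*g has a kink at ±1 and so φ_{G,ψ} is not Schwartz. *)

(* Defs.v *)
From HB Require Import structures.
From mathcomp Require Import all_boot all_order all_algebra.
From mathcomp Require Import all_classical all_reals all_analysis.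
Set Implicit Arguments. Unset Strict Implicit. Unset Printing Implicit Defensive.
Import Order.TTheory GRing.Theory Num.Theory.
Import numFieldNormedType.Exports.
Local Open Scope classical_set_scope.
Local Open Scope ring_scope.

Section Defs.
Variable R : realType.


Definition intR (f : R -> R) : R := Rintegral (@lebesgue_measure R) setT f.

Definition intR2 (f : R -> R -> R) : R :=
  Rintegral (@lebesgue_measure R \x @lebesgue_measure R)%E setT (fun z : R * R => f z.1 z.2).

Definition fourier_re (f : R -> R) (xi : R) : R :=
  intR (fun x => f x * cos (2 * pi * x * xi)).
Definition fourier_im (f : R -> R) (xi : R) : R :=
  intR (fun x => - (f x * sin (2 * pi * x * xi))).

Definition fourier_supp_in (f : R -> R) (a : R) : Prop :=
  forall xi, a < `|xi| -> fourier_re f xi = 0 /\ fourier_im f xi = 0.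

Definition schwartz (f : R -> R) : Prop :=
  (forall n x, derivable (derive1n n f) x 1) /\
  (forall n k, exists C : R, forall x, `|x| ^+ k * `|derive1n n f x| <= C).

Definition test_function (phi : R -> R) : Prop :=
  (forall x, 0 <= phi x) /\ (forall x, phi (- x) = phi x) /\ schwartz phi /\
  (exists a : R, fourier_supp_in phi a) /\ 0 < phi 0.

Definition K (y : R) : R := if y == 0 then 1 else sin (pi * y) / (pi * y).
Definition Keps (e : R) (x y : R) : R := K (x - y) + e * K (x + y).
Definition Wdet (e : R) (x y : R) : R :=
  Keps e x x * Keps e y y - Keps e x y * Keps e y x.

Inductive group := SOeven | SOodd | U | O | USp.

Definition W2reg (G : group) (x y : R) : R :=
  match G with
  | SOeven => Wdet 1 x y
  | SOodd => Wdet (-1) x y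
  | O => 2^-1 * Wdet 1 x y + 2^-1 * Wdet (-1) x y
  | U => Wdet 0 x y
  | USp => Wdet (-1) x y
  end.

(* coefficient of the Dirac terms  delta(x) K_{-1}(y,y) + delta(y) K_{-1}(x,x) *)
Definition W2delta (G : group) : R :=
  match G with
  | SOodd => 1
  | O => 2^-1
  | _ => 0
  end.

(* \int_{R^2} phi(x) psi(y) W_{2,G}(x,y) dx dy, delta terms distributionally *)
Definition two_level (G : group) (phi psi : R -> R) : R :=
  intR2 (fun x y => phi x * psi y * W2reg G x y) +
  W2delta G * (phi 0 * intR (fun y => psi y * Keps (-1) y y)
               + psi 0 * intR (fun x => phi x * Keps (-1) x x)).

Definition level_ratio (G : group) (phi psi : R -> R) : R :=
  (phi 0 * psi 0)^-1 * two_level G phi psi.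

Definition psi_sinc2 (y : R) : R := K y ^+ 2.

Definition c_const (G : group) : R :=
  match G with
  | USp => 2^-1
  | U => 1
  | _ => 3 / 2
  end.

Definition s3 : R := Num.sqrt 3.

Definition g_fun (G : group) (x : R) : R :=
  match G with
  | SOeven => (216 * cos (4 * x / s3) + 36 * s3 * sin (2 / s3)) /
              (162 * cos (2 / s3) - 5 * s3 * sin (2 / s3))
  | SOodd => (8 * cos (4 * x / s3) + 12 * s3 * sin (2 / s3)) /
             (11 * s3 * sin (2 / s3) + 2 * cos (2 / s3))
  | U => (6 * cos (2 * x) + 6 * sin 1) / (3 * cos 1 + 4 * sin 1)
  | O => (36 * cos (4 * x / s3) + 18 * s3 * sin (2 / s3)) /
         (18 * cos (2 / s3) + 13 * s3 * sin (2 / s3))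
  | USp => (8 * cos (4 * x) + 12 * sin 2) / (2 * cos 2 + 3 * sin 2)
  end.

Definition g_ext (G : group) (x : R) : R :=
  if (- 2^-1 <= x) && (x <= 2^-1) then g_fun G x else 0.

Definition convol (f g : R -> R) (xi : R) : R := intR (fun t => f t * g (xi - t)).

Definition is_infimum (S : set R) (v : R) : Prop :=
  (forall s, S s -> v <= s) /\ (forall w, (forall s, S s -> w <= s) -> w <= v).

End Defs.

(* Main.v *)
(* On the Fourier side the 2-level density pairs phi with c * dirac_0 + m(u), where
   c = c_const and m(u) = m0 + m1 |u| + m2 u^2.  For phi^ = gamma * gamma with gamma
   supported in [-1/2, 1/2] this is c int gamma^2 + int int m(x - t) gamma(x) gamma(t),
   while phi(0) = (int gamma)^2; since c g(x) + int m(x - t) g(t) dt = c, the choice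
   gamma = g gives the ratio c / int g.

   The lower bound does not factor phi^.  By Fejer's kernel the samples phi^(n/N)
   are the coefficients of a nonnegative cosine polynomial; Lukacs's theorem writes it
   as a sum of terms (cosine polynomial)^2 and (sine polynomial)^2, on which the
   sampled pairing is a finite quadratic form.  The sine form is nonnegative; the
   cosine form is bounded below by comparison with the samples of g, for which the
   integral equation holds up to a Riemann sum error O(1/N).  Then N tends to infinity.

   The bound is approached by Schwartz functions: multiply g by the bump
   exp (- d / (1/4 - u^2)) and let d tend to 0. *)
Require Import Defs.
From HB Require Import structures.
From mathcomp Require Import all_boot all_order all_algebra.
From mathcomp Require Import all_classical all_reals all_analysis.
From mathcomp Require Import measurable_realfun ring lra zify.
Set Implicit Arguments. Unset Strict Implicit. Unset Printing Implicit Defensive.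
Import Order.TTheory GRing.Theory Num.Theory.
Import numFieldNormedType.Exports.
Local Open Scope classical_set_scope.
Local Open Scope ring_scope.

(** * Integration on the line *)

(** A nonnegative band-limited [phi] is the square modulus of the transform of some [gamma] on
    [-1/2, 1/2] that need not be even; that is a theorem on entire functions. Sampling turns it into
    a statement on polynomials on [-1, 1], with cosine and sine squares in place of the even and the
    odd part of [gamma]. The sine squares vanish at t = 0, so they add nothing to the side that
    tends to phi(0), and their form only has to be nonnegative; the cosine squares have to reach the
    constant. On cosine coefficients of total 0 the parts m0 and m2 of the kernel cancel, and what
    is left of m1 is negative but dominated by the Dirac term. Subtracting the multiple of the
    samples of g with the same total therefore gives the bound, without spectral analysis of the
    kernel. The Riemann sum error in the integral equation costs at most a constant times
    [energy / N]. This is exactly the effect of replacing the Dirac coefficient c by c + C / N, and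
    since that coefficient multiplies phi^(0), the change disappears in the limit. *)

Section Integration.
Variable R : realType.
Implicit Types (f g h c : R -> R).

Notation mu := (@lebesgue_measure R).

Definition L1 f := mu.-integrable setT (EFin \o f).

Definition bounded_measurable c :=
  measurable_fun setT c /\ exists B, forall x, `|c x| <= B.

Lemma L1_measurable f : L1 f -> measurable_fun setT f.
Proof. by move/measurable_int/measurable_EFinP. Qed.

Lemma L1_eq f g : f =1 g -> L1 f -> L1 g.
Proof. by move=> /funext ->. Qed.

Lemma intR_eq f g : f =1 g -> intR f = intR g.
Proof. by move=> /funext ->. Qed.

Lemma L1_dom f g : measurable_fun setT f -> (forall x, `|f x| <= g x) ->
  L1 g -> L1 f.
Proof.
move=> mf fg; apply: le_integrable => //; first exact/measurable_EFinP.
move=> x _ /=; rewrite lee_fin (le_trans (fg x))// ler_norm//.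
Qed.

Lemma L1_0 : L1 (fun=> 0).
Proof. exact: integrable0. Qed.

Lemma L1Z (k : R) f : L1 f -> L1 (fun x => k * f x).
Proof. exact: integrableZl. Qed.

Lemma L1D f g : L1 f -> L1 g -> L1 (fun x => f x + g x).
Proof. exact: integrableD. Qed.

Lemma L1N f : L1 f -> L1 (fun x => - f x).
Proof. exact: integrableN. Qed.

Lemma L1B f g : L1 f -> L1 g -> L1 (fun x => f x - g x).
Proof. by move=> ? ?; apply: L1D => //; exact: L1N. Qed.

Lemma L1_norm f : L1 f -> L1 (fun x => `|f x|).
Proof. exact: integrable_norm. Qed.

Lemma L1_sum I (s : seq I) (F : I -> R -> R) :
  (forall i, L1 (F i)) -> L1 (fun x => \sum_(i <- s) F i x).
Proof.
move=> LF; elim: s => [|i s IH].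
  by apply: L1_eq L1_0 => x; rewrite big_nil.
apply: (@L1_eq (fun x => F i x + \sum_(j <- s) F j x)); last exact: L1D.
by move=> x; rewrite big_cons.
Qed.

Lemma L1_bm f c : L1 f -> bounded_measurable c -> L1 (fun x => f x * c x).
Proof.
move=> Lf [mc [B cB]].
apply: (@L1_dom _ (fun x => B * `|f x|)).
- by apply: measurable_funM => //; exact: L1_measurable.
- by move=> x; rewrite normrM mulrC ler_wpM2r.
- by apply: L1Z; exact: L1_norm.
Qed.

Lemma intRZ (k : R) f : L1 f -> intR (fun x => k * f x) = k * intR f.
Proof. by move=> Lf; rewrite /intR RintegralZl. Qed.

Lemma intRZr (k : R) f : L1 f -> intR (fun x => f x * k) = intR f * k.
Proof. by move=> Lf; rewrite /intR RintegralZr. Qed.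

Lemma intRD f g : L1 f -> L1 g -> intR (fun x => f x + g x) = intR f + intR g.
Proof. by move=> Lf Lg; rewrite /intR RintegralD. Qed.

Lemma intRB f g : L1 f -> L1 g -> intR (fun x => f x - g x) = intR f - intR g.
Proof. by move=> Lf Lg; rewrite /intR RintegralB. Qed.

Lemma intR0 : intR (fun=> 0 : R) = 0.
Proof. by rewrite /intR /Rintegral integral0. Qed.

Lemma intRN f : L1 f -> intR (fun x => - f x) = - intR f.
Proof.
move=> Lf; rewrite -mulN1r -intRZ//; apply: intR_eq => x; by rewrite mulN1r.
Qed.

Lemma intR_sum I (s : seq I) (F : I -> R -> R) :
  (forall i, L1 (F i)) ->
  intR (fun x => \sum_(i <- s) F i x) = \sum_(i <- s) intR (F i).
Proof.
move=> LF; elim: s => [|i s IH].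
  by rewrite big_nil -[RHS]intR0; apply: intR_eq => x; rewrite big_nil.
rewrite big_cons -IH -intRD//; last exact: L1_sum.
by apply: intR_eq => x; rewrite big_cons.
Qed.

Lemma intR_le f g : L1 f -> L1 g -> (forall x, f x <= g x) -> intR f <= intR g.
Proof. by move=> Lf Lg fg; apply: le_Rintegral. Qed.

Lemma intR_ge0 f : (forall x, 0 <= f x) -> 0 <= intR f.
Proof. by move=> f0; apply: Rintegral_ge0. Qed.

Lemma intR_norm f : L1 f -> `|intR f| <= intR (fun x => `|f x|).
Proof. by move=> Lf; apply: le_normr_Rintegral. Qed.

Lemma L1_fin f : L1 f -> (\int[mu]_x (f x)%:E)%E = (intR f)%:E.
Proof. by move=> Lf; rewrite /intR /Rintegral fineK//; exact: integrable_fin_num. Qed.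

Lemma intR_ae f g : L1 f -> measurable_fun setT g ->
  {ae mu, forall x, f x = g x} -> intR f = intR g.
Proof.
move=> Lf mg fg; rewrite /intR /Rintegral; congr fine.
apply: ae_eq_integral => //.
- by apply/measurable_EFinP; exact: L1_measurable.
- exact/measurable_EFinP.
- by have := @filterS _ _ (ae_filter_ringOfSetsType mu) _ _ _ fg; apply => x /= -> _.
Qed.

Lemma dct (F : nat -> R -> R) f g :
  (forall n, measurable_fun setT (F n)) ->
  {ae mu, forall x, F n x @[n --> \oo] --> f x} -> measurable_fun setT f ->
  L1 g -> (forall n x, `|F n x| <= g x) ->
  intR (F n) @[n --> \oo] --> intR f.
Proof.
move=> mF Ff mf Lg Fg.
have LF n : L1 (F n) by exact: L1_dom (Fg n) _.
have h1 : {ae mu, forall x, setT x -> (EFin \o F n) x @[n --> \oo] --> (EFin \o f) x}.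
  apply: (@filterS _ _ (ae_filter_ringOfSetsType mu)) Ff => x Fx _.
  by apply: cvg_EFin Fx; exact: nearW.
have h2 : {ae mu, forall x n, setT x -> (`|(EFin \o F n) x| <= (EFin \o g) x)%E}.
  by apply: aeW => x n _ /=; rewrite lee_fin.
have mFE n : measurable_fun setT (EFin \o F n) by exact/measurable_EFinP.
have mfE : measurable_fun setT (EFin \o f) by exact/measurable_EFinP.
have [Lf _ +] := @dominated_convergence _ _ _ mu setT measurableT (fun n => EFin \o F n) (EFin \o f) (EFin \o g) mFE mfE h1 Lg h2.
under eq_fun do rewrite /= L1_fin//.
by rewrite (L1_fin Lf); exact: fine_cvg.
Qed.

(** Cutting off by a boolean test keeps every integral on the whole line and makes
    [zext (- 2^-1) 2^-1 (g_fun G)] convertible to [g_ext G]. *)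
Definition zext (a b : R) (G : R -> R) x := if (a <= x) && (x <= b) then G x else 0.

Lemma zextE a b G : zext a b G = G \_ `[a, b].
Proof.
apply/funext => x; rewrite /zext patchE.
case: ifPn => h; first by rewrite mem_set//= in_itv.
by rewrite memNset//= in_itv/=; apply/negP.
Qed.

Lemma measurable_zext a b G : measurable_fun setT G -> measurable_fun setT (zext a b G).
Proof.
move=> mG; rewrite zextE; apply/measurable_restrict => //.
exact: measurable_funS mG.
Qed.

Lemma L1_zext a b G : continuous G -> L1 (zext a b G).
Proof.
move=> cG; rewrite /L1 zextE -restrict_EFin.
apply/(@integrable_mkcond _ _ _ mu `[a, b]%classic (EFin \o G) (measurable_itv _)).
apply: continuous_compact_integrable; first exact: segment_compact.
exact: continuous_subspaceT.
Qed.

Lemma intR_zext a b G : intR (zext a b G) = Rintegral mu `[a, b] G.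
Proof. by rewrite /intR zextE -Rintegral_mkcond. Qed.

(** The tool for all explicit integrals below. A primitive on the whole line spares any condition at
    the endpoints, and a = b is allowed. *)
Lemma FTC_zext (a b : R) (F G : R -> R) : a <= b -> continuous G ->
  (forall x : R, is_derive x 1 F (G x)) -> intR (zext a b G) = F b - F a.
Proof.
rewrite le_eqVlt => /predU1P[<-|ab] cG dF.
  by rewrite intR_zext set_itv1 Rintegral_set1 subrr.
have cF : continuous F.
  by move=> x; apply/differentiable_continuous/derivable1_diffP; have := dF x; case.
rewrite intR_zext /Rintegral (@continuous_FTC2 _ _ F)//.
- exact: continuous_subspaceT.
- split.
  + by move=> x _; have := dF x; case.
  + exact/cvg_at_right_filter/cF.
  + exact/cvg_at_left_filter/cF.
- by move=> x _; rewrite derive1E; have := dF x => -[].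
Qed.

(** Uniqueness of Lebesgue measure: only half-open intervals have to be checked. The maps it serves
    are translation and reflection. *)
Lemma pushforward_lebesgue (phi : R -> R) : measurable_fun setT phi ->
  (forall a b : R, a < b -> mu (phi @^-1` `]a, b]) = (b - a)%:E) ->
  forall A : set (measurableTypeR R), measurable A -> mu A = mu (phi @^-1` A).
Proof.
move=> mphi phiE A mA.
pose nu : {measure set (measurableTypeR R) -> \bar R} :=
  @measure_function_pushforward__canonical__measure_function_Measure _ _
    (measurableTypeR R) (measurableTypeR R) R mu phi mphi.
apply: (@lebesgue_measure_unique R nu) => // X /ocitvP[->|[[a b]/= ab ->]].
  by rewrite /= /pushforward preimage_set0 !measure0.
by rewrite /= /pushforward phiE// lebesgue_measure_itv/= lte_fin ab EFinB.
Qed.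

Lemma intR_pushforward (phi : R -> R) f : measurable_fun setT phi ->
  (forall a b : R, a < b ->
     mu (phi @^-1` `]a, b]) = (b - a)%:E) ->
  measurable_fun setT f -> L1 (f \o phi) ->
  L1 f /\ intR f = intR (f \o phi).
Proof.
move=> mphi phiE mf Lf.
have E := pushforward_lebesgue mphi phiE.
pose nu : {measure set (measurableTypeR R) -> \bar R} :=
  @measure_function_pushforward__canonical__measure_function_Measure _ _
    (measurableTypeR R) (measurableTypeR R) R mu phi mphi.
have mE : measurable_fun setT (EFin \o f) by exact/measurable_EFinP.
have iE (h : R -> \bar R) : (\int[mu]_x h x = \int[nu]_x h x)%E.
  by apply: eq_measure_integral => A mA _; exact: E.
have Lf' : L1 f.
  apply/integrableP; split => //.
  rewrite iE ge0_integral_pushforward//; last exact: measurableT_comp.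
  by have /integrableP[_] := Lf.
split => //; rewrite /intR /Rintegral iE.
by rewrite (@integral_pushforward _ _ (measurableTypeR R) (measurableTypeR R) R phi mphi mu setT (EFin \o f) mE Lf).
Qed.

Lemma intR_shift f (a : R) : L1 f ->
  L1 (fun x => f (x + a)) /\ intR (fun x => f (x + a)) = intR f.
Proof.
have ms (b : R) : measurable_fun setT (fun x : R => x + b) by exact: measurable_funD.
have E (b u v : R) : u < v -> mu ((fun x => x + b) @^-1` `]u, v]) = (v - u)%:E.
  move=> uv; rewrite (_ : _ @^-1` _ = `]u - b, v - b]%classic).
    by rewrite lebesgue_measure_itv/= lte_fin ltrD2r uv -EFinB; congr EFin; lra.
  by apply/seteqP; split=> x /=; rewrite !in_itv/= ltrBlDr lerBrDr.
move=> Lf; have mf := L1_measurable Lf.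
have [] := @intR_pushforward (fun x => x - a) (fun x => f (x + a)) (ms (- a)) (@E (- a)).
- by apply: (measurableT_comp mf); exact: ms.
- by apply: L1_eq Lf => x /=; rewrite subrK.
move=> L ->; split => //; apply: intR_eq => x /=; by rewrite subrK.
Qed.

Lemma intR_opp f : L1 f ->
  L1 (fun x => f (- x)) /\ intR (fun x => f (- x)) = intR f.
Proof.
have mo : measurable_fun setT (fun x : R => - x) by exact: measurable_funN.
have E (u v : R) : u < v -> mu ((fun x => - x) @^-1` `]u, v]) = (v - u)%:E.
  move=> uv; rewrite (_ : _ @^-1` _ = `[- v, - u[%classic).
    by rewrite lebesgue_measure_itv/= lte_fin ltrN2 uv -EFinB; congr EFin; lra.
  by apply/seteqP; split=> x /=; rewrite !in_itv/= => /andP[? ?]; apply/andP; split; lra.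
move=> Lf; have mf := L1_measurable Lf.
have [] := @intR_pushforward (fun x => - x) (fun x => f (- x)) mo E.
- exact: (measurableT_comp mf).
- by apply: L1_eq Lf => x /=; rewrite opprK.
move=> L ->; split => //; apply: intR_eq => x /=; by rewrite opprK.
Qed.

Section Fubini.
Variables (f h : R -> R) (c : R -> R -> R) (B : R).
Hypotheses (Lf : L1 f) (Lh : L1 h).
Hypothesis mc : measurable_fun setT (fun z : measurableTypeR R * measurableTypeR R => c z.1 z.2).
Hypothesis cB : forall x y, `|c x y| <= B.

Let g (z : measurableTypeR R * measurableTypeR R) : R := f z.1 * h z.2 * c z.1 z.2.

Let mfh : measurable_fun setT (fun z : measurableTypeR R * measurableTypeR R => f z.1 * h z.2).
Proof.
apply: measurable_funM.
- exact: (measurableT_comp (L1_measurable Lf) measurable_fst).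
- exact: (measurableT_comp (L1_measurable Lh) measurable_snd).
Qed.

(** Tonelli applies to [B * (f x * h y)], whose iterated absolute integral factors; the kernel [c]
    enters only through its bound. *)
Lemma integrable_prod : (mu \x mu)%E.-integrable setT (EFin \o g).
Proof.
have mg : measurable_fun setT g by exact: measurable_funM.
have : (mu \x mu)%E.-integrable setT (EFin \o (fun z : measurableTypeR R * measurableTypeR R => B * (f z.1 * h z.2))).
  apply: (@integrableZl _ _ R (mu \x mu)%E setT measurableT B (EFin \o (fun z : measurableTypeR R * measurableTypeR R => f z.1 * h z.2))).
  apply/integrable12ltyP; first exact/measurable_EFinP.
  rewrite (_ : (fun _ => _) = (fun x : R => (`|f x| * intR (fun y => `|h y|))%:E)).
    have : L1 (fun x => intR (fun y => `|h y|) * `|f x|) by apply: L1Z; exact: L1_norm.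
    move/L1_norm/integrable_lty => /(_ measurableT).
    apply: le_lt_trans; apply: ge0_le_integral => //.
    - by move=> x _; rewrite lee_fin mulr_ge0//; apply: intR_ge0 => y.
    - apply/measurable_EFinP; apply: measurable_funM => //.
      by apply: measurableT_comp => //; exact: L1_measurable.
    - apply/measurable_EFinP; apply: measurableT_comp => //; apply: measurable_funM => //.
      by apply: measurableT_comp => //; exact: L1_measurable.
    - by move=> x _; rewrite lee_fin mulrC ler_norm.
  apply/funext => x; rewrite -intRZ; last exact: L1_norm.
  rewrite -L1_fin; last by apply: L1Z; exact: L1_norm.
  by apply: eq_integral => y _; rewrite /= normrM.
apply: le_integrable => //; first exact/measurable_EFinP.
move=> [x y] _ /=; rewrite lee_fin /g /= normrM normrM mulrC normrM -normrM ler_wpM2r//.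
by rewrite (le_trans (cB _ _))// ler_norm.
Qed.

Let L1_fst x : L1 (fun y => h y * c x y).
Proof.
apply: L1_bm => //; split; last by exists B.
by have := measurableT_comp mc (@measurable_pair1 _ _ (measurableTypeR R) (measurableTypeR R) x).
Qed.

Let L1_snd y : L1 (fun x => f x * c x y).
Proof.
apply: L1_bm => //; split; last by exists B.
by have := measurableT_comp mc (@measurable_pair2 _ _ (measurableTypeR R) (measurableTypeR R) y).
Qed.

Let F1 x : (\int[mu]_y (g (x, y))%:E)%E = (f x * intR (fun y => h y * c x y))%:E.
Proof.
rewrite -intRZ// -L1_fin; last exact: L1Z.
by apply: eq_integral => y _; rewrite /g/= mulrA.
Qed.

Let F2 y : (\int[mu]_x (g (x, y))%:E)%E = (h y * intR (fun x => f x * c x y))%:E.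
Proof.
rewrite -intRZ// -L1_fin; last exact: L1Z.
by apply: eq_integral => x _; rewrite /g/= mulrA (mulrC (f x)).
Qed.

Lemma L1_fubini : L1 (fun x => f x * intR (fun y => h y * c x y)).
Proof.
have := integrable_fubini_F integrable_prod.
have -> : fubini_F mu (EFin \o g) = EFin \o (fun x => f x * intR (fun y => h y * c x y)).
  by apply/funext => x; rewrite /fubini_F /= -F1.
by [].
Qed.

Lemma intR2_fubini : intR2 (fun x y => f x * h y * c x y) =
  intR (fun x => f x * intR (fun y => h y * c x y)).
Proof.
rewrite /intR2 /Rintegral -(integral12_prod_meas1 integrable_prod) /intR /Rintegral.
by congr fine; apply: eq_integral => x _; rewrite /fubini_F /= -F1.
Qed.

Lemma fubini_swap : intR (fun x => f x * intR (fun y => h y * c x y)) =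
  intR (fun y => h y * intR (fun x => f x * c x y)).
Proof.
rewrite -intR2_fubini /intR2 /Rintegral -(integral21_prod_meas1 integrable_prod) /intR /Rintegral.
by congr fine; apply: eq_integral => y _; rewrite /fubini_G /= -F2.
Qed.

End Fubini.


Lemma ae_seq (s : seq R) (P : R -> Prop) :
  (forall x, x \notin s -> P x) -> {ae mu, forall x, P x}.
Proof.
move=> sP; have cs : countable [set` s] by exact: finite_set_countable.
exists [set` s]; split.
- exact: countable_measurable.
- exact: countable_lebesgue_measure0.
- by move=> x /= /(contra_not (sP x)) /negP; rewrite negbK.
Qed.

Lemma intR_seq (s : seq R) f g : L1 f -> measurable_fun setT g ->
  (forall x, x \notin s -> f x = g x) -> intR f = intR g.
Proof. by move=> Lf mg fg; apply: intR_ae => //; exact: ae_seq fg. Qed.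

Lemma cvgn_ge (u : nat -> R) (a c : R) :
  u n @[n --> \oo] --> a -> (forall n, c <= u n) -> c <= a.
Proof.
move=> ua uc; apply: (ler_cvg_to (cvg_cst c) ua); exact: nearW.
Qed.

(** Monotone convergence as an integrability criterion, for functions without a majorant known
    beforehand: the Cauchy density and nonnegative transforms. *)
Lemma mct_L1 (F : nat -> R -> R) f (C : R) :
  (forall n, L1 (F n)) -> (forall n x, 0 <= F n x) ->
  (forall x, nondecreasing_seq (F ^~ x)) ->
  (forall x, F n x @[n --> \oo] --> f x) -> measurable_fun setT f ->
  (forall n, intR (F n) <= C) -> L1 f.
Proof.
move=> LF F0 ndF Ff mf FC.
have f0 x : 0 <= f x.
  exact: cvgn_ge (Ff x) _.
apply/integrableP; split; first exact/measurable_EFinP.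
have mFE n : measurable_fun setT (EFin \o F n).
  by apply/measurable_EFinP; exact: L1_measurable.
have lE x : limn (fun n => (F n x)%:E) = `|(f x)%:E|%E.
  rewrite /= ger0_norm//; apply/cvg_lim => //.
  by apply: cvg_EFin (Ff x); exact: nearW.
have := @monotone_convergence _ (measurableTypeR R) R mu setT measurableT
  (fun n => EFin \o F n) mFE _ _.
under eq_integral do rewrite lE.
move=> -> //; last 2 first.
- by move=> n x _; rewrite lee_fin.
- by move=> x _ m n mn; rewrite lee_fin; exact: ndF.
have h n : (\int[mu]_x (F n x)%:E <= C%:E)%E by rewrite L1_fin// lee_fin.
apply: (@le_lt_trans _ _ C%:E); last by rewrite ltry.
apply: lime_le; last exact: nearW.
apply: ereal_nondecreasing_is_cvgn => m n mn; apply: ge0_le_integral => //.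
- by move=> x _; rewrite lee_fin.
- exact: mFE.
- exact: mFE.
- by move=> x _; rewrite lee_fin; exact: ndF.
Qed.

Lemma zext_cvg f x : zext (- n%:R) n%:R f x @[n --> \oo] --> f x.
Proof.
apply: cvg_near_cst; near=> n.
have xn : `|x| <= n%:R.
  by near: n; exact: nbhs_infty_ger.
by rewrite /zext -ler_norml xn.
Unshelve. all: by end_near. Qed.

Lemma zext0_cvg f x :
  zext 0 n%:R f x @[n --> \oo] --> (if 0 <= x then f x else 0).
Proof.
apply: cvg_near_cst; near=> n.
have xn : `|x| <= n%:R.
  by near: n; exact: nbhs_infty_ger.
by rewrite /zext (le_trans (ler_norm x) xn) andbT.
Unshelve. all: by end_near. Qed.

Lemma norm_zext_le a b f x : `|zext a b f x| <= `|f x|.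
Proof. by rewrite /zext; case: ifP => // _; rewrite normr0. Qed.

Lemma intR_zext_cvg f : L1 f -> intR (zext (- n%:R) n%:R f) @[n --> \oo] --> intR f.
Proof.
move=> Lf; apply: (dct (g := fun x => `|f x|)).
- by move=> n; apply: measurable_zext; exact: L1_measurable.
- by apply: aeW => x; exact: zext_cvg.
- exact: L1_measurable.
- exact: L1_norm.
- by move=> n x; exact: norm_zext_le.
Qed.

Lemma measurable_half f : measurable_fun setT f ->
  measurable_fun setT (fun x : R => if 0 <= x then f x else 0).
Proof.
move=> mf; apply: measurable_fun_ifT => //.
exact: measurable_fun_ler.
Qed.

Lemma intR_zext0_cvg f : L1 f -> intR (zext 0 n%:R f) @[n --> \oo] -->
  intR (fun x : R => if 0 <= x then f x else 0).
Proof.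
move=> Lf; apply: (dct (g := fun x => `|f x|)).
- by move=> n; apply: measurable_zext; exact: L1_measurable.
- by apply: aeW => x; exact: zext0_cvg.
- by apply: measurable_half; exact: L1_measurable.
- exact: L1_norm.
- by move=> n x; exact: norm_zext_le.
Qed.

Lemma intR_even f : L1 f -> (forall x, f (- x) = f x) ->
  intR f = 2 * intR (fun x : R => if 0 <= x then f x else 0).
Proof.
move=> Lf ef; set f0 := (fun x : R => if 0 <= x then f x else 0).
have mf0 : measurable_fun setT f0 by apply: measurable_half; exact: L1_measurable.
have Lf0 : L1 f0.
  apply: L1_dom (L1_norm Lf) => //.
  by move=> x; rewrite /f0; case: ifP => // _; rewrite normr0.
have [Lf0' f0E] := intR_opp Lf0.
rewrite mulr_natl mulr2n -{2}f0E -intRD//.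
apply: (@intR_seq [:: 0]) => //; first by apply: L1_measurable; exact: (L1D Lf0 Lf0').
move=> x; rewrite inE => x0; rewrite /f0 oppr_ge0 ef.
by have := x0; case: ltgtP => // _ _; rewrite ?addr0 ?add0r.
Qed.

End Integration.

(** * Fourier inversion for even functions *)

Section Continuity.
Variable R : realType.
Implicit Types f g : R -> R.

Lemma contM f g : continuous f -> continuous g -> continuous (fun x => f x * g x).
Proof. by move=> cf cg x; apply: cvgM; [exact: cf|exact: cg]. Qed.

Lemma contD f g : continuous f -> continuous g -> continuous (fun x => f x + g x).
Proof. by move=> cf cg x; apply: cvgD; [exact: cf|exact: cg]. Qed.

Lemma contN f : continuous f -> continuous (fun x => - f x).
Proof. by move=> cf x; apply: cvgN; exact: cf. Qed.

Lemma contX f n : continuous f -> continuous (fun x => f x ^+ n).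
Proof. by move=> cf x; apply: (@continuous_comp _ _ _ f (fun y => y ^+ n)); [exact: cf|exact: exprn_continuous]. Qed.

Lemma contV f : continuous f -> (forall x, f x != 0) -> continuous (fun x => (f x)^-1).
Proof. by move=> cf f0 x; apply: cvgV => //; exact: cf. Qed.

Lemma cont_comp (h : R -> R) f : continuous h -> continuous f -> continuous (fun x => h (f x)).
Proof. by move=> ch cf x; apply: continuous_comp; [exact: cf|exact: ch]. Qed.

Lemma cont_cos f : continuous f -> continuous (fun x => cos (f x)).
Proof. by apply: cont_comp; exact: continuous_cos. Qed.

Lemma cont_sin f : continuous f -> continuous (fun x => sin (f x)).
Proof. by apply: cont_comp; exact: continuous_sin. Qed.

Lemma cont_exp f : continuous f -> continuous (fun x => expR (f x)).
Proof. by apply: cont_comp; exact: continuous_expR. Qed.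

Lemma cont_norm f : continuous f -> continuous (fun x => `|f x|).
Proof. by apply: (@cont_comp Num.norm); exact: norm_continuous. Qed.

Lemma cont_cst (c : R) : continuous (fun _ : R => c).
Proof. exact: cst_continuous. Qed.

Lemma cont_id : continuous (fun x : R => x).
Proof. by move=> x; exact: cvg_id. Qed.

Lemma derive_cont f : (forall x, derivable f x 1) -> continuous f.
Proof. by move=> df x; apply/differentiable_continuous/derivable1_diffP. Qed.

End Continuity.

Ltac cont := lazymatch goal with
  | |- forall x, continuous_at x (fun _ => ?c) => exact: cont_cst
  | |- forall x, continuous_at x (fun y => y) => exact: cont_id
  | |- forall x, continuous_at x (fun y => @?f y + @?g y) =>
      refine (@contD _ f g _ _); cont
  | |- forall x, continuous_at x (fun y => @?f y * @?g y) =>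
      refine (@contM _ f g _ _); cont
  | |- forall x, continuous_at x (fun y => - @?f y) => refine (@contN _ f _); cont
  | |- forall x, continuous_at x (fun y => @?f y ^+ ?n) => refine (@contX _ f n _); cont
  | |- forall x, continuous_at x (fun y => `| @?f y |) => refine (@cont_norm _ f _); cont
  | |- forall x, continuous_at x (fun y => cos (@?f y)) => refine (@cont_cos _ f _); cont
  | |- forall x, continuous_at x (fun y => sin (@?f y)) => refine (@cont_sin _ f _); cont
  | |- forall x, continuous_at x (fun y => expR (@?f y)) => refine (@cont_exp _ f _); cont
  | |- forall x, continuous_at x (+%R ?a) =>
      refine (@contD _ (fun _ => a) (fun y => y) _ _); cont
  | |- forall x, continuous_at x ( *%R ?a) =>
      refine (@contM _ (fun _ => a) (fun y => y) _ _); cont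
  | _ => idtac
  end.

Section Fourier.
Variable R : realType.
Implicit Types (f g h c : R -> R).
Notation mu := (@lebesgue_measure R).

Lemma bm_cont c B : continuous c -> (forall x, `|c x| <= B) -> bounded_measurable c.
Proof. by move=> cc cB; split; [exact: continuous_measurable_fun|exists B]. Qed.

Lemma bm_cosx (xi : R) : bounded_measurable (fun x => cos (2 * pi * x * xi)).
Proof. by apply: (@bm_cont _ 1); [cont|move=> x; exact: cos_max]. Qed.

Lemma bm_sinx (xi : R) : bounded_measurable (fun x => sin (2 * pi * x * xi)).
Proof. by apply: (@bm_cont _ 1); [cont|move=> x; exact: sin_max]. Qed.

Lemma L1_cosx f xi : L1 f -> L1 (fun x => f x * cos (2 * pi * x * xi)).
Proof. by move=> Lf; apply: L1_bm => //; exact: bm_cosx. Qed.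

Lemma L1_sinx f xi : L1 f -> L1 (fun x => f x * sin (2 * pi * x * xi)).
Proof. by move=> Lf; apply: L1_bm => //; exact: bm_sinx. Qed.

Lemma fourier_re_even f xi : fourier_re f (- xi) = fourier_re f xi.
Proof. by apply: intR_eq => x; rewrite mulrN cosN. Qed.

Lemma fourier_re_le f xi : L1 f -> `|fourier_re f xi| <= intR (fun x => `|f x|).
Proof.
move=> Lf; apply: le_trans (intR_norm (L1_cosx xi Lf)) _.
apply: intR_le; [exact/L1_norm/L1_cosx|exact: L1_norm|].
by move=> x; rewrite normrM ler_piMr// cos_max.
Qed.

Lemma fourier_re_cont f : L1 f -> continuous (fourier_re f).
Proof.
move=> Lf a; apply/(@cvg_nbhsP _ R^o) => w wa.
apply: (dct (g := fun x => `|f x|)).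
- by move=> n; apply: L1_measurable; exact: L1_cosx.
- apply: aeW => x; apply: cvgM; first exact: cvg_cst.
  have cc : continuous (fun y => cos (2 * pi * x * y)) by cont.
  exact: (cvg_comp _ _ wa (cc a)).
- by apply: L1_measurable; exact: L1_cosx.
- exact: L1_norm.
- by move=> n x; rewrite normrM ler_piMr// cos_max.
Qed.

Lemma fourier_im_even f xi : L1 f -> (forall x, f (- x) = f x) -> fourier_im f xi = 0.
Proof.
move=> Lf ef; rewrite /fourier_im intRN; last exact: L1_sinx.
have [_] := intR_opp (L1_sinx xi Lf).
under intR_eq do rewrite ef mulrN mulNr sinN mulrN.
rewrite intRN; last exact: L1_sinx.
by move=> /eqP; rewrite eqNr => /eqP ->; rewrite oppr0.
Qed.

Lemma measurable_cosxy : measurable_fun setT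
  (fun z : measurableTypeR R * measurableTypeR R => cos (2 * pi * z.1 * z.2)).
Proof.
have mcos : measurable_fun setT (@cos R) by apply: continuous_measurable_fun; exact: continuous_cos.
apply: (measurableT_comp mcos).
apply: measurable_funM; last exact: measurable_snd.
by apply: measurable_funM; last exact: measurable_fst.
Qed.

(** Both sides are iterated integrals of [f x * h y * cos (2 * pi * x * y)], whose kernel is
    symmetric. *)
Lemma fourier_mult f h : L1 f -> L1 h ->
  intR (fun x => f x * fourier_re h x) = intR (fun x => h x * fourier_re f x).
Proof.
move=> Lf Lh.
have := @fubini_swap _ f h (fun x y => cos (2 * pi * x * y)) 1 Lf Lh measurable_cosxy (fun x y => cos_max _).
rewrite /fourier_re => E; rewrite -E; apply: intR_eq => x; congr (_ * _).
by apply: intR_eq => y; rewrite mulrAC.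
Qed.

(** Evenness kills the sine half of the addition formula. This is how translations and phases are
    handled with cosine transforms alone. *)
Lemma cosD_even f (a xi : R) : L1 f -> (forall x, f (- x) = f x) ->
  intR (fun x => f x * cos (2 * pi * x * xi + a)) = cos a * fourier_re f xi.
Proof.
move=> Lf ef.
transitivity (intR (fun x => cos a * (f x * cos (2 * pi * x * xi)) -
                             sin a * (f x * sin (2 * pi * x * xi)))).
  by apply: intR_eq => x; rewrite cosD; ring.
rewrite intRB; [|exact/L1Z/L1_cosx|exact/L1Z/L1_sinx].
rewrite !intRZ; [|exact: L1_sinx|exact: L1_cosx].
have := fourier_im_even xi Lf ef; rewrite /fourier_im intRN; last exact: L1_sinx.
by move=> /eqP; rewrite oppr_eq0 => /eqP ->; rewrite mulr0 subr0.
Qed.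

End Fourier.

(** * Abel means and the Poisson kernel *)

Section AbelPoisson.
Variable R : realType.
Implicit Types (f g h c : R -> R) (e x y d u k xi : R).
Notation mu := (@lebesgue_measure R).

Lemma zext_nondecreasing f (x : R) : (forall y, 0 <= f y) ->
  nondecreasing_seq (fun n => zext (- n%:R) n%:R f x).
Proof.
move=> f0 m n mn; rewrite /zext -!ler_norml.
case: (leP `|x| m%:R) => h; last by case: ifP.
by rewrite (le_trans h)// ler_nat.
Qed.

Lemma cont_cauchy : continuous (fun y : R => (1 + y ^+ 2)^-1).
Proof.
by apply: contV; [cont|move=> y; rewrite gt_eqF// ltr_pwDl// sqr_ge0].
Qed.

Lemma L1_cauchy : L1 (fun y : R => (1 + y ^+ 2)^-1).
Proof.
have q0 (y : R) : 0 <= (1 + y ^+ 2)^-1 by rewrite invr_ge0 addr_ge0// sqr_ge0.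
apply: (@mct_L1 _ (fun n => zext (- n%:R) n%:R (fun y => (1 + y ^+ 2)^-1)) _ pi).
- by move=> n; apply: L1_zext; exact: cont_cauchy.
- by move=> n x; rewrite /zext; case: ifP.
- by move=> x; exact: zext_nondecreasing.
- by move=> x; exact: zext_cvg.
- by apply: continuous_measurable_fun; exact: cont_cauchy.
- move=> n; rewrite (@FTC_zext _ _ _ (@atan R))//; last exact: cont_cauchy.
    rewrite atanN opprK; have := atan_ltpi2 (n%:R : R); lra.
  by rewrite -subr_ge0 opprK addr_ge0.
Qed.

Lemma cvg_invn : (n%:R : R)^-1 @[n --> \oo] --> (0 : R).
Proof.
apply/(@gtr0_cvgV0 R _ _ _ (fun n : nat => n%:R : R)); last exact: cvgr_idn.
by near=> n; near: n; exact: nbhs_infty_gtr.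
Unshelve. all: by end_near. Qed.

(** The summation factor for inversion. Its transform is rational with an [atan] primitive, so the
    total mass 1 of that transform is an elementary limit. *)
Definition abel (e u : R) := expR (- (e * `|u|)).

Lemma abel_cont e : continuous (abel e).
Proof. by rewrite /abel; cont. Qed.

Lemma abel_ge0 e u : 0 <= abel e u.
Proof. exact: expR_ge0. Qed.

Lemma abel_le1 e u : 0 < e -> abel e u <= 1.
Proof. by move=> e0; rewrite expR_le1 oppr_le0 mulr_ge0// ltW. Qed.

Lemma L1_abel e : 0 < e -> L1 (abel e).
Proof.
move=> e0; apply: (@L1_dom _ _ (fun u => (1 + 4 / e ^+ 2) * (1 + u ^+ 2)^-1)).
- by apply: continuous_measurable_fun; exact: abel_cont.
- move=> u; rewrite ger0_norm ?abel_ge0//.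
  have u2 : 0 < 1 + u ^+ 2 by rewrite ltr_pwDl// sqr_ge0.
  have e2 : 0 < e ^+ 2 by rewrite exprn_gt0.
  rewrite /abel expRN ler_pdivlMr// mulrC ler_pdivrMr ?expR_gt0//.
  have t0 : 0 <= e * `|u| by rewrite mulr_ge0// ltW.
  (* Squaring [1 + s / 2 <= expR (s / 2)] gives quadratic growth of the exponential, enough for a
     comparison with the Cauchy density. *)
  have h : 1 + (e * `|u|) ^+ 2 / 4 <= expR (e * `|u|).
    rewrite [e * `|u| in leRHS]splitr expRD -expr2.
    have := expR_ge1Dx (e * `|u| / 2) => h1.
    apply: (@le_trans _ _ ((1 + e * `|u| / 2) ^+ 2)).
      rewrite -subr_ge0 (_ : _ - _ = e * `|u|)//; by field.
    by rewrite lerXn2r// nnegrE ?expR_ge0// addr_ge0// divr_ge0.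
  apply: le_trans (ler_wpM2l _ h); last by rewrite addr_ge0// divr_ge0// ltW.
  rewrite exprMn real_normK ?num_real//.
  rewrite -subr_ge0 (_ : _ - _ = e ^+ 2 * u ^+ 2 / 4 + 4 / e ^+ 2).
    have eu : 0 <= e ^+ 2 * u ^+ 2 by apply: mulr_ge0; exact: sqr_ge0.
    by apply: addr_ge0; apply: divr_ge0 => //; exact: ltW.
  by field; rewrite gt_eqF.
- by apply: L1Z; exact: L1_cauchy.
Qed.

(** The primitive is the real part of [exp ((- e + i k) u) / (- e + i k)]. *)
Lemma is_derive_abel (e k u : R) : 0 < e ->
  is_derive u 1 (fun u => expR (- (e * u)) * (k * sin (k * u) - e * cos (k * u)) / (e ^+ 2 + k ^+ 2))
    (expR (- (e * u)) * cos (k * u)).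
Proof.
move=> e0; have d0 : e ^+ 2 + k ^+ 2 != 0 by rewrite gt_eqF// ltr_pwDl ?sqr_ge0// exprn_gt0.
apply: is_derive_eq.
rewrite /GRing.scale /=; field; exact: d0.
Qed.

Lemma fourier_abel e x : 0 < e ->
  fourier_re (abel e) x = 2 * e / (e ^+ 2 + (2 * pi * x) ^+ 2).
Proof.
move=> e0; set k := 2 * pi * x.
have d0 : e ^+ 2 + k ^+ 2 != 0 by rewrite gt_eqF// ltr_pwDl ?sqr_ge0// exprn_gt0.
pose f u := abel e u * cos (2 * pi * u * x).
have Lf : L1 f by apply: L1_cosx; exact: L1_abel.
have ff : f =1 fun u => abel e u * cos (k * u).
  by move=> u; rewrite /f /k; congr (_ * cos _); ring.
rewrite /fourier_re (@intR_even _ f)//; last first.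
  by move=> u; rewrite !ff /abel normrN mulrN cosN.
have := intR_zext0_cvg Lf.
set I := intR _ => If.
suff IE : (fun n => intR (zext 0 n%:R f)) @ \oo --> e / (e ^+ 2 + k ^+ 2).
  by rewrite (cvg_unique _ If IE)// mulrA.
pose F u := expR (- (e * u)) * (k * sin (k * u) - e * cos (k * u)) / (e ^+ 2 + k ^+ 2).
have E n : intR (zext 0 n%:R f) = F n%:R - F 0.
  transitivity (intR (zext 0 n%:R (fun u => expR (- (e * u)) * cos (k * u)))).
    apply: intR_eq => u; rewrite /zext; case: ifP => // /andP[u0 _].
    by rewrite ff /abel ger0_norm.
  apply: FTC_zext => //; first by cont.
  by move=> u; exact: is_derive_abel.
under eq_fun do rewrite E.
have -> : e / (e ^+ 2 + k ^+ 2) = 0 - F 0.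
  by rewrite /F !mulr0 sin0 cos0 oppr0 expR0; field.
apply: cvgB; last exact: cvg_cst.
pose C := (`|k| + e) / (e ^+ 2 + k ^+ 2).
have dp : 0 < e ^+ 2 + k ^+ 2 by rewrite ltr_pwDl ?sqr_ge0// exprn_gt0.
apply: (@squeeze_cvgr _ _ _ _ (fun n : nat => - (C / e * (n%:R)^-1))
   (fun n : nat => C / e * (n%:R)^-1)).
- near=> n; rewrite -ler_norml /F normrM normfV (gtr0_norm dp) normrM ger0_norm ?expR_ge0//.
  have n0 : 0 < n%:R :> R by near: n; exact: nbhs_infty_gtr.
  have h1 : expR (- (e * n%:R)) <= e^-1 * n%:R^-1.
    rewrite -invfM expRN lef_pV2 ?posrE ?expR_gt0 ?mulr_gt0//.
    by apply: le_trans (expR_ge1Dx _); rewrite lerDr.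
  have h2 : `|k * sin (k * n%:R) - e * cos (k * n%:R)| <= `|k| + e.
    apply: le_trans (ler_normB _ _) _; rewrite (normrM k) (normrM e) (gtr0_norm e0).
    by apply: lerD; rewrite ler_piMr// ?sin_max ?cos_max// ltW.
  rewrite /C (_ : _ / e / _ = e^-1 / n%:R * (`|k| + e) / (e ^+ 2 + k ^+ 2)); last by ring.
  rewrite ler_wpM2r ?invr_ge0 ?(ltW dp)//.
  by apply: ler_pM => //; exact: expR_ge0.
- rewrite -[X in _ --> X]oppr0 -[X in - X](mulr0 (C / e)).
  by apply: cvgN; apply: cvgM; [exact: cvg_cst|exact: cvg_invn].
- rewrite -[X in _ --> X](mulr0 (C / e)).
  by apply: cvgM; [exact: cvg_cst|exact: cvg_invn].
Unshelve. all: by end_near. Qed.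
Lemma pi_ge1 : 1 <= (pi : R).
Proof. by apply: le_trans (pi_ge2 R); rewrite ler1n. Qed.

Lemma twopi_sq_ge1 : 1 <= (2 * pi : R) ^+ 2.
Proof.
rewrite -[leLHS](expr1n _ 2) lerXn2r ?nnegrE ?mulr_ge0 ?pi_ge0//.
by have := pi_ge1; lra.
Qed.

Definition poisson (e y : R) := 2 * e / (e ^+ 2 + (2 * pi * y) ^+ 2).

Lemma poisson_den_gt0 e y : 0 < e -> 0 < e ^+ 2 + (2 * pi * y) ^+ 2.
Proof. by move=> e0; rewrite ltr_pwDl ?sqr_ge0// exprn_gt0. Qed.

Lemma poisson_ge0 e y : 0 < e -> 0 <= poisson e y.
Proof. by move=> e0; rewrite divr_ge0 ?mulr_ge0 ?(ltW e0)// ltW// poisson_den_gt0. Qed.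

Lemma poisson_cont e : 0 < e -> continuous (poisson e).
Proof.
move=> e0; rewrite /poisson; cont; apply: contV; first by cont.
by move=> y; rewrite gt_eqF// poisson_den_gt0.
Qed.

Lemma L1_poisson e : 0 < e -> L1 (poisson e).
Proof.
move=> e0; apply: (@L1_dom _ _ (fun y => (2 / e + 2 * e) * (1 + y ^+ 2)^-1)).
- by apply: continuous_measurable_fun; exact: poisson_cont.
- move=> y; rewrite ger0_norm ?poisson_ge0//.
  have u2 : 0 < 1 + y ^+ 2 by rewrite ltr_pwDl// sqr_ge0.
  rewrite ler_pdivrMr ?poisson_den_gt0// mulrAC ler_pdivlMr//.
  have p1 := pi_ge1.
  have p3 := twopi_sq_ge1.
  have : 0 <= ((2 * pi) ^+ 2 - 1) * (2 * e * y ^+ 2).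
    by apply: mulr_ge0; rewrite ?subr_ge0//; apply: mulr_ge0; rewrite ?sqr_ge0// mulr_ge0// ltW.
  have : 0 <= 2 * e * e ^+ 2 by apply: mulr_ge0; rewrite ?sqr_ge0// mulr_ge0// ltW.
  have : 0 <= 2 / e * ((2 * pi) ^+ 2 * y ^+ 2).
    by apply: mulr_ge0; [rewrite divr_ge0// ltW|apply: mulr_ge0; exact: sqr_ge0].
  have -> : (2 / e + 2 * e) * (e ^+ 2 + (2 * pi * y) ^+ 2) = 2 * e + 2 * e * e ^+ 2 +
    2 / e * ((2 * pi) ^+ 2 * y ^+ 2) + 2 * e * ((2 * pi) ^+ 2 * y ^+ 2).
    by field; rewrite gt_eqF.
  set a := (2 * pi) ^+ 2; lra.
- by apply: L1Z; exact: L1_cauchy.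
Qed.

Lemma is_derive_poisson (e y : R) : 0 < e ->
  is_derive y 1 (fun y => pi^-1 * atan (2 * pi / e * y)) (poisson e y).
Proof.
move=> e0; have := poisson_den_gt0 y e0; have := pi_gt0 R.
rewrite /poisson; move: (pi) => p p0 d0.
apply: is_derive_eq; rewrite /GRing.scale /=; field.
by rewrite !gt_eqF.
Qed.

Lemma intR_poisson e : 0 < e -> intR (poisson e) = 1.
Proof.
move=> e0; have If := intR_zext_cvg (L1_poisson e0).
have E n : intR (zext (- n%:R) n%:R (poisson e)) = 2 / pi * atan (2 * pi / e * n%:R).
  have nn : - n%:R <= n%:R :> R by rewrite -subr_ge0 opprK addr_ge0.
  rewrite (FTC_zext nn (poisson_cont e0) (fun y => is_derive_poisson y e0)).
  by rewrite mulrN atanN; ring.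
have p0 := pi_gt0 R.
have C : 2 / pi * atan (2 * pi / e * n%:R) @[n --> \oo] --> 2 / pi * (pi / 2).
  apply: cvgM; first exact: cvg_cst.
  apply: (@cvg_comp _ _ _ (fun n : nat => 2 * pi / e * n%:R) (@atan R) _ _ _ _ (@cvgy_atan R)).
  have M0 : 0 < 2 * pi / e by rewrite divr_gt0// mulr_gt0.
  exact: (cvg_comp _ _ cvgr_idn (gt0_cvgMry M0 cvg_id)).
move: If; under eq_fun do rewrite E; move=> If.
rewrite (cvg_unique _ If C)//.
by move: (pi) p0 => p p0; field; rewrite gt_eqF.
Qed.

(** Away from 0 the kernel is [e] times a fixed integrable function, so its tail vanishes with
    [e]. *)
Lemma poisson_le e y d : 0 < e -> 0 < d -> d <= `|y| ->
  poisson e y <= e * ((2 + 2 / d ^+ 2) * (1 + y ^+ 2)^-1).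
Proof.
move=> e0 d0 dy; have p1 := pi_ge1.
have u2 : 0 < 1 + y ^+ 2 by rewrite ltr_pwDl// sqr_ge0.
have d2 : 0 < d ^+ 2 by rewrite exprn_gt0.
have dy2 : d ^+ 2 <= y ^+ 2 by rewrite -[leRHS]real_normK ?num_real// lerXn2r ?nnegrE// ltW.
have y2 : 0 < y ^+ 2 by apply: lt_le_trans dy2.
have -> : poisson e y = e * (2 / (e ^+ 2 + (2 * pi * y) ^+ 2)) by rewrite /poisson; ring.
rewrite ler_pM2l//.
rewrite ler_pdivrMr ?poisson_den_gt0// mulrAC ler_pdivlMr//.
apply: (@le_trans _ _ ((2 + 2 / d ^+ 2) * (y ^+ 2))).
  have : 1 <= y ^+ 2 / d ^+ 2 by rewrite ler_pdivlMr// mul1r.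
  have -> : (2 + 2 / d ^+ 2) * y ^+ 2 = 2 * y ^+ 2 + 2 * (y ^+ 2 / d ^+ 2) by ring.
  lra.
rewrite ler_pM2l; last by rewrite addr_gt0// divr_gt0.
have : 0 <= e ^+ 2 := sqr_ge0 e.
have : 0 <= ((2 * pi) ^+ 2 - 1) * y ^+ 2.
  by rewrite mulr_ge0 ?sqr_ge0// subr_ge0 twopi_sq_ge1.
by rewrite (exprMn _ (2 * pi) y); set a := (2 * pi) ^+ 2; lra.
Qed.

Lemma poisson_approx f B (e : nat -> R) : L1 f -> (forall x, `|f x| <= B) ->
  {for 0, continuous f} -> (forall n, 0 < e n) -> e n @[n --> \oo] --> 0 ->
  intR (fun y => f y * poisson (e n) y) @[n --> \oo] --> f 0.
Proof.
move=> Lf fB cf e0 ecv; apply/cvgrPdist_le => eta eta0.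
have eta2 : 0 < eta / 2 by rewrite divr_gt0.
have /cvgrPdist_le/(_ _ eta2) := cf.
rewrite near_nbhs => -[d /= d0 dP].
pose Q := intR (fun y : R => (2 + 2 / d ^+ 2) * (1 + y ^+ 2)^-1).
have LQ : L1 (fun y : R => (2 + 2 / d ^+ 2) * (1 + y ^+ 2)^-1) by apply: L1Z; exact: L1_cauchy.
have Q0 : 0 <= Q.
  apply: intR_ge0 => y; rewrite mulr_ge0 ?addr_ge0 ?divr_ge0 ?sqr_ge0 ?invr_ge0//.
  by rewrite addr_ge0// sqr_ge0.
have B0 : 0 <= B by apply: le_trans (fB 0).
have : (2 * B * Q) * e n @[n --> \oo] --> 0.
  rewrite -[X in _ --> X](mulr0 (2 * B * Q)); apply: cvgM => //; exact: cvg_cst.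
move=> /cvgrPdist_le/(_ _ eta2) H.
near=> n.
have en0 := e0 n.
have LP := L1_poisson en0.
have LfP : L1 (fun y => f y * poisson (e n) y).
  apply: (@L1_dom _ _ (fun y => B * poisson (e n) y)); last exact: L1Z.
    by apply: measurable_funM; apply: L1_measurable.
  by move=> y; rewrite normrM (ger0_norm (poisson_ge0 _ _))// ler_wpM2r// poisson_ge0.
have -> : f 0 - intR (fun y => f y * poisson (e n) y) =
    intR (fun y => f 0 * poisson (e n) y - f y * poisson (e n) y).
  by rewrite intRB//; [rewrite intRZ// intR_poisson// mulr1|exact: L1Z].
apply: le_trans (intR_norm _) _; first by apply: L1B => //; exact: L1Z.
(* One majorant serves both regions: the first term covers [|y| < d] by continuity at 0, the second
   covers [d <= |y|] by [poisson_le]. *)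
apply: (@le_trans _ _ (intR (fun y => eta / 2 * poisson (e n) y +
    2 * B * (e n * ((2 + 2 / d ^+ 2) * (1 + y ^+ 2)^-1))))).
  apply: intR_le.
  - by apply: L1_norm; apply: L1B => //; exact: L1Z.
  - by apply: L1D; [exact: L1Z|do 2 apply: L1Z].
  - move=> y; rewrite -mulrBl normrM (ger0_norm (poisson_ge0 _ _))//.
    have c0 : 0 <= (2 + 2 / d ^+ 2) / (1 + y ^+ 2).
      by rewrite divr_ge0 ?addr_ge0 ?divr_ge0 ?sqr_ge0.
    have [dy|yd] := leP d `|y|.
      apply: (@le_trans _ _ (2 * B * poisson (e n) y)).
        rewrite ler_wpM2r ?poisson_ge0//.
        by apply: le_trans (ler_normB _ _) _; have := fB 0; have := fB y; lra.
      apply: (@le_trans _ _ (2 * B * (e n * ((2 + 2 / d ^+ 2) / (1 + y ^+ 2))))).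
        by rewrite ler_wpM2l ?mulr_ge0// poisson_le.
      by rewrite lerDr mulr_ge0 ?poisson_ge0// ltW.
    apply: (@le_trans _ _ (eta / 2 * poisson (e n) y)).
      rewrite ler_wpM2r ?poisson_ge0//; apply: dP => /=.
      by rewrite sub0r normrN.
    by rewrite lerDl; apply: mulr_ge0; [rewrite mulr_ge0|rewrite mulr_ge0// ltW].
rewrite intRD; [|exact: L1Z|by do 2 apply: L1Z].
rewrite intRZ// (intRZ _ (L1Z _ LQ)) (intRZ _ LQ).
rewrite intR_poisson// mulr1 -/Q.
rewrite [leRHS]splitr lerD2l (_ : 2 * B * (e n * Q) = 2 * B * Q * e n); last by ring.
apply: le_trans (ler_norm _) _; rewrite -normrN -sub0r.
by near: n; exact: H.
Unshelve. all: by end_near. Qed.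

End AbelPoisson.

Section Inversion.
Variable R : realType.
Implicit Types (f g h c G : R -> R) (e x y t d u k xi B : R).
Notation mu := (@lebesgue_measure R).

Let eps (n : nat) : R := n.+1%:R^-1.

Let eps_gt0 n : 0 < eps n. Proof. by rewrite invr_gt0. Qed.

Let eps_cvg : eps n @[n --> \oo] --> 0. Proof. exact: cvg_harmonic. Qed.

Lemma abel_cvg u : abel (eps n) u @[n --> \oo] --> (1 : R).
Proof.
have -> : 1 = expR (- (0 * `|u|)) :> R by rewrite mul0r oppr0 expR0.
have cc : continuous (fun e => expR (- (e * `|u|)) : R) by cont.
exact: (cvg_comp _ _ eps_cvg (cc 0)).
Qed.

Lemma bm_abel e : 0 < e -> bounded_measurable (abel e).
Proof.
move=> e0; apply: (@bm_cont _ _ 1); first exact: abel_cont.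
by move=> u; rewrite ger0_norm ?abel_ge0 ?abel_le1.
Qed.

Lemma fourier_abel_mult f e : 0 < e -> L1 f ->
  intR (fun u => fourier_re f u * abel e u) = intR (fun y => f y * poisson e y).
Proof.
move=> e0 Lf; have := fourier_mult Lf (L1_abel e0).
under eq_fun do rewrite fourier_abel//.
by move=> ->; apply: intR_eq => u; rewrite mulrC.
Qed.

Lemma fourier_abel_cvg f B : L1 f -> (forall x, `|f x| <= B) ->
  {for 0, continuous f} ->
  intR (fun u => fourier_re f u * abel (eps n) u) @[n --> \oo] --> f 0.
Proof.
move=> Lf fB cf; under eq_fun do rewrite fourier_abel_mult//.
exact: poisson_approx.
Qed.

(* The Abel means of [fourier_re f] at 0 are Poisson averages of [f], hence at most [B]. *)
Lemma L1_fourier_ge0 f B : L1 f -> (forall x, `|f x| <= B) ->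
  (forall u, 0 <= fourier_re f u) -> L1 (fourier_re f).
Proof.
move=> Lf fB f0.
apply: (@mct_L1 _ (fun n u => fourier_re f u * abel (eps n) u) _ B).
- move=> n; have [c [D cD]] := bm_abel (eps_gt0 n).
  apply: L1_dom (L1Z (intR (fun x => `|f x|)) (L1_abel (eps_gt0 n))).
    apply: measurable_funM => //.
    by apply: continuous_measurable_fun; exact: fourier_re_cont.
  move=> u; rewrite normrM (ger0_norm (abel_ge0 _ _)) ler_wpM2r ?abel_ge0//.
  exact: fourier_re_le.
- by move=> n x; rewrite mulr_ge0// abel_ge0.
- move=> x m n mn; rewrite ler_wpM2l// /abel ler_expR lerN2 ler_wpM2r//.
  by rewrite /eps lef_pV2 ?posrE// ler_nat.
- move=> x; rewrite -[X in _ --> X]mulr1; apply: cvgM; first exact: cvg_cst.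
  exact: abel_cvg.
- by apply: continuous_measurable_fun; exact: fourier_re_cont.
- move=> n; rewrite fourier_abel_mult//.
  have LP := L1_poisson (eps_gt0 n).
  rewrite -[leRHS]mulr1 -(intR_poisson (eps_gt0 n)) -intRZ//.
  apply: intR_le; last first.
  + by move=> x; rewrite ler_wpM2r ?poisson_ge0// (le_trans (ler_norm _)).
  + exact: L1Z.
  apply: (@L1_dom _ _ (fun y => B * poisson (eps n) y)); last exact: L1Z.
    by apply: measurable_funM; apply: L1_measurable.
  by move=> y; rewrite normrM (ger0_norm (poisson_ge0 _ _))// ler_wpM2r// poisson_ge0.
Qed.

(** The Abel means of the transform converge to [f 0] by the Poisson approximation and to its
    integral by dominated convergence. *)
Lemma intR_fourier f B : L1 f -> (forall x, `|f x| <= B) ->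
  {for 0, continuous f} -> L1 (fourier_re f) -> intR (fourier_re f) = f 0.
Proof.
move=> Lf fB cf Lh; apply: (cvg_unique _ _ (fourier_abel_cvg Lf fB cf)) => //.
apply: (dct (g := fun u => `|fourier_re f u|)).
- move=> n; apply: L1_measurable; apply: L1_bm => //; exact: bm_abel.
- apply: aeW => x; rewrite -[X in _ --> X]mulr1; apply: cvgM; first exact: cvg_cst.
  exact: abel_cvg.
- exact: L1_measurable.
- exact: L1_norm.
- move=> n x; rewrite normrM ler_piMr// (ger0_norm (abel_ge0 _ _)).
  by rewrite abel_le1.
Qed.

Theorem fourier_inversion f B x : L1 f -> (forall x, `|f x| <= B) ->
  (forall x, f (- x) = f x) -> continuous f -> L1 (fourier_re f) ->
  fourier_re (fourier_re f) x = f x.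
Proof.
move=> Lf fB ef cf Lh.
(* Inversion at [x] is inversion at 0 for this symmetrised translate: its value at 0 is [f x], and
   its transform is that of [f] times [cos (2 * pi * u * x)]. *)
pose fx y := 2^-1 * (f (y + x) + f (y - x)).
have [Lp _] := intR_shift x Lf; have [Lm _] := intR_shift (- x) Lf.
have Lfx : L1 fx by apply: L1Z; exact: L1D.
have E u : fourier_re fx u = fourier_re f u * cos (2 * pi * u * x).
  rewrite /fourier_re.
  transitivity (intR (fun y => 2^-1 * (f (y + x) * cos (2 * pi * y * u) +
                                       f (y - x) * cos (2 * pi * y * u)))).
    by apply: intR_eq => y; rewrite /fx; ring.
  have Lpc := L1_cosx u Lp; have Lmc := L1_cosx u Lm.
  rewrite intRZ ?intRD//; last exact: L1D.
  have sh z : intR (fun y => f (y + z) * cos (2 * pi * y * u)) =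
              cos (2 * pi * u * z) * fourier_re f u.
    rewrite -(cosN (2 * pi * u * z)) -(cosD_even _ _ Lf)//.
    have Lc : L1 (fun y => f y * cos (2 * pi * y * u + - (2 * pi * u * z))).
      apply: L1_bm => //; apply: (@bm_cont _ _ 1); first by cont.
      by move=> y; exact: cos_max.
    have [_ <-] := intR_shift z Lc.
    by apply: intR_eq => y; congr (_ * cos _); ring.
  by rewrite !sh mulrN cosN -/(fourier_re f u); field.
have Lhx : L1 (fourier_re fx).
  by apply: (@L1_eq _ (fun u => fourier_re f u * cos (2 * pi * u * x))) => //; exact: L1_cosx.
have := @intR_fourier fx B Lfx _ _ Lhx.
rewrite (_ : fx 0 = f x); last by rewrite /fx add0r sub0r ef; field.
move=> <-.
- by apply: intR_eq => u; rewrite E.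
- move=> y; rewrite /fx normrM ger0_norm ?invr_ge0// mulrC ler_pdivrMr//.
  by apply: le_trans (ler_normD _ _) _; have := fB (y + x); have := fB (y - x); lra.
- apply: contM; first exact: cont_cst.
  by apply: contD; apply: (cont_comp cf); cont.
Qed.

End Inversion.

(** * Autocorrelations and the sinc kernel *)

Section Autocorrelation.
Variable R : realType.
Implicit Types (f g h c G : R -> R) (e x y t d u k xi B a b : R).
Notation mu := (@lebesgue_measure R).
Notation half := (2^-1 : R).

Lemma zext_out a b G x : ~~ ((a <= x) && (x <= b)) -> zext a b G x = 0.
Proof. by rewrite /zext => /negPf ->. Qed.

Lemma zext_sym_even a G : (forall x, G (- x) = G x) ->
  forall x, zext (- a) a G (- x) = zext (- a) a G x.
Proof. by move=> eG x; rewrite /zext -!ler_norml normrN eG. Qed.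

Lemma zext_continuous_at a b G x : a < b -> continuous G -> x != a -> x != b ->
  zext a b G y @[y --> x] --> zext a b G x.
Proof.
move=> ab cG xa xb.
have [xlta|altx|xE] := ltgtP x a; last by rewrite xE eqxx in xa.
- have -> : zext a b G x = 0 by apply: zext_out; rewrite negb_and -ltNge xlta.
  apply: cvg_near_cst; near=> y.
  by apply: zext_out; rewrite negb_and -ltNge; apply/orP; left; near: y; exact: lt_nbhsl.
have [xltb|bltx|xE] := ltgtP x b; last by rewrite xE eqxx in xb.
- rewrite {2}/zext !ltW//=.
  apply: cvg_trans (cG x); apply: near_eq_cvg; near=> y.
  rewrite /zext ifT//; apply/andP; split; apply: ltW; near: y.
    exact: lt_nbhsr.
  exact: lt_nbhsl.
- have -> : zext a b G x = 0 by apply: zext_out; rewrite negb_and -!ltNge bltx orbT.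
  apply: cvg_near_cst; near=> y.
  by apply: zext_out; rewrite negb_and -!ltNge; apply/orP; right; near: y; exact: lt_nbhsr.
Unshelve. all: by end_near. Qed.

Lemma zext_bounded a b G : a <= b -> continuous G -> exists B, forall x, `|zext a b G x| <= B.
Proof.
move=> ab cG.
have [|c _ cP] := @EVT_max _ (fun x => `|G x|) a b ab.
  by apply: continuous_subspaceT; exact: cont_norm.
exists `|G c| => x; rewrite /zext; case: ifPn => [xab|_]; last by rewrite normr0.
by apply: cP; rewrite in_itv.
Qed.

Section Convol.
Variables (G : R -> R) (cG : continuous G) (eG : forall x, G (- x) = G x).
Let gam := zext (- half) half G.
Notation F := (fourier_re gam).
Notation con := (convol gam gam).

Let half_lt : - half < half. Proof. by rewrite gtrN. Qed.

Let Lgam : L1 gam. Proof. exact: L1_zext. Qed.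

Let mgam : measurable_fun setT gam. Proof. exact: L1_measurable. Qed.

Let egam x : gam (- x) = gam x. Proof. exact: zext_sym_even. Qed.

Let gam_bnd : exists B, forall x, `|gam x| <= B.
Proof. by apply: zext_bounded => //; exact: ltW. Qed.

Lemma gam_out x : half < `|x| -> gam x = 0.
Proof. by move=> hx; apply: zext_out; rewrite -ler_norml -ltNge. Qed.

Let L1_conv_integrand x : L1 (fun t => gam t * gam (x - t)).
Proof.
have [B gB] := gam_bnd; apply: L1_bm => //; split; last by exists B.
by apply: measurableT_comp => //; exact: measurable_funB.
Qed.

Lemma convol_out xi : 1 < `|xi| -> con xi = 0.
Proof.
move=> x1; rewrite /convol -[RHS](@intR0 R); apply: intR_eq => t.
have [h|h] := ltP half `|t|; first by rewrite gam_out// mul0r.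
rewrite (@gam_out (xi - t)) ?mulr0//.
by have := ler_normD (xi - t) t; rewrite subrK; lra.
Qed.

Lemma convol_even xi : con (- xi) = con xi.
Proof.
rewrite /convol; have [_ <-] := intR_opp (L1_conv_integrand (- xi)).
by apply: intR_eq => t; rewrite egam -opprD egam; congr (_ * gam _); ring.
Qed.

Lemma convol0 : con 0 = intR (fun t => gam t ^+ 2).
Proof. by apply: intR_eq => t; rewrite sub0r egam expr2. Qed.

Lemma convol_bounded : exists B, forall xi, `|con xi| <= B.
Proof.
have [B gB] := gam_bnd; exists (intR (fun t => B * `|gam t|)) => xi.
apply: le_trans (intR_norm (L1_conv_integrand xi)) _.
apply: intR_le; [exact: L1_norm|by apply: L1Z; exact: L1_norm|].
by move=> t; rewrite normrM mulrC ler_wpM2r.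
Qed.

(** The truncation jumps at the two ends of its support, so the integrands converge for all [t]
    except [a - half] and [a + half]. *)
Lemma convol_continuous : continuous con.
Proof.
have [B gB] := gam_bnd.
move=> a; apply/(@cvg_nbhsP _ R^o) => w wa.
apply: (dct (g := fun t => B * `|gam t|)).
- by move=> n; apply: L1_measurable; exact: L1_conv_integrand.
- apply: (@ae_seq _ [:: a - half; a + half]) => t; rewrite !inE negb_or => /andP[ta tb].
  apply: cvgM; first exact: cvg_cst.
  have wat : w n - t @[n --> \oo] --> a - t by apply: cvgB => //; exact: cvg_cst.
  apply: (cvg_comp _ _ wat); apply: zext_continuous_at => //.
    by apply: contraNneq tb => h; apply/eqP; lra.
  by apply: contraNneq ta => h; apply/eqP; lra.
- by apply: L1_measurable; exact: L1_conv_integrand.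
- by apply: L1Z; exact: L1_norm.
- by move=> n t; rewrite normrM mulrC ler_wpM2r.
Qed.

(** The Fubini lemmas want an integrable factor in each variable. The autocorrelation lives on
    [-1, 1], so this indicator can be inserted without changing it. *)
Let ind := zext (- 1) 1 (fun=> 1 : R).

Let ind_in x : `|x| <= 1 -> ind x = 1.
Proof. by move=> x1; rewrite /ind /zext -ler_norml x1. Qed.

Let ind_con xi : ind xi * con xi = con xi.
Proof.
have [h|h] := leP `|xi| 1; first by rewrite ind_in// mul1r.
by rewrite convol_out// mulr0.
Qed.

Let ind_gam xi t : `|t| <= half -> ind xi * gam (xi - t) = gam (xi - t).
Proof.
move=> t1; have [h|h] := leP `|xi| 1; first by rewrite ind_in// mul1r.
rewrite gam_out ?mulr0//.
by have := ler_normD (xi - t) t; rewrite subrK; lra.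
Qed.

Let mdiff : measurable_fun setT
  (fun z : measurableTypeR R * measurableTypeR R => gam (z.1 - z.2)).
Proof.
apply: (measurableT_comp mgam); apply: measurable_funB.
  exact: measurable_fst.
exact: measurable_snd.
Qed.

Let Lind : L1 ind. Proof. by apply: L1_zext; exact: cst_continuous. Qed.

Lemma L1_convol : L1 con.
Proof.
have [B gB] := gam_bnd.
have := @L1_fubini _ ind gam (fun xi t => gam (xi - t)) B Lind Lgam mdiff (fun x y => gB _).
by apply: L1_eq => xi; exact: ind_con.
Qed.

Lemma fourier_convol x : fourier_re con x = F x ^+ 2.
Proof.
have [B gB] := gam_bnd.
pose ker xi t := gam (xi - t) * cos (2 * pi * xi * x).
have mker : measurable_fun setT
    (fun z : measurableTypeR R * measurableTypeR R => ker z.1 z.2).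
  apply: measurable_funM => //.
  have mc : measurable_fun setT (fun xi : R => cos (2 * pi * xi * x)).
    by apply: continuous_measurable_fun; cont.
  exact: (measurableT_comp mc measurable_fst).
have kerB xi t : `|ker xi t| <= B.
  by rewrite normrM -[leRHS]mulr1 ler_pM// cos_max.
have := @fubini_swap _ ind gam ker B Lind Lgam mker kerB.
set lhs := intR _; set rhs := intR _ => E.
have -> : fourier_re con x = lhs.
  apply: intR_eq => xi; rewrite -[in LHS]ind_con -mulrA; congr (_ * _).
  rewrite /convol -intRZr//; apply: intR_eq => t; rewrite /ker; ring.
rewrite E /rhs expr2 -intRZr; last exact: L1_cosx.
apply: intR_eq => t.
have [th|th] := leP `|t| half; last by rewrite gam_out// !mul0r.
rewrite -mulrA; congr (_ * _).
transitivity (intR (fun xi => gam (xi - t) * cos (2 * pi * (xi - t) * x + 2 * pi * t * x))).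
  apply: intR_eq => xi; rewrite /ker mulrA ind_gam//; congr (_ * cos _); ring.
rewrite -cosD_even//.
have L : L1 (fun xi => gam xi * cos (2 * pi * xi * x + 2 * pi * t * x)).
  apply: L1_bm => //; apply: (@bm_cont _ _ 1); first by cont.
  by move=> y; exact: cos_max.
by have [_ ->] := intR_shift (- t) L.
Qed.

(** The square is the transform of the autocorrelation, which is bounded and integrable, and it is
    nonnegative; [L1_fourier_ge0] then yields integrability without any decay estimate. *)
Lemma L1_fourier_sq : L1 (fun x => F x ^+ 2).
Proof.
have [B cB] := convol_bounded.
have := @L1_fourier_ge0 R con B L1_convol cB.
have -> : fourier_re con = fun x => F x ^+ 2 by apply/funext => x; exact: fourier_convol.
by apply => x; exact: sqr_ge0.
Qed.

Lemma fourier_fourier_sq xi : fourier_re (fun x => F x ^+ 2) xi = con xi.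
Proof.
have [B cB] := convol_bounded.
have := @fourier_inversion R con B xi L1_convol cB convol_even convol_continuous.
have -> : fourier_re con = fun x => F x ^+ 2 by apply/funext => x; exact: fourier_convol.
by apply; exact: L1_fourier_sq.
Qed.

End Convol.
End Autocorrelation.

(** * The sinc kernel and the transform of psi *)

Section Sinc.
Variable R : realType.
Implicit Types (f g h c G phi : R -> R) (e x y t d u v k xi B a b : R).
Notation mu := (@lebesgue_measure R).
Notation half := (2^-1 : R).

Definition dirichlet a x := intR (zext (- a) a (fun u => cos (2 * pi * u * x))).

Lemma is_derive_sin_scaled k u : k != 0 ->
  is_derive u 1 (fun u => sin (k * u) / k) (cos (k * u)).
Proof. by move=> k0; apply: is_derive_eq; rewrite /GRing.scale /=; field. Qed.

Lemma dirichletE a x : 0 <= a -> x != 0 -> dirichlet a x = sin (2 * pi * x * a) / (pi * x).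
Proof.
move=> a0 x0; have p0 := pi_gt0 R.
have k0 : 2 * pi * x != 0 by rewrite !mulf_neq0// gt_eqF.
rewrite /dirichlet (_ : (fun u => _) = fun u => cos (2 * pi * x * u)); last first.
  by apply/funext => u; congr cos; ring.
have aa : - a <= a by lra.
rewrite (FTC_zext aa _ (fun u => is_derive_sin_scaled u k0)); last by cont.
rewrite mulrN sinN; move: (pi) (gt_eqF p0) k0 => p pn k0; field.
by rewrite x0 pn.
Qed.

Lemma dirichlet0 a : 0 <= a -> dirichlet a 0 = 2 * a.
Proof.
move=> a0; rewrite /dirichlet (_ : (fun u => _) = fun=> 1); last first.
  by apply/funext => u; rewrite mulr0 cos0.
have aa : - a <= a by lra.
rewrite (@FTC_zext _ _ _ id)//; first by ring.
exact: cst_continuous.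
Qed.

Lemma dirichlet_fourier a x : dirichlet a x = fourier_re (zext (- a) a (fun=> 1)) x.
Proof.
by apply: intR_eq => u; rewrite /zext; case: ifP; rewrite ?mul1r ?mul0r.
Qed.

Lemma K_dirichlet y : K y = dirichlet half y.
Proof.
rewrite /K; have [->|y0] := eqVneq y 0; first by rewrite dirichlet0//; field.
by rewrite dirichletE//; congr (sin _ / _); field.
Qed.

(** The band of [K (y + y)] is exactly [-1, 1], so against a [phi] with that band it returns half of
    [phi 0]. *)
Lemma K2_dirichlet y : K (y + y) = half * dirichlet 1 y.
Proof.
rewrite /K -mulr2n mulrn_eq0 /=; have [->|y0] := eqVneq y 0.
  by rewrite dirichlet0//; field.
have p0 := pi_gt0 R.
rewrite dirichletE// (_ : pi * (y *+ 2) = 2 * pi * y * 1); last by ring.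
by move: (pi) (gt_eqF p0) => p pn; field; rewrite y0 pn.
Qed.

Let ind := zext (- half) half (fun=> 1 : R).

Lemma K_fourier y : K y = fourier_re ind y.
Proof. by rewrite K_dirichlet dirichlet_fourier. Qed.

Let cst_cont : continuous (fun _ : R => 1 : R). Proof. exact: cst_continuous. Qed.

Lemma K_cont : continuous (@K R).
Proof.
have -> : @K R = fourier_re ind by apply/funext => y; exact: K_fourier.
by apply: fourier_re_cont; exact: L1_zext.
Qed.

Lemma K_even y : K (- y) = K y.
Proof. by rewrite !K_fourier fourier_re_even. Qed.

Lemma K_le1 y : `|K y| <= 1.
Proof.
rewrite K_fourier; apply: le_trans (fourier_re_le _ _) _; first exact: L1_zext.
rewrite (_ : (fun x => _) = ind); last first.
  by apply/funext => u; rewrite /ind /zext; case: ifP; rewrite ?normr1 ?normr0.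
rewrite /ind (@FTC_zext _ _ _ id)//; last by lra.
by rewrite opprK; lra.
Qed.

Definition tri := zext (- 1) 1 (fun u : R => 1 - `|u|).

Lemma tri_even u : tri (- u) = tri u.
Proof. by apply: zext_sym_even => x; rewrite normrN. Qed.

Lemma L1_tri : L1 tri.
Proof. by apply: L1_zext; cont. Qed.

Lemma convol_ind xi : convol ind ind xi = tri xi.
Proof.
wlog x0 : xi / 0 <= xi => [hw|].
  have [/hw//|/ltW xi0] := leP 0 xi.
  rewrite -(convol_even cst_cont)//; rewrite hw ?tri_even//; lra.
have [x1|x1] := leP xi 1; last first.
  rewrite convol_out//; last by rewrite ger0_norm.
  by rewrite /tri zext_out// -ler_norml ger0_norm// -ltNge.
rewrite /tri {1}/zext -ler_norml (ger0_norm x0) x1.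
transitivity (intR (zext (xi - half) half (fun=> 1 : R))).
  apply: intR_eq => t; rewrite /ind /zext.
  case: ifPn => h1; case: ifPn => h2; case: ifPn => h3; rewrite ?mulr1 ?mul0r ?mulr0//.
  - move: h1 h2 h3 => /andP[a1 a2] /andP[a3 a4] /negP[]; apply/andP; split; lra.
  - move: h1 h2 h3 => /andP[a1 a2] /negP h2 /andP[a3 a4]; case: h2; apply/andP; split; lra.
  - move: h1 h3 => /negP h1 /andP[a3 a4]; case: h1; apply/andP; split; lra.
  - move: h1 h3 => /negP h1 /andP[a3 a4]; case: h1; apply/andP; split; lra.
rewrite (@FTC_zext _ _ _ id)//; last by lra.
by lra.
Qed.

(** This form makes psi an instance of the autocorrelation results, with the constant function 1 in
    the role of [G]. *)
Lemma psiE : @psi_sinc2 R = fun x => fourier_re ind x ^+ 2.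
Proof. by apply/funext => x; rewrite /psi_sinc2 K_fourier. Qed.

Lemma L1_psi : L1 (@psi_sinc2 R).
Proof. by rewrite psiE; exact: L1_fourier_sq. Qed.

Lemma fourier_psi xi : fourier_re (@psi_sinc2 R) xi = tri xi.
Proof. by rewrite psiE fourier_fourier_sq// convol_ind. Qed.

Lemma fourier_tri x : fourier_re tri x = psi_sinc2 x.
Proof.
rewrite psiE -fourier_convol//; apply: intR_eq => u.
by rewrite convol_ind.
Qed.

Lemma psi_even x : @psi_sinc2 R (- x) = psi_sinc2 x.
Proof. by rewrite /psi_sinc2 K_even. Qed.

Lemma psi0 : @psi_sinc2 R 0 = 1.
Proof. by rewrite /psi_sinc2 /K eqxx expr1n. Qed.

Lemma intR_psi : intR (@psi_sinc2 R) = 1.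
Proof.
transitivity (fourier_re (@psi_sinc2 R) 0).
  by apply: intR_eq => x; rewrite mulr0 cos0 mulr1.
by rewrite fourier_psi /tri /zext normr0 oppr_le0 ler01 subr0.
Qed.

End Sinc.

(** * The 2-level density on the Fourier side *)

Section Level.
Variable R : realType.
Implicit Types (f g h c : R -> R) (e x y t d u v k xi B a b : R) (Gr : group).
Notation mu := (@lebesgue_measure R).
Notation half := (2^-1 : R).
Notation psi := (@psi_sinc2 R).

(** The transforms of [tri2] and of [par] below are the integrals over [y] of
    [psi y * K (x - y) ^+ 2] and of [psi y * (K (x - y) * K (x + y))]. *)
Let tri2 := zext (- 1) 1 (fun u : R => (1 - `|u|) ^+ 2).
Let par := zext (- 1) 1 (fun u : R => 2^-1 * (1 - u ^+ 2)).

Let L1_tri2 : L1 tri2. Proof. by apply: L1_zext; cont. Qed.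
Let L1_par : L1 par. Proof. by apply: L1_zext; cont. Qed.

Lemma K_meas : measurable_fun setT (@K R).
Proof. by apply: continuous_measurable_fun; exact: K_cont. Qed.

Lemma measurable_Kcomp (h : R -> R) : continuous h -> measurable_fun setT (fun y => K (h y)).
Proof.
move=> ch; apply: continuous_measurable_fun; apply: cont_comp => //.
exact: K_cont.
Qed.

Lemma K_sqB x y : K (x - y) ^+ 2 = intR (fun u => tri u * cos (2 * pi * y * u + - (2 * pi * x * u))).
Proof.
rewrite -/(psi_sinc2 (x - y)) -fourier_tri; apply: intR_eq => u; congr (_ * _).
by rewrite -cosN; congr cos; ring.
Qed.

(** This is the convolution of psi with itself, hence the transform of the square of the triangle
    function. *)
Lemma intR_psi_KB x : intR (fun y => psi y * K (x - y) ^+ 2) = fourier_re tri2 x.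
Proof.
pose c y u := cos (2 * pi * y * u + - (2 * pi * x * u)).
have mc : measurable_fun setT (fun z : measurableTypeR R * measurableTypeR R => c z.1 z.2).
  have mcos : measurable_fun setT (@cos R) by apply: continuous_measurable_fun; exact: continuous_cos.
  apply: (measurableT_comp mcos); apply: measurable_funD; last first.
    apply: measurableT_comp => //; apply: measurable_funM => //; exact: measurable_snd.
  apply: measurable_funM; last exact: measurable_snd.
  by apply: measurable_funM => //; exact: measurable_fst.
under eq_fun do rewrite K_sqB.
rewrite (@fubini_swap _ psi (@tri R) c 1 (@L1_psi R) (@L1_tri R) mc (fun x y => cos_max _)).
apply: intR_eq => u; rewrite cosD_even; [|exact: L1_psi|exact: psi_even].
rewrite fourier_psi cosN /tri /tri2 /zext; case: ifP => _; last by rewrite !mul0r.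
by rewrite (_ : 2 * pi * x * u = 2 * pi * u * x); ring.
Qed.

Lemma bm_K (h : R -> R) : continuous h -> bounded_measurable (fun y => K (h y)).
Proof.
by move=> ch; split; [exact: measurable_Kcomp|exists 1 => y; exact: K_le1].
Qed.

Lemma bm_mul c c' : bounded_measurable c -> bounded_measurable c' ->
  bounded_measurable (fun x => c x * c' x).
Proof.
move=> [mc [B cB]] [md [D dD]]; split; first exact: measurable_funM.
by exists (B * D) => x; rewrite normrM ler_pM.
Qed.

Lemma intR_psi_KD x : intR (fun y => psi y * K (x + y) ^+ 2) = fourier_re tri2 x.
Proof.
rewrite -intR_psi_KB.
have L : L1 (fun y => psi y * K (x - y) ^+ 2).
  apply: L1_bm; first exact: L1_psi.
  by under eq_fun do rewrite expr2; apply: bm_mul; apply: bm_K; cont.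
by have [_ <-] := intR_opp L; apply: intR_eq => y; rewrite psi_even opprK.
Qed.

Lemma intR_psi_K2 : intR (fun y => psi y * K (y + y)) = half.
Proof.
transitivity (intR (fun y => half * (psi y * fourier_re (zext (- 1) 1 (fun=> 1)) y))).
  by apply: intR_eq => y; rewrite K2_dirichlet dirichlet_fourier; ring.
have L1i : L1 (zext (- 1) 1 (fun _ : R => 1 : R)) by apply: L1_zext; exact: cst_continuous.
rewrite intRZ; last first.
  apply: L1_bm; first exact: L1_psi.
  apply: (@bm_cont _ _ (intR (fun x => `|zext (- 1) 1 (fun=> 1 : R) x|))).
    exact: fourier_re_cont.
  by move=> x; exact: fourier_re_le.
rewrite fourier_mult//; last exact: L1_psi.
rewrite (_ : intR _ = 1) ?mulr1// -[RHS](@psi0 R) -fourier_tri /fourier_re.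
apply: intR_eq => u; rewrite mulr0 cos0 mulr1 -/(fourier_re psi u) fourier_psi /tri /zext.
by case: ifP => _; rewrite ?mul1r ?mulr0.
Qed.

Lemma is_derive_KK (x y v : R) : x + y != 0 -> y - x != 0 -> x != 0 ->
  is_derive v 1 (fun v => (cos (2 * pi * x - 2 * pi * (x + y) * v) / (x + y) -
                           cos (2 * pi * x + 2 * pi * (y - x) * v) / (y - x)) /
                          (4 * pi ^+ 2 * x))
    (sin (2 * pi * x * (1 - v)) / (pi * x) * cos (2 * pi * y * v)).
Proof.
move=> h1 h2 h3; have p0 : pi != 0 :> R by rewrite gt_eqF// pi_gt0.
have -> : sin (2 * pi * x * (1 - v)) / (pi * x) * cos (2 * pi * y * v) =
  (sin (2 * pi * x + 2 * pi * (y - x) * v) + sin (2 * pi * x - 2 * pi * (x + y) * v)) / (2 * pi * x).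
  have -> : 2 * pi * x + 2 * pi * (y - x) * v = 2 * pi * x * (1 - v) + 2 * pi * y * v by ring.
  have -> : 2 * pi * x - 2 * pi * (x + y) * v = 2 * pi * x * (1 - v) - 2 * pi * y * v by ring.
  rewrite sinD sinB; move: (sin _) (cos _) (sin _) (cos _) => s c s' c'.
  by move: (pi) p0 => p p0; field; rewrite h3 p0.
move: (pi) p0 => p p0.
apply: is_derive_eq; rewrite /GRing.scale /=.
move: (sin _) (cos _) (sin _) (cos _) => s c s' c'.
by field; rewrite h1 h2 h3 p0.
Qed.

(** As functions of [y] the factors are transforms of [exp (2 pi i x u)] and [exp (- 2 pi i x u)]
    cut to [-1/2, 1/2]. Their convolution is [sin (2 pi x (1 - |v|)) / (2 pi x)] on [-1, 1]; folding
    the even density onto [0, 1] doubles it. *)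
Lemma KK_dirichlet x y : x + y != 0 -> y - x != 0 -> x != 0 ->
  K (x - y) * K (x + y) =
  intR (zext 0 1 (fun v => sin (2 * pi * x * (1 - v)) / (pi * x) * cos (2 * pi * y * v))).
Proof.
move=> h1 h2 h3; rewrite (FTC_zext ler01 _ (fun v => is_derive_KK v h1 h2 h3)); last by cont.
have h2' : x - y != 0 by rewrite -opprB oppr_eq0.
rewrite /K (negPf h1) (negPf h2') !mulr0 !mulr1 subr0 addr0.
have p0 : pi != 0 :> R by rewrite gt_eqF// pi_gt0.
have -> : 2 * pi * x - 2 * pi * (x + y) = - (2 * (pi * y)) by ring.
have -> : 2 * pi * x + 2 * pi * (y - x) = 2 * (pi * y) by ring.
have -> : 2 * pi * x = 2 * (pi * x) by ring.
have -> : pi * (x - y) = pi * x - pi * y by ring.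
have -> : pi * (x + y) = pi * x + pi * y by ring.
rewrite cosN sinB sinD.
have D2 z : cos (2 * z) = cos z ^+ 2 - sin z ^+ 2 :> R by rewrite mulr_natl mulr2n cosD -!expr2.
rewrite !D2.
have := cos2Dsin2 (pi * x); have := cos2Dsin2 (pi * y).
move: (sin _) (cos _) (sin _) (cos _) => s c s' c' e1 e2.
rewrite mulf_div (_ : (s * c' - c * s') * (s * c' + c * s') = s ^+ 2 * c' ^+ 2 - c ^+ 2 * s' ^+ 2); last by ring.
have -> : c ^+ 2 = 1 - s ^+ 2 by lra.
have -> : c' ^+ 2 = 1 - s' ^+ 2 by lra.
move: (pi) p0 => p p0.
field; rewrite h1 h2 h3 p0 -mulrBr -mulrDr !mulf_neq0//.
Qed.

Lemma is_derive_par k u : k != 0 -> is_derive u 1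
  (fun u => 2^-1 * ((1 - u ^+ 2) * sin (k * u) / k - 2 * u * cos (k * u) / k ^+ 2 + 2 * sin (k * u) / k ^+ 3))
  (2^-1 * (1 - u ^+ 2) * cos (k * u)).
Proof.
move=> k0; apply: is_derive_eq; rewrite /GRing.scale /=.
by field.
Qed.

Lemma is_derive_sinlin k v : k != 0 -> is_derive v 1
  (fun v => ((1 - v) * cos (k * (1 - v)) / k - sin (k * (1 - v)) / k ^+ 2) * (2 / k))
  ((1 - v) * (2 * sin (k * (1 - v)) / k)).
Proof.
move=> k0; apply: is_derive_eq; rewrite /GRing.scale /=.
by field.
Qed.

(* The Fourier integral for [K (x - y) * K (x + y)] in [y] fails only at [y = x] and [y = - x]. *)
Lemma intR_psi_KK x : x != 0 ->
  intR (fun y => psi y * (K (x - y) * K (x + y))) = fourier_re par x.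
Proof.
move=> x0; have p0 : pi != 0 :> R by rewrite gt_eqF// pi_gt0.
have k0 : 2 * pi * x != 0 by rewrite !mulf_neq0.
pose S := zext 0 1 (fun v => sin (2 * pi * x * (1 - v)) / (pi * x)).
have LS : L1 S by apply: L1_zext; cont.
have bKK : bounded_measurable (fun y => K (x - y) * K (x + y)).
  by apply: bm_mul; apply: bm_K; cont.
have -> : intR (fun y => psi y * (K (x - y) * K (x + y))) = intR (fun y => psi y * fourier_re S y).
  apply: (@intR_seq _ [:: x; - x]).
  - by apply: L1_bm => //; exact: L1_psi.
  - apply: measurable_funM; first by apply: L1_measurable; exact: L1_psi.
    by apply: continuous_measurable_fun; exact: fourier_re_cont.
  move=> y; rewrite !inE negb_or => /andP[yx yNx]; congr (_ * _).
  rewrite KK_dirichlet// ?subr_eq0//; last by rewrite addrC addr_eq0.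
  by apply: intR_eq => v; rewrite /S /zext; case: ifP => _; [congr (_ * cos _); ring|rewrite mul0r].
rewrite fourier_mult//; last exact: L1_psi.
transitivity (intR (zext 0 1 (fun v => (1 - v) * (2 * sin (2 * pi * x * (1 - v)) / (2 * pi * x))))).
  apply: intR_eq => v; rewrite fourier_psi /S /tri /zext.
  case: ifPn => [/andP[v0 v1]|_]; last by rewrite mul0r.
  rewrite v1 (le_trans _ v0) ?lerN10//= ger0_norm//.
  by move: (pi) p0 => p p0; field; rewrite p0 x0.
rewrite (FTC_zext ler01 _ (fun v => is_derive_sinlin v k0)); last by cont.
rewrite /fourier_re (@intR_eq _ _ (zext (- 1) 1 (fun u => 2^-1 * (1 - u ^+ 2) * cos (2 * pi * x * u)))); last first.
  move=> u; rewrite /par /zext; case: ifP => _; last by rewrite mul0r.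
  by congr (_ * cos _); ring.
have N1 : - 1 <= 1 :> R by lra.
rewrite (FTC_zext N1 _ (fun u => is_derive_par u k0)); last by cont.
rewrite subr0 subrr !mulr0 sin0 cos0 mulrN sinN cosN !mulr1.
by move: (2 * pi * x) k0 => k k0; field.
Qed.

(* Inversion is assumed because it has different proofs for Schwartz functions and for
   squares of transforms of truncated functions. *)
Definition bandlimited (phi : R -> R) := [/\ L1 phi, forall x, phi (- x) = phi x,
  forall u, 1 < `|u| -> fourier_re phi u = 0 &
  forall x, fourier_re (fourier_re phi) x = phi x].

(** For the determinant with sign [e] the three coefficients are
    [(1 + e / 2) * (e / 2) - (1 + e ^+ 2) - e], [2 * (1 + e ^+ 2)] and [e - (1 + e ^+ 2)], as in
    [J_quadratic]. Here [e] is 1 for [SOeven], 0 for [U], -1 for [SOodd] and [USp], and [O] is the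
    mean of 1 and -1. *)
Definition m0 Gr : R :=
  match Gr with SOeven => - (9 / 4) | SOodd => - (5 / 4) | U => - 1 | O => - (7 / 4) | USp => - (5 / 4) end.
Definition m1 Gr : R := match Gr with U => 2 | _ => 4 end.
Definition m2 Gr : R :=
  match Gr with SOeven => - 1 | SOodd => - 3 | U => - 1 | O => - 2 | USp => - 3 end.

(* The 2-level density pairs [phi] with [c_const Gr * dirac_0 + m_ker Gr] on the Fourier side. *)
Definition m_ker Gr u : R := m0 Gr + m1 Gr * `|u| + m2 Gr * u ^+ 2.

Section Identity.
Variables (phi : R -> R) (Bphi : bandlimited phi).
Notation hphi := (fourier_re phi).

Let Lphi : L1 phi. Proof. by case: Bphi. Qed.
Let supp u : 1 < `|u| -> hphi u = 0. Proof. by case: Bphi => _ _ + _; exact. Qed.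

Lemma bandlimited_hat_cont : continuous hphi. Proof. exact: fourier_re_cont. Qed.

Lemma bandlimited_zext (h : R -> R) u : zext (- 1) 1 h u * hphi u = h u * hphi u.
Proof.
rewrite /zext -ler_norml; case: leP => // u1.
by rewrite (supp u1) !mulr0.
Qed.

Lemma L1_bandlimited_hat (h : R -> R) : continuous h -> L1 (fun u => h u * hphi u).
Proof.
move=> ch; have : L1 (zext (- 1) 1 (fun u => h u * hphi u)).
  by apply: L1_zext; apply: contM => //; exact: bandlimited_hat_cont.
apply: L1_eq => u; rewrite /zext -ler_norml; case: leP => // u1.
by rewrite (supp u1) mulr0.
Qed.

Lemma bandlimited0 : intR hphi = phi 0.
Proof.
have [_ _ _ <-] := Bphi; apply: intR_eq => u.
by rewrite mulr0 cos0 mulr1.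
Qed.

Lemma bandlimited_intR : intR phi = hphi 0.
Proof. by apply: intR_eq => x; rewrite mulr0 cos0 mulr1. Qed.

Lemma intR_bandlimited (h : R -> R) : continuous h ->
  intR (fun x => phi x * fourier_re (zext (- 1) 1 h) x) = intR (fun u => h u * hphi u).
Proof.
move=> ch; rewrite fourier_mult//; last exact: L1_zext.
by apply: intR_eq => u; rewrite bandlimited_zext.
Qed.

Lemma L1_phi_fourier (h : R -> R) : L1 h -> L1 (fun x => phi x * fourier_re h x).
Proof.
move=> Lh; apply: L1_bm => //; apply: (@bm_cont _ _ (intR (fun x => `|h x|))).
  exact: fourier_re_cont.
by move=> x; exact: fourier_re_le.
Qed.

Lemma intR_phi_K2 : intR (fun x => phi x * K (x + x)) = half * phi 0.
Proof.
transitivity (intR (fun y => half * (phi y * fourier_re (zext (- 1) 1 (fun=> 1)) y))).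
  by apply: intR_eq => y; rewrite K2_dirichlet dirichlet_fourier; ring.
have cc : continuous (fun _ : R => 1 : R) by exact: cst_continuous.
rewrite intRZ; last by apply: L1_phi_fourier; exact: L1_zext.
rewrite intR_bandlimited// -bandlimited0; congr (_ * _).
by apply: intR_eq => u; rewrite mul1r.
Qed.

(** The result of integrating [psi y * Wdet e x y] over [y], valid for [x != 0]. The factor
    [1 + e / 2] comes from [intR_psi] and [intR_psi_K2]. *)
Let w e x := (1 + e / 2) * (1 + e * K (x + x)) - (1 + e ^+ 2) * fourier_re tri2 x -
  2 * e * fourier_re par x.

Lemma WdetE e x y : Wdet e x y = (1 + e * K (x + x)) * (1 + e * K (y + y)) -
  (K (x - y) ^+ 2 + 2 * e * (K (x - y) * K (x + y)) + e ^+ 2 * K (x + y) ^+ 2).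
Proof.
rewrite /Wdet /Keps !subrr (_ : K (0 : R) = 1); last by rewrite /K eqxx.
rewrite (_ : K (y - x) = K (x - y)); last by rewrite -opprB K_even.
rewrite (addrC y x); ring.
Qed.

Lemma intR_psi_Wdet e x : x != 0 -> intR (fun y => psi y * Wdet e x y) = w e x.
Proof.
move=> x0; have Lpsi := @L1_psi R.
have bD : bounded_measurable (fun y => K (x + y)) by apply: bm_K; cont.
have bB : bounded_measurable (fun y => K (x - y)) by apply: bm_K; cont.
have b2 : bounded_measurable (fun y : R => K (y + y)) by apply: bm_K; cont.
have L2 : L1 (fun y => psi y * K (y + y)) by exact: L1_bm.
have LB : L1 (fun y => psi y * K (x - y) ^+ 2).
  by apply: L1_bm => //; under eq_fun do rewrite expr2; exact: bm_mul.
have LD : L1 (fun y => psi y * K (x + y) ^+ 2).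
  by apply: L1_bm => //; under eq_fun do rewrite expr2; exact: bm_mul.
have LBD : L1 (fun y => psi y * (K (x - y) * K (x + y))).
  by apply: L1_bm => //; exact: bm_mul.
transitivity (intR (fun y => (1 + e * K (x + x)) * (psi y + e * (psi y * K (y + y))) -
   (psi y * K (x - y) ^+ 2 + 2 * e * (psi y * (K (x - y) * K (x + y))) +
    e ^+ 2 * (psi y * K (x + y) ^+ 2)))).
  by apply: intR_eq => y; rewrite WdetE; ring.
have Lc : L1 (fun y => psi y + e * (psi y * K (y + y))) by apply: L1D => //; exact: L1Z.
have LBBD : L1 (fun y => psi y * K (x - y) ^+ 2 + 2 * e * (psi y * (K (x - y) * K (x + y)))).
  by apply: L1D => //; exact: L1Z.
rewrite intRB; [|exact: L1Z|by apply: L1D => //; exact: L1Z].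
rewrite intRD; [|exact: LBBD|exact: L1Z].
rewrite (intRD LB); last exact: L1Z.
rewrite (intRZ _ Lc) (intRZ _ LBD) (intRZ _ LD) (intRD Lpsi); last exact: L1Z.
rewrite (intRZ _ L2) intR_psi intR_psi_K2 intR_psi_KB intR_psi_KD intR_psi_KK//.
by rewrite /w; field.
Qed.

Let L1_K2 : L1 (fun x => phi x * K (x + x)).
Proof. by apply: L1_bm => //; apply: bm_K; cont. Qed.

Lemma intR_phi_w e : intR (fun x => phi x * w e x) =
  (1 + e / 2) * hphi 0 + intR (fun u => ((1 + e / 2) * (e / 2) -
     (1 + e ^+ 2) * (1 - `|u|) ^+ 2 - e * (1 - u ^+ 2)) * hphi u).
Proof.
have Lt := L1_phi_fourier L1_tri2; have Lp := L1_phi_fourier L1_par.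
have c1 : continuous (fun u : R => (1 - `|u|) ^+ 2) by cont.
have c2 : continuous (fun u : R => 2^-1 * (1 - u ^+ 2) : R) by cont.
have Lh := L1_bandlimited_hat (@cont_cst R 1).
have L1h := L1_bandlimited_hat c1; have L2h := L1_bandlimited_hat c2.
transitivity (intR (fun x => (1 + e / 2) * (phi x + e * (phi x * K (x + x))) -
  ((1 + e ^+ 2) * (phi x * fourier_re tri2 x) + 2 * e * (phi x * fourier_re par x)))).
  by apply: intR_eq => x; rewrite /w; ring.
have La : L1 (fun x => phi x + e * (phi x * K (x + x))) by apply: L1D => //; exact: L1Z.
rewrite intRB; [|exact: L1Z|by apply: L1D; exact: L1Z].
rewrite (intRZ _ La) (intRD Lphi); last exact: L1Z.
rewrite (intRZ _ L1_K2) intR_phi_K2 intRD; [|exact: L1Z|exact: L1Z].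
rewrite (intRZ _ Lt) (intRZ _ Lp) bandlimited_intR /tri2 /par !intR_bandlimited//.
transitivity ((1 + e / 2) * hphi 0 + ((1 + e / 2) * (e / 2) * intR (fun u => 1 * hphi u) -
  ((1 + e ^+ 2) * intR (fun u => (1 - `|u|) ^+ 2 * hphi u) +
  2 * e * intR (fun u => 2^-1 * (1 - u ^+ 2) * hphi u)))).
  rewrite (_ : intR (fun u => 1 * hphi u) = phi 0); last first.
    by rewrite -bandlimited0; apply: intR_eq => u; rewrite mul1r.
  by field.
congr (_ + _).
rewrite -(intRZ _ Lh) -(intRZ _ L1h) -(intRZ _ L2h) -intRD; [|exact: L1Z|exact: L1Z].
rewrite -intRB; [|exact: L1Z|by apply: L1D; exact: L1Z].
by apply: intR_eq => u; field.
Qed.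

Lemma measurable_Wdet e : measurable_fun setT
  (fun z : measurableTypeR R * measurableTypeR R => Wdet e z.1 z.2).
Proof.
have mD : measurable_fun setT (fun z : measurableTypeR R * measurableTypeR R => K (z.1 + z.2)).
  apply: (measurableT_comp K_meas); apply: measurable_funD; [exact: measurable_fst|exact: measurable_snd].
have mB : measurable_fun setT (fun z : measurableTypeR R * measurableTypeR R => K (z.1 - z.2)).
  apply: (measurableT_comp K_meas); apply: measurable_funB; [exact: measurable_fst|exact: measurable_snd].
have m2 : measurable_fun setT (fun x : R => K (x + x)) by apply: measurable_Kcomp; cont.
under eq_fun do rewrite WdetE.
apply: measurable_funB; [apply: measurable_funM; apply: measurable_funD => //; apply: measurable_funM => //|].
- exact: (measurableT_comp m2 measurable_fst).
- exact: (measurableT_comp m2 measurable_snd).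
apply: measurable_funD; [apply: measurable_funD|]; rewrite -?expr2.
- by under eq_fun do rewrite expr2; exact: measurable_funM.
- by apply: measurable_funM => //; exact: measurable_funM.
- by apply: measurable_funM => //; under eq_fun do rewrite expr2; exact: measurable_funM.
Qed.

Lemma Wdet_bounded e x y : `|Wdet e x y| <= 2 * (1 + `|e|) ^+ 2.
Proof.
have kB z z' : `|Keps e z z'| <= 1 + `|e|.
  apply: le_trans (ler_normD _ _) _; apply: lerD; first exact: K_le1.
  by rewrite normrM ler_piMr// K_le1.
rewrite /Wdet; apply: le_trans (ler_normB _ _) _; rewrite !normrM mulr_natl mulr2n expr2.
by apply: lerD; apply: ler_pM.
Qed.

Lemma intR2_Wdet e : intR2 (fun x y => phi x * psi y * Wdet e x y) =
  intR (fun x => phi x * w e x).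
Proof.
have Lpsi := @L1_psi R.
rewrite (intR2_fubini Lphi Lpsi (measurable_Wdet e) (@Wdet_bounded e)).
apply: (@intR_seq _ [:: 0]).
- exact: (L1_fubini Lphi Lpsi (measurable_Wdet e) (@Wdet_bounded e)).
- apply: measurable_funM; first exact: L1_measurable.
  apply: continuous_measurable_fun; rewrite /w; cont; try exact: fourier_re_cont.
  by apply: cont_comp; [exact: K_cont|cont].
- by move=> x; rewrite inE => x0; rewrite intR_psi_Wdet.
Qed.

Lemma intR2_half e e' :
  intR2 (fun x y => phi x * psi y * (2^-1 * Wdet e x y + 2^-1 * Wdet e' x y)) =
  2^-1 * intR2 (fun x y => phi x * psi y * Wdet e x y) +
  2^-1 * intR2 (fun x y => phi x * psi y * Wdet e' x y).
Proof.
have Lpsi := @L1_psi R; have Lh := L1Z 2^-1 Lphi.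
have I d := integrable_prod Lh Lpsi (measurable_Wdet d) (@Wdet_bounded d).
have Z d : 2^-1 * intR2 (fun x y => phi x * psi y * Wdet d x y) =
    intR2 (fun x y => 2^-1 * phi x * psi y * Wdet d x y).
  rewrite (intR2_fubini Lphi Lpsi (measurable_Wdet d) (@Wdet_bounded d)).
  rewrite (intR2_fubini Lh Lpsi (measurable_Wdet d) (@Wdet_bounded d)).
  rewrite -intRZ; last exact: (L1_fubini Lphi Lpsi (measurable_Wdet d) (@Wdet_bounded d)).
  by apply: intR_eq => x; rewrite mulrA.
rewrite !Z /intR2 -(RintegralD measurableT (I e) (I e')).
by congr Rintegral; apply/funext => z; ring.
Qed.

Lemma intR_KepsN1 h : L1 h -> intR (fun y => h y * Keps (-1) y y) =
  intR h - intR (fun y => h y * K (y + y)).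
Proof.
move=> Lh; rewrite -intRB//; last by apply: L1_bm => //; apply: bm_K; cont.
apply: intR_eq => y; rewrite /Keps subrr (_ : K (0 : R) = 1); last by rewrite /K eqxx.
by ring.
Qed.

Let J e := intR (fun u => ((1 + e / 2) * (e / 2) -
     (1 + e ^+ 2) * (1 - `|u|) ^+ 2 - e * (1 - u ^+ 2)) * hphi u).

Let J_quadratic e : J e = intR (fun u => (((1 + e / 2) * (e / 2) - (1 + e ^+ 2) - e) +
  (2 * (1 + e ^+ 2)) * `|u| + (e - (1 + e ^+ 2)) * u ^+ 2) * hphi u).
Proof.
apply: intR_eq => u; have -> : u ^+ 2 = `|u| ^+ 2 by rewrite real_normK// num_real.
by congr (_ * _); ring.
Qed.

(** In the Dirac terms the two multiples of [phi 0], one half and minus one half, cancel. Only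
    [hphi 0] remains, which is why [SOodd] has the kernel of [USp] but the constant 3/2 instead of
    1/2. *)
Lemma two_level_fourier Gr : two_level Gr phi psi =
  c_const R Gr * hphi 0 + intR (fun u => m_ker Gr u * hphi u).
Proof.
rewrite /two_level !intR_KepsN1//; last exact: L1_psi.
rewrite intR_psi intR_psi_K2 psi0 bandlimited_intR intR_phi_K2.
have E e : intR2 (fun x y => phi x * psi y * Wdet e x y) = (1 + e / 2) * hphi 0 + J e.
  by rewrite intR2_Wdet intR_phi_w.
case: Gr; rewrite /= /m_ker /= ?E ?J_quadratic.
- rewrite mul0r addr0; congr (_ * _ + intR _); [by field|by apply/funext => u; field].
- rewrite addrAC; congr (_ + intR _); [by field|by apply/funext => u; field].
- rewrite [0 * (phi 0 * _ + _)]mul0r addr0; congr (_ * _ + intR _); [by ring|apply/funext => u; ring].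
- rewrite intR2_half !E !J_quadratic.
  set f1 := (fun u => _); set f2 := (fun u => _); set f3 := (fun u => _).
  have L1f : L1 f1 by apply: L1_bandlimited_hat; cont.
  have L2f : L1 f2 by apply: L1_bandlimited_hat; cont.
  have -> : intR f3 = 2^-1 * intR f1 + 2^-1 * intR f2.
    rewrite -!intRZ// -intRD; [|exact: L1Z|exact: L1Z].
    by apply: intR_eq => u; rewrite /f1 /f2 /f3; move: (hphi u) `|u| => hu au; field.
  by move: (intR f1) (intR f2) (hphi 0) (phi 0) => i1 i2 h0 p0; field.
- rewrite mul0r addr0; congr (_ * _ + intR _); [by field|by apply/funext => u; field].
Qed.
End Identity.

End Level.

(** * Nonnegative cosine polynomials *)

Section Lukacs.
Variable R : realType.
Implicit Types (p q A B C D : {poly R}) (x y r c : R).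

(** The index bounds the degree, and its parity selects the two admissible weights. Arbitrary sums
    are allowed because the quadratic forms applied later are additive. Odd indices occur when the
    induction removes a linear factor. *)
Inductive lukacs_cone : nat -> {poly R} -> Prop :=
| lukacs_sq M A : (size A <= M.+1)%N -> lukacs_cone M.*2 (A ^+ 2)
| lukacs_wsq M B : (size B <= M)%N -> lukacs_cone M.*2 ((1 - 'X) * (1 + 'X) * B ^+ 2)
| lukacs_l M C : (size C <= M.+1)%N -> lukacs_cone M.*2.+1 ((1 - 'X) * C ^+ 2)
| lukacs_r M D : (size D <= M.+1)%N -> lukacs_cone M.*2.+1 ((1 + 'X) * D ^+ 2)
| lukacs_add n p q : lukacs_cone n p -> lukacs_cone n q -> lukacs_cone n (p + q).

Lemma size_linM (a b : R) p n : (size p <= n)%N -> (size ((a%:P + b *: 'X) * p)%R <= n.+1)%N.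
Proof.
move=> pn; apply: leq_trans (size_polyMleq _ _) _.
have : (size (a%:P + b *: 'X)%R <= 2)%N.
  apply: leq_trans (size_polyD _ _) _; rewrite geq_max; apply/andP; split.
    by apply: leq_trans (size_polyC_leq1 _) _.
  by apply: leq_trans (size_scale_leq _ _) _; rewrite size_polyX.
by move: (size _) (size p) pn => [|[|[|s]]] t //= pn _; rewrite ?addn1 ?addSn ?add0n ?leqW// (leq_trans (leq_pred _))// leqW.
Qed.

Lemma size_1BX p n : (size p <= n)%N -> (size ((1 - 'X) * p)%R <= n.+1)%N.
Proof. by move=> /(@size_linM 1 (-1)); rewrite scaleN1r. Qed.

Lemma size_1DX p n : (size p <= n)%N -> (size ((1 + 'X) * p)%R <= n.+1)%N.
Proof. by move=> /(@size_linM 1 1); rewrite scale1r. Qed.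

Lemma size_XBC r p n : (size p <= n)%N -> (size (('X - r%:P) * p)%R <= n.+1)%N.
Proof. by move=> /(@size_linM (- r) 1); rewrite scale1r polyCN addrC. Qed.

(** Multiplication by [1 - 'X] permutes the four kinds of generators, a square of the weight being
    absorbed into the squared polynomial. The same holds for [1 + 'X]. *)
Lemma lukacs_1BX n p : lukacs_cone n p -> lukacs_cone n.+1 ((1 - 'X) * p).
Proof.
elim=> {n p} [M A sA|M B sB|M C sC|M D sD|n p q _ IHp _ IHq].
- exact: lukacs_l.
- rewrite (_ : _ * _ = (1 + 'X) * ((1 - 'X) * B) ^+ 2); last by ring.
  by apply: lukacs_r; exact: size_1BX.
- rewrite (_ : _ * _ = ((1 - 'X) * C) ^+ 2); last by ring.
  by rewrite -doubleS; apply: lukacs_sq; exact: size_1BX.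
- by rewrite mulrA -doubleS; exact: lukacs_wsq.
- by rewrite mulrDr; exact: lukacs_add.
Qed.

Lemma lukacs_1DX n p : lukacs_cone n p -> lukacs_cone n.+1 ((1 + 'X) * p).
Proof.
elim=> {n p} [M A sA|M B sB|M C sC|M D sD|n p q _ IHp _ IHq].
- exact: lukacs_r.
- have -> : (1 + 'X) * ((1 - 'X) * (1 + 'X) * B ^+ 2) = (1 - 'X) * ((1 + 'X) * B) ^+ 2 by ring.
  by apply: lukacs_l; exact: size_1DX.
- by rewrite mulrA (mulrC (1 + 'X)) -doubleS; exact: lukacs_wsq.
- have -> : (1 + 'X) * ((1 + 'X) * D ^+ 2) = ((1 + 'X) * D) ^+ 2 by ring.
  by rewrite -doubleS; apply: lukacs_sq; exact: size_1DX.
- by rewrite mulrDr; exact: lukacs_add.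
Qed.

Lemma lukacs_XBC2 n p r : lukacs_cone n p -> lukacs_cone n.+2 (('X - r%:P) ^+ 2 * p).
Proof.
elim=> {n p} [M A sA|M B sB|M C sC|M D sD|n p q _ IHp _ IHq].
- by rewrite -exprMn -doubleS; apply: lukacs_sq; exact: size_XBC.
- rewrite mulrCA -exprMn.
  by rewrite -doubleS; apply: lukacs_wsq; exact: size_XBC.
- rewrite mulrCA -exprMn.
  by rewrite -doubleS; apply: lukacs_l; exact: size_XBC.
- rewrite mulrCA -exprMn.
  by rewrite -doubleS; apply: lukacs_r; exact: size_XBC.
- by rewrite mulrDr; exact: lukacs_add.
Qed.

Lemma lukacs_const n c : 0 <= c -> lukacs_cone n c%:P.
Proof.
move=> c0; have sC (d : R) k : (size d%:P <= k.+1)%N by exact: leq_trans (size_polyC_leq1 _) _.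
rewrite -[n]odd_double_half; case: (odd n) => /=; last first.
  by rewrite add0n -(sqr_sqrtr c0) polyC_exp; exact: lukacs_sq.
rewrite add1n; have c2 : 0 <= c / 2 by rewrite divr_ge0.
(* In odd degree a constant is not a generator; it is recovered from [(1 - 'X) + (1 + 'X) = 2]. *)
have -> : c%:P = (1 - 'X) * (Num.sqrt (c / 2))%:P ^+ 2 + (1 + 'X) * (Num.sqrt (c / 2))%:P ^+ 2.
  rewrite -mulrDl addrACA addNr addr0 -polyC_exp sqr_sqrtr// -polyC1 -polyCD -polyCM.
  by congr _%:P; field.
by apply: lukacs_add; [exact: lukacs_l|exact: lukacs_r].
Qed.

Lemma horner_cont p : continuous (fun x => p.[x]).
Proof. exact: continuous_horner. Qed.

Lemma horner_ge0_right p r c : r < c ->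
  (forall x, r < x -> x <= c -> 0 <= p.[x]) -> 0 <= p.[r].
Proof.
move=> rc pos; rewrite leNgt; apply/negP => pr.
have /cvgrPdist_lt/(_ (- p.[r])) := @horner_cont p r.
rewrite oppr_gt0 => /(_ pr); rewrite near_nbhs => -[d /= d0 dP].
pose m := Num.min (d / 2) (c - r).
have m0 : 0 < m by rewrite lt_min divr_gt0//= subr_gt0.
have md : m <= d / 2 by rewrite ge_min lexx.
have mr : m <= c - r by rewrite ge_min lexx orbT.
have xr : r < r + m by rewrite ltrDl.
have xc : r + m <= c by lra.
have xd : `|r - (r + m)| < d by rewrite opprD addNKr normrN gtr0_norm//; lra.
have := pos _ xr xc; have := dP _ xd.
by rewrite /= ltr_norml => /andP[h1 h2] h3; lra.
Qed.

Lemma horner_ge0_left p r c : c < r ->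
  (forall x, c <= x -> x < r -> 0 <= p.[x]) -> 0 <= p.[r].
Proof.
move=> cr pos; have := @horner_ge0_right (p \Po - 'X) (- r) (- c).
rewrite horner_comp hornerN hornerX opprK; apply; first by rewrite ltrN2.
by move=> x rx xc; rewrite horner_comp hornerN hornerX; apply: pos; lra.
Qed.

(** Subtracting the minimum over [-1, 1] creates a real root at the minimiser, so no complex
    factorisation is needed. A root at an endpoint gives off a linear weight, an interior one a
    square factor; the quotient is again nonnegative and of smaller degree. *)
Lemma lukacs n p : (size p <= n.+1)%N ->
  (forall x, -1 <= x <= 1 -> 0 <= p.[x]) -> lukacs_cone n p.
Proof.
elim/ltn_ind: n p => n IH p sp pos.
have N11 : -1 <= 1 :> R by lra.
have [r rI rmin] := @EVT_min _ (fun x => p.[x]) (-1) 1 N11 (continuous_subspaceT (@horner_cont p)).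
rewrite in_itv/= in rI.
set c := p.[r]; have c0 : 0 <= c := pos _ rI.
rewrite -[p](subrK c%:P); apply: lukacs_add; last exact: lukacs_const.
set q := p - c%:P.
have qpos x : -1 <= x <= 1 -> 0 <= q.[x].
  by move=> xI; rewrite hornerD hornerN hornerC subr_ge0; apply: rmin; rewrite in_itv.
have sq : (size q <= n.+1)%N.
  apply: leq_trans (size_polyD _ _) _; rewrite geq_max sp size_polyN.
  by apply: leq_trans (size_polyC_leq1 _) _.
have q0 : lukacs_cone n 0 by rewrite -polyC0; exact: lukacs_const.
have [->//|qn0] := eqVneq q 0.
have /factor_theorem[q1 q1E] : root q r by rewrite /root hornerD hornerN hornerC subrr.
have q1n0 : q1 != 0 by apply: contraNneq qn0 => h; rewrite q1E h mul0r.
have sq1 : size q = (size q1).+1 by rewrite q1E size_Mmonic ?monicXsubC// size_XsubC addn2.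
case: n IH sp sq q0 => [|n] IH sp sq q0.
  by move: sq; rewrite sq1 ltnS leqn0 size_poly_eq0 (negPf q1n0).
have sq1n : (size q1 <= n.+1)%N by rewrite -ltnS -sq1.
have q1x x : q.[x] = q1.[x] * (x - r) by rewrite q1E hornerM hornerXsubC.
move: (rI) => /andP[]; rewrite le_eqVlt => /predU1P[rE _|rl].
  have -> : q = (1 + 'X) * q1 by rewrite q1E -rE polyCN polyC1 opprK; ring.
  have pun y : r < y -> y <= 1 -> 0 <= q1.[y].
    by move=> ry y1; have := qpos y; rewrite q1x pmulr_lge0 ?subr_gt0//; apply; rewrite y1 rE ltW.
  apply: lukacs_1DX; apply: IH => // x /andP[]; rewrite rE le_eqVlt => /predU1P[<- _|]; last exact: pun.
  by apply: (@horner_ge0_right _ _ 1) => //; rewrite -rE; lra.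
rewrite le_eqVlt => /predU1P[rE|rr].
  have -> : q = (1 - 'X) * - q1 by rewrite q1E rE polyC1; ring.
  have pun y : y < r -> -1 <= y -> 0 <= (- q1).[y].
    move=> ry y1; have := qpos y; rewrite q1x hornerN nmulr_lge0 ?subr_lt0// oppr_ge0.
    by apply; rewrite y1 -rE ltW.
  apply: lukacs_1BX; apply: IH => //; first by rewrite size_polyN.
  move=> x /andP[x1]; rewrite -rE le_eqVlt => /predU1P[->|xr]; last exact: pun.
  by apply: (@horner_ge0_left _ _ (-1)) => // y y1 yr; exact: pun.
(* At an interior minimiser [q1] is nonnegative to the right of [r] and nonpositive to the left, so
   by continuity it vanishes there: the root is double. *)
have q1r : q1.[r] = 0.
  apply/eqP; rewrite eq_le; apply/andP; split; last first.
    apply: (@horner_ge0_right _ _ 1) => // x rx x1.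
    by have := qpos x; rewrite q1x pmulr_lge0 ?subr_gt0//; apply; rewrite x1 ltW// (lt_trans rl).
  rewrite -oppr_ge0 -hornerN; apply: (@horner_ge0_left _ _ (-1)) => // x x1 xr.
  have := qpos x; rewrite q1x hornerN nmulr_lge0 ?subr_lt0// oppr_ge0; apply.
  by rewrite x1 ltW// (lt_trans xr).
have /factor_theorem[q2 q2E] : root q1 r by rewrite /root q1r.
have qE : q = ('X - r%:P) ^+ 2 * q2 by rewrite q1E q2E; ring.
have q2n0 : q2 != 0 by apply: contraNneq qn0 => h; rewrite qE h mulr0.
have sq2 : size q1 = (size q2).+1 by rewrite q2E size_Mmonic ?monicXsubC// size_XsubC addn2.
case: n IH sp sq q0 sq1n => [|n] IH sp sq q0 sq1n.
  by move: sq1n; rewrite sq2 ltnS leqn0 size_poly_eq0 (negPf q2n0).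
rewrite qE; apply: lukacs_XBC2; apply: IH => //; first by rewrite -ltnS -sq2.
have pun y : -1 <= y <= 1 -> y != r -> 0 <= q2.[y].
  move=> yI yr; have := qpos y yI; rewrite qE hornerM horner_exp hornerXsubC pmulr_rge0//.
  by rewrite exprn_even_gt0//= subr_eq0.
move=> x xI; have [->|xr] := eqVneq x r; last exact: pun.
apply: (@horner_ge0_right _ _ 1) => // y ry y1; apply: pun; last by rewrite gt_eqF.
by rewrite y1 ltW// (lt_trans rl).
Qed.

End Lukacs.

(** * Cosine and sine polynomials *)

Section TrigPolynomials.
Variable R : realType.
Implicit Types (p q A B : {poly R}) (x y r t : R) (a b c w : nat -> R) (M N n j k : nat).

Definition cos_poly n a t := \sum_(j < n) a j * cos (j%:R * t).
Definition sin_poly n b t := \sum_(j < n) b j * sin (j.+1%:R * t).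

Lemma cos_mul x y : cos x * cos y = 2^-1 * (cos (x - y) + cos (x + y)) :> R.
Proof. by rewrite cosB cosD; field. Qed.

Lemma sin_mul x y : sin x * sin y = 2^-1 * (cos (x - y) - cos (x + y)) :> R.
Proof. by rewrite cosB cosD; field. Qed.

(** With truncated subtraction [(j - k) + (k - j)] is the distance of [j] and [k]; this form is kept
    in all the quadratic forms. *)
Lemma cos_distn j k t : cos (j%:R * t - k%:R * t) = cos (((j - k) + (k - j))%N%:R * t).
Proof.
have [jk|kj] := leqP j k.
  have -> : ((j - k) + (k - j) = k - j)%N by rewrite (eqP jk).
  by rewrite natrB// mulrBl -cosN opprB.
have -> : ((j - k) + (k - j) = j - k)%N by rewrite (eqP (ltnW kj)) addn0.
by rewrite natrB 1?ltnW// mulrBl.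
Qed.

Definition is_cos_poly n (f : R -> R) := exists a, forall t, f t = cos_poly n a t.
Definition is_sin_poly n (f : R -> R) := exists a, forall t, f t = sin_poly n a t.

Lemma is_cos_polyD n (f g : R -> R) : is_cos_poly n f -> is_cos_poly n g ->
  is_cos_poly n (fun t => f t + g t).
Proof.
move=> [a aE] [b bE]; exists (fun j => a j + b j) => t.
by rewrite aE bE /cos_poly -big_split; apply: eq_bigr => j _; rewrite mulrDl.
Qed.

Lemma is_cos_polyZ n x (f : R -> R) : is_cos_poly n f -> is_cos_poly n (fun t => x * f t).
Proof.
move=> [a aE]; exists (fun j => x * a j) => t.
by rewrite aE /cos_poly mulr_sumr; apply: eq_bigr => j _; rewrite mulrA.
Qed.

Lemma is_cos_poly_cos n j : (j < n)%N -> is_cos_poly n (fun t => cos (j%:R * t)).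
Proof.
move=> jn; exists (fun i => (i == j)%:R) => t.
rewrite /cos_poly (bigD1 (Ordinal jn))//= eqxx mul1r big1 ?addr0// => i.
by rewrite -val_eqE /= => /negPf ->; rewrite mul0r.
Qed.

Lemma is_cos_poly_sum n m (F : nat -> R -> R) : (forall j, (j < m)%N -> is_cos_poly n (F j)) ->
  is_cos_poly n (fun t => \sum_(j < m) F j t).
Proof.
elim: m => [|m IH] FP.
  by exists (fun=> 0) => t; rewrite big_ord0 /cos_poly big1// => j _; rewrite mul0r.
have [|a aE] := @is_cos_polyD n (fun t => \sum_(j < m) F j t) (F m) _ (FP m (ltnSn m)).
  by apply: IH => j jm; apply: FP; exact: ltnW.
by exists a => t; rewrite -aE big_ord_recr.
Qed.

Lemma is_sin_polyD n (f g : R -> R) : is_sin_poly n f -> is_sin_poly n g ->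
  is_sin_poly n (fun t => f t + g t).
Proof.
move=> [a aE] [b bE]; exists (fun j => a j + b j) => t.
by rewrite aE bE /sin_poly -big_split; apply: eq_bigr => j _; rewrite mulrDl.
Qed.

Lemma is_sin_polyZ n x (f : R -> R) : is_sin_poly n f -> is_sin_poly n (fun t => x * f t).
Proof.
move=> [a aE]; exists (fun j => x * a j) => t.
by rewrite aE /sin_poly mulr_sumr; apply: eq_bigr => j _; rewrite mulrA.
Qed.

Lemma is_sin_poly_sin n j : (j <= n)%N -> is_sin_poly n (fun t => sin (j%:R * t)).
Proof.
case: j => [_|j jn].
  exists (fun=> 0) => t; rewrite mul0r sin0 /sin_poly big1// => j _; by rewrite mul0r.
exists (fun i => (i == j)%:R) => t.
rewrite /sin_poly (bigD1 (Ordinal jn))//= eqxx mul1r big1 ?addr0// => i.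
by rewrite -val_eqE /= => /negPf ->; rewrite mul0r.
Qed.

Lemma is_sin_poly_sum n m (F : nat -> R -> R) : (forall j, (j < m)%N -> is_sin_poly n (F j)) ->
  is_sin_poly n (fun t => \sum_(j < m) F j t).
Proof.
elim: m => [|m IH] FP.
  by exists (fun=> 0) => t; rewrite big_ord0 /sin_poly big1// => j _; rewrite mul0r.
have [|a aE] := @is_sin_polyD n (fun t => \sum_(j < m) F j t) (F m) _ (FP m (ltnSn m)).
  by apply: IH => j jm; apply: FP; exact: ltnW.
by exists a => t; rewrite -aE big_ord_recr.
Qed.

Lemma is_cos_poly_eq n (f g : R -> R) : f =1 g -> is_cos_poly n f -> is_cos_poly n g.
Proof. by move=> /funext ->. Qed.

Lemma is_sin_poly_eq n (f g : R -> R) : f =1 g -> is_sin_poly n f -> is_sin_poly n g.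
Proof. by move=> /funext ->. Qed.

Lemma is_cos_poly_mul n (f : R -> R) : is_cos_poly n f ->
  is_cos_poly n.+1 (fun t => cos t * f t).
Proof.
move=> [a aE]; apply: (@is_cos_poly_eq _ (fun t => \sum_(j < n) cos t * (a j * cos (j%:R * t)))).
  by move=> t; rewrite aE /cos_poly mulr_sumr.
apply: (@is_cos_poly_sum _ _ (fun j t => cos t * (a j * cos (j%:R * t)))) => -[|j] jn.
  apply: (@is_cos_poly_eq _ (fun t => a 0%N * cos (1%:R * t))).
    by move=> t; rewrite mul0r cos0 mul1r; ring.
  by apply: is_cos_polyZ; exact: is_cos_poly_cos.
apply: (@is_cos_poly_eq _ (fun t => (a j.+1 / 2) * (cos (j%:R * t) + cos (j.+2%:R * t)))).
  move=> t; rewrite mulrCA [cos t * _]mulrC cos_mul.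
  have -> : j.+1%:R * t - t = j%:R * t by rewrite -natr1; ring.
  have -> : j.+1%:R * t + t = j.+2%:R * t by rewrite -!natr1; ring.
  by field.
by apply: is_cos_polyZ; apply: is_cos_polyD; apply: is_cos_poly_cos; rewrite // ltnW// ltnW.
Qed.

Lemma is_sin_poly_mul n (f : R -> R) : is_sin_poly n f ->
  is_sin_poly n.+1 (fun t => cos t * f t).
Proof.
move=> [a aE]; apply: (@is_sin_poly_eq _ (fun t => \sum_(j < n) cos t * (a j * sin (j.+1%:R * t)))).
  by move=> t; rewrite aE /sin_poly mulr_sumr.
apply: (@is_sin_poly_sum _ _ (fun j t => cos t * (a j * sin (j.+1%:R * t)))) => j jn.
apply: (@is_sin_poly_eq _ (fun t => (a j / 2) * (sin (j%:R * t) + sin (j.+2%:R * t)))).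
  move=> t; rewrite mulrCA.
  have -> : j%:R * t = j.+1%:R * t - t by rewrite -natr1; ring.
  have -> : j.+2%:R * t = j.+1%:R * t + t by rewrite -!natr1; ring.
  by rewrite sinB sinD; field.
by apply: is_sin_polyZ; apply: is_sin_polyD; apply: is_sin_poly_sin; rewrite // ltnW// ltnW.
Qed.

Lemma horner_cos M A : (size A <= M.+1)%N -> is_cos_poly M.+1 (fun t => A.[cos t]).
Proof.
elim/poly_ind: A M => [|A c IH] M.
  move=> _; exists (fun=> 0) => t; rewrite horner0 /cos_poly big1// => j _; by rewrite mul0r.
rewrite size_MXaddC; case: ifP => [/andP[/eqP -> /eqP ->] _|_].
  exists (fun=> 0) => t; rewrite mul0r add0r hornerC /cos_poly big1// => j _; by rewrite mul0r.
rewrite ltnS => sA.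
apply: (@is_cos_poly_eq _ (fun t => cos t * A.[cos t] + c * cos (0%:R * t))).
  by move=> t; rewrite hornerD hornerM hornerX hornerC mul0r cos0 mulr1 mulrC.
apply: is_cos_polyD; last by apply: is_cos_polyZ; exact: is_cos_poly_cos.
case: M sA => [|M] sA; last by apply: is_cos_poly_mul; exact: IH.
move: sA; rewrite leqn0 size_poly_eq0 => /eqP ->.
by exists (fun=> 0) => t; rewrite horner0 mulr0 /cos_poly big1// => j _; rewrite mul0r.
Qed.

(** At [cos t] the generator [(1 - 'X) * (1 + 'X) * B ^+ 2] is the square of this function, which is
    how sine polynomials enter. *)
Lemma horner_sin M B : (size B <= M)%N -> is_sin_poly M (fun t => sin t * B.[cos t]).
Proof.
elim/poly_ind: B M => [|A c IH] M.
  move=> _; exists (fun=> 0) => t; rewrite horner0 mulr0 /sin_poly big1// => j _; by rewrite mul0r.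
rewrite size_MXaddC; case: ifP => [/andP[/eqP -> /eqP ->] _|_].
  exists (fun=> 0) => t; rewrite mul0r add0r hornerC mulr0 /sin_poly big1// => j _; by rewrite mul0r.
case: M => // M; rewrite ltnS => sA.
apply: (@is_sin_poly_eq _ (fun t => cos t * (sin t * A.[cos t]) + c * sin (1%:R * t))).
  by move=> t; rewrite hornerD hornerM hornerX hornerC mul1r; ring.
apply: is_sin_polyD; first by apply: is_sin_poly_mul; exact: IH.
by apply: is_sin_polyZ; exact: is_sin_poly_sin.
Qed.

Lemma chebyshev n : exists p, (size p <= n.+1)%N /\ forall t, p.[cos t] = cos (n%:R * t).
Proof.
suff [] : (exists p, (size p <= n.+1)%N /\ forall t, p.[cos t] = cos (n%:R * t)) /\
  (exists p, (size p <= n.+2)%N /\ forall t, p.[cos t] = cos (n.+1%:R * t)) by [].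
elim: n => [|n [IH0 [q [sq qE]]]].
  split; first by exists 1; rewrite size_poly1; split => // t; rewrite hornerE mul0r cos0.
  by exists 'X; rewrite size_polyX; split => // t; rewrite hornerX mul1r.
split; first by exists q.
have [p [sp pE]] := IH0.
exists (2 *: ('X * q) - p); split.
  apply: leq_trans (size_polyD _ _) _; rewrite geq_max size_polyN; apply/andP; split.
    apply: leq_trans (size_scale_leq _ _) _; rewrite mulrC.
    have [->|q0] := eqVneq q 0; first by rewrite mul0r size_poly0.
    by rewrite size_mulX.
  by apply: leq_trans sp _; rewrite ltnW.
move=> t; rewrite hornerD hornerN hornerZ hornerM hornerX qE pE cos_mul.
have -> : t - n.+1%:R * t = - (n%:R * t) by rewrite -natr1; ring.
have -> : t + n.+1%:R * t = n.+2%:R * t by rewrite -!natr1; ring.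
by rewrite cosN; field.
Qed.

End TrigPolynomials.

(** * Discrete orthogonality and the dual functional *)

Section NodeAverage.
Variable R : realType.
Implicit Types (p q A B : {poly R}) (x y r t v : R) (a b c w : nat -> R) (L M N n j k d : nat).

Definition node_avg L (f : R -> R) := L%:R^-1 * \sum_(r < L) f (2 * pi * r%:R / L%:R).

(** The sum telescopes, since [2 sin h cos (2 h r)] is the difference of [sin ((2 r + 1) h)] and
    [sin ((2 r - 1) h)]. *)
Lemma sum_cos_nodes (h : R) L :
  2 * sin h * \sum_(r < L) cos (2 * h * r%:R) = sin ((2 * L%:R - 1) * h) + sin h.
Proof.
elim: L => [|L IH]; first by rewrite big_ord0 mulr0 mulr0 sub0r mulN1r sinN addNr.
rewrite big_ord_recr/= mulrDr IH.
have -> : (2 * L%:R - 1) * h = 2 * h * L%:R - h by ring.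
have -> : (2 * L.+1%:R - 1) * h = 2 * h * L%:R + h by rewrite -natr1; ring.
by rewrite sinB sinD; ring.
Qed.

Lemma sin_sub2pi d (h : R) : sin (2 * (pi * d%:R) - h) = - sin h.
Proof.
elim: d => [|d IH]; first by rewrite !mulr0 sub0r sinN.
rewrite -IH -[RHS]sinD2pi; congr sin; rewrite -natr1; ring.
Qed.

Lemma node_avg_cos L d : (0 < d)%N -> (d < L)%N ->
  node_avg L (fun t => cos (d%:R * t)) = 0.
Proof.
move=> d0 dL; have L0 : 0 < L%:R :> R by rewrite ltr0n (leq_trans _ dL).
have p0 := pi_gt0 R.
pose h : R := pi * d%:R / L%:R.
have h0 : 0 < sin h.
  apply: sin_gt0_pi; apply/andP; split; first by rewrite divr_gt0// mulr_gt0// ltr0n.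
  by rewrite ltr_pdivrMr// ltr_pM2l// ltr_nat.
rewrite /node_avg (_ : \sum_(r < L) _ = 0) ?mulr0//.
have : 2 * sin h * \sum_(r < L) cos (2 * h * r%:R) = 0.
  rewrite sum_cos_nodes (_ : _ * h = 2 * (pi * d%:R) - h) ?sin_sub2pi ?addNr//.
  by rewrite /h; move: (pi) => q; field; rewrite gt_eqF.
move=> /eqP; rewrite mulf_eq0 mulf_eq0 (gt_eqF h0) pnatr_eq0/= => /eqP s0; rewrite -[RHS]s0.
apply: eq_bigr => r _; congr cos; rewrite /h; ring.
Qed.

Lemma node_avgD L (f g : R -> R) : node_avg L (fun t => f t + g t) = node_avg L f + node_avg L g.
Proof. by rewrite /node_avg big_split/= mulrDr. Qed.

Lemma node_avgZ L x (f : R -> R) : node_avg L (fun t => x * f t) = x * node_avg L f.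
Proof. by rewrite /node_avg -mulr_sumr mulrCA. Qed.

Lemma node_avg_eq L (f g : R -> R) : f =1 g -> node_avg L f = node_avg L g.
Proof. by move=> /funext ->. Qed.

Lemma node_avg_sum L n (F : nat -> R -> R) :
  node_avg L (fun t => \sum_(j < n) F j t) = \sum_(j < n) node_avg L (F j).
Proof. by rewrite /node_avg exchange_big/= mulr_sumr. Qed.

(** The number of integers of absolute value [n], and also the reciprocal of the mean of
    [cos (n t) ^ 2]. *)
Definition wt n : R := if n == 0%N then 1 else 2.

(* For [j < N] its value at [cos (j * t)] is [w j]; as an average over nodes it is defined on
   all functions, so no coefficients have to be extracted from a product. *)
Definition cos_functional N w (f : R -> R) :=
  node_avg N.*2 (fun t => f t * \sum_(n < N) wt n * w n * cos (n%:R * t)).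

Lemma cos_functionalD N w (f g : R -> R) : cos_functional N w (fun t => f t + g t) =
  cos_functional N w f + cos_functional N w g.
Proof. by rewrite -node_avgD; apply: node_avg_eq => t; rewrite mulrDl. Qed.

Lemma cos_functionalZ N w x (f : R -> R) : cos_functional N w (fun t => x * f t) =
  x * cos_functional N w f.
Proof. by rewrite -node_avgZ; apply: node_avg_eq => t; rewrite mulrA. Qed.

Lemma cos_functional_eq N w (f g : R -> R) : f =1 g -> cos_functional N w f = cos_functional N w g.
Proof. by move=> /funext ->. Qed.

Lemma cos_functional_sum N w n (F : nat -> R -> R) :
  cos_functional N w (fun t => \sum_(j < n) F j t) = \sum_(j < n) cos_functional N w (F j).
Proof.
rewrite /cos_functional -(@node_avg_sum _ _ (fun j t => F j t * \sum_(n < N) wt n * w n * cos (n%:R * t))).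
by apply: node_avg_eq => t; rewrite mulr_suml.
Qed.

(** Twice [N] nodes suffice: [j + k] stays below [2 N], so no product frequency is aliased to 0. *)
Lemma node_avg_coscos N j k : (j < N)%N -> (k < N)%N ->
  node_avg N.*2 (fun t => cos (j%:R * t) * cos (k%:R * t)) = (j == k)%:R / wt k.
Proof.
move=> jN kN.
have N0 : (0 < N)%N by exact: leq_trans jN.
have one : node_avg N.*2 (fun t => cos (0%:R * t)) = 1.
  rewrite /node_avg (eq_bigr (fun=> 1)); last by move=> r _; rewrite mul0r cos0.
  by rewrite sumr_const card_ord mulVf// pnatr_eq0 double_eq0 -lt0n.
rewrite (_ : node_avg _ _ = 2^-1 * (node_avg N.*2 (fun t => cos (((j - k) + (k - j))%N%:R * t)) +
    node_avg N.*2 (fun t => cos ((j + k)%:R * t)))); last first.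
  rewrite -node_avgD -node_avgZ; apply: node_avg_eq => t.
  by rewrite cos_mul cos_distn (natrD _ j k) mulrDl.
have [<-|jk] := eqVneq j k.
  rewrite subnn addn0 one /wt; case: j jN kN => [|j] jN _ //=.
    by rewrite addn0 one; field.
  rewrite node_avg_cos ?addr0 ?mulr1 ?mul1r//.
  by rewrite -addnn -addSn leq_add// ltnW.
rewrite mul0r !node_avg_cos ?addr0 ?mulr0//; try lia.
Qed.

Lemma cos_functional_cos N w n : (n < N)%N -> cos_functional N w (fun t => cos (n%:R * t)) = w n.
Proof.
move=> nN; rewrite /cos_functional.
rewrite (@node_avg_eq _ _ (fun t => \sum_(k < N) (wt k * w k) * (cos (n%:R * t) * cos (k%:R * t)))); last first.
  by move=> t; rewrite mulr_sumr; apply: eq_bigr => k _; ring.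
rewrite (@node_avg_sum _ _ (fun k t => (wt k * w k) * (cos (n%:R * t) * cos (k%:R * t)))).
rewrite (bigD1 (Ordinal nN))//= big1 ?addr0.
  rewrite node_avgZ node_avg_coscos// eqxx /wt /=; case: ifP => _ /=; by field.
move=> k; rewrite -val_eqE /= => kn; rewrite node_avgZ node_avg_coscos//.
by rewrite eq_sym (negPf kn) mul0r mulr0.
Qed.

Lemma cos_functional_cos_sq M w a :
  cos_functional M.*2.+1 w (fun t => cos_poly M.+1 a t ^+ 2) =
  \sum_(j < M.+1) \sum_(k < M.+1) a j * a k * (2^-1 * (w ((j - k) + (k - j))%N + w (j + k)%N)).
Proof.
rewrite (@cos_functional_eq _ _ _ (fun t => \sum_(j < M.+1) \sum_(k < M.+1)
  (a j * a k / 2) * (cos (((j - k) + (k - j))%N%:R * t) + cos ((j + k)%N%:R * t)))); last first.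
  move=> t; rewrite expr2 /cos_poly mulr_suml; apply: eq_bigr => j _.
  rewrite mulr_sumr; apply: eq_bigr => k _.
  by rewrite mulrACA cos_mul cos_distn (natrD _ j k) mulrDl; field.
rewrite (@cos_functional_sum _ _ _ (fun j t => \sum_(k < M.+1)
  (a j * a k / 2) * (cos (((j - k) + (k - j))%N%:R * t) + cos ((j + k)%N%:R * t)))).
apply: eq_bigr => j _.
rewrite (@cos_functional_sum _ _ _ (fun k t =>
  (a j * a k / 2) * (cos (((j - k) + (k - j))%N%:R * t) + cos ((j + k)%N%:R * t)))).
apply: eq_bigr => k _; have := ltn_ord j; have := ltn_ord k => kM jM.
rewrite cos_functionalZ cos_functionalD !cos_functional_cos; try lia.
by field.
Qed.

Lemma cos_functional_sin_sq M w b :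
  cos_functional M.*2.+1 w (fun t => sin_poly M b t ^+ 2) =
  \sum_(j < M) \sum_(k < M) b j * b k * (2^-1 * (w ((j - k) + (k - j))%N - w (j + k).+2)).
Proof.
rewrite (@cos_functional_eq _ _ _ (fun t => \sum_(j < M) \sum_(k < M)
  (b j * b k / 2) * (cos (((j - k) + (k - j))%N%:R * t) + (-1) * cos ((j + k).+2%:R * t)))); last first.
  move=> t; rewrite expr2 /sin_poly mulr_suml; apply: eq_bigr => j _.
  rewrite mulr_sumr; apply: eq_bigr => k _.
  rewrite mulrACA sin_mul cos_distn !subSS.
  have -> : (j + k).+2%:R * t = j.+1%:R * t + k.+1%:R * t.
    by rewrite -!natr1 natrD; ring.
  by field.
rewrite (@cos_functional_sum _ _ _ (fun j t => \sum_(k < M)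
  (b j * b k / 2) * (cos (((j - k) + (k - j))%N%:R * t) + (-1) * cos ((j + k).+2%:R * t)))).
apply: eq_bigr => j _.
rewrite (@cos_functional_sum _ _ _ (fun k t =>
  (b j * b k / 2) * (cos (((j - k) + (k - j))%N%:R * t) + (-1) * cos ((j + k).+2%:R * t)))).
apply: eq_bigr => k _; have := ltn_ord j; have := ltn_ord k => kM jM.
rewrite cos_functionalZ cos_functionalD cos_functionalZ !cos_functional_cos; try lia.
by field.
Qed.

Section ConeBound.
Variables (M : nat) (w : nat -> R) (v : R).
Hypothesis cosP : forall a, v * (\sum_(j < M.+1) a j) ^+ 2 <=
  \sum_(j < M.+1) \sum_(k < M.+1) a j * a k * (2^-1 * (w ((j - k) + (k - j))%N + w (j + k)%N)).
Hypothesis sinP : forall b, 0 <=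
  \sum_(j < M) \sum_(k < M) b j * b k * (2^-1 * (w ((j - k) + (k - j))%N - w (j + k).+2)).

(** The weighted squares vanish at 1, so nonnegativity of the sine form is enough for them, and the
    full constant [v] is asked of the cosine form only. Parity rules out the generators of odd
    index. *)
Lemma lukacs_cone_bound n p : lukacs_cone n p -> n = M.*2 ->
  v * p.[1] <= cos_functional M.*2.+1 w (fun t => p.[cos t]).
Proof.
elim=> {n p} [M' A sA|M' B sB|M' C sC|M' D sD|n p q _ IHp _ IHq] nM; try lia.
- have {}nM : M' = M by lia.
  subst M'; have [a aE] := horner_cos sA.
  rewrite (@cos_functional_eq _ _ _ (fun t => cos_poly M.+1 a t ^+ 2)).
    rewrite cos_functional_cos_sq; apply: le_trans (cosP a).
    rewrite horner_exp -(cos0 R) aE /cos_poly.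
    by under [in leLHS]eq_bigr do rewrite mulr0 cos0 mulr1.
  by move=> t; rewrite horner_exp aE.
- have {}nM : M' = M by lia.
  subst M'; have [b bE] := horner_sin sB.
  rewrite (@cos_functional_eq _ _ _ (fun t => sin_poly M b t ^+ 2)).
    rewrite cos_functional_sin_sq !hornerM hornerD hornerN hornerX hornerC subrr !mul0r mulr0.
    exact: sinP.
  move=> t; rewrite -bE exprMn sin2cos2 !hornerM !hornerD hornerN hornerX hornerC; ring.
- rewrite hornerD mulrDr.
  rewrite (@cos_functional_eq _ _ _ (fun t => p.[cos t] + q.[cos t])); last by move=> t; rewrite hornerD.
  by rewrite cos_functionalD lerD// ?IHp ?IHq.
Qed.

(** The nonnegative sum is [p.[cos t]] for some [p], to which Lukacs applies. The left side is [v *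
    p.[1]], its value at t = 0; the right side is the value of the functional. *)
Lemma trig_bound c : (forall t, 0 <= \sum_(n < M.*2.+1) wt n * c n * cos (n%:R * t)) ->
  v * (\sum_(n < M.*2.+1) wt n * c n) <= \sum_(n < M.*2.+1) wt n * c n * w n.
Proof.
move=> pos.
have [p [sp pE]] : exists p, (size p <= M.*2.+1)%N /\
    forall t, p.[cos t] = \sum_(n < M.*2.+1) wt n * c n * cos (n%:R * t).
  elim: (M.*2.+1) => [|m [p [sp pE]]].
    by exists 0; rewrite size_poly0; split => // t; rewrite horner0 big_ord0.
  have [q [sq qE]] := @chebyshev R m.
  exists (p + (wt m * c m) *: q); split.
    apply: leq_trans (size_polyD _ _) _; rewrite geq_max (leq_trans sp)//=.
    by apply: leq_trans (size_scale_leq _ _) _.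
  by move=> t; rewrite hornerD hornerZ pE qE big_ord_recr.
have pos1 x : -1 <= x <= 1 -> 0 <= p.[x].
  by move=> xI; rewrite -(acosK xI) pE.
have := lukacs_cone_bound (lukacs sp pos1) erefl.
rewrite -{1}(cos0 R) pE.
rewrite (eq_bigr (fun n : 'I_M.*2.+1 => wt n * c n)); last first.
  by move=> n _; rewrite mulr0 cos0 mulr1.
move=> h; apply: le_trans h _.
rewrite (@cos_functional_eq _ _ _ _ pE).
rewrite (@cos_functional_sum _ _ _ (fun n t => wt n * c n * cos (n%:R * t))) le_eqVlt.
apply/orP; left; apply/eqP; apply: eq_bigr => n _.
by rewrite cos_functionalZ cos_functional_cos.
Qed.

End ConeBound.
End NodeAverage.

(** * The sampled quadratic forms *)

Section FiniteForms.
Variable R : realType.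
Implicit Types (x y r t v : R) (a b c w s : nat -> R) (M N n d : nat).

Lemma weighted_cauchy_schwarz (I : finType) (P : pred I) (x w : I -> R) :
  (forall i, 0 < w i) ->
  (\sum_(i | P i) x i) ^+ 2 <= (\sum_(i | P i) w i) * (\sum_(i | P i) x i ^+ 2 / w i).
Proof.
move=> w0; set S := \sum_(i | P i) x i; set W := \sum_(i | P i) w i.
have W0 : 0 <= W by apply: sumr_ge0 => i _; exact: ltW.
have := W0; rewrite le_eqVlt => /predU1P[W00|Wp].
  have P0 (i : I) : P i -> False.
    move=> Pi; have : w i <= W.
      by rewrite /W (bigD1 i)//= lerDl sumr_ge0// => j _; exact: ltW.
    by rewrite -W00 leNgt w0.
  have -> : S = 0 by rewrite /S big1// => i /P0.
  by rewrite expr0n mulr_ge0// sumr_ge0// => i _; rewrite divr_ge0 ?sqr_ge0// ltW.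
have : 0 <= \sum_(i | P i) (x i - S / W * w i) ^+ 2 / w i.
  by apply: sumr_ge0 => i _; rewrite divr_ge0 ?sqr_ge0// ltW.
rewrite (eq_bigr (fun i => x i ^+ 2 / w i - (2 * (S / W) * x i - (S / W) ^+ 2 * w i))); last first.
  by move=> i _; field; rewrite gt_eqF// gt_eqF.
rewrite sumrB sumrB -!mulr_sumr -/S -/W subr_ge0.
have -> : 2 * (S / W) * S - (S / W) ^+ 2 * W = S ^+ 2 / W by field; rewrite gt_eqF.
by rewrite ler_pdivrMr// mulrC.
Qed.

Lemma cauchy_schwarz_sum (I : finType) (x y : I -> R) :
  (\sum_i x i * y i) ^+ 2 <= (\sum_i x i ^+ 2) * (\sum_i y i ^+ 2).
Proof.
set X := \sum_i x i ^+ 2; set Y := \sum_i y i ^+ 2; set S := \sum_i x i * y i.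
have X0 : 0 <= X by apply: sumr_ge0 => i _; exact: sqr_ge0.
have [X00|Xn0] := eqVneq X 0.
  have x0 i : x i = 0.
    apply/eqP; rewrite -sqrf_eq0; apply/eqP.
    by move/psumr_eq0P : X00 => -> // j _; exact: sqr_ge0.
  by rewrite /S big1 ?expr0n ?X00 ?mul0r// => i _; rewrite x0 mul0r.
have Xp : 0 < X by rewrite lt_def Xn0.
have : 0 <= \sum_i (y i - S / X * x i) ^+ 2 by apply: sumr_ge0 => i _; exact: sqr_ge0.
rewrite (eq_bigr (fun i => y i ^+ 2 - (2 * (S / X) * (x i * y i) - (S / X) ^+ 2 * x i ^+ 2))); last first.
  by move=> i _; ring.
rewrite sumrB sumrB -!mulr_sumr -/S -/X -/Y subr_ge0.
have -> : 2 * (S / X) * S - (S / X) ^+ 2 * X = S ^+ 2 / X by field.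
by rewrite ler_pdivrMr// mulrC.
Qed.

Lemma wt_gt0 n : 0 < wt R n.
Proof. by rewrite /wt; case: ifP. Qed.

Lemma sum_wt n : \sum_(j < n.+1) wt R j = n.*2.+1%:R.
Proof.
elim: n => [|n IH]; first by rewrite big_ord1.
by rewrite big_ord_recr/= IH /wt -natrD; congr _%:R; lia.
Qed.

Lemma sum_wt_le i M : (i < M)%N -> \sum_(j < M.+1 | (j <= i)%N) wt R j = i.*2.+1%:R.
Proof.
move=> iM; have := @big_ord_widen_cond _ 0 +%R i.+1 M.+1 xpredT (fun j => wt R j).
by rewrite sum_wt ltnW// => ->//; apply: eq_bigl => j; rewrite ltnS.
Qed.

(** The mean of the square of the cosine polynomial with coefficients [a], which is what the Dirac
    term contributes to the cosine form. *)
Definition energy n a := \sum_(j < n) a j ^+ 2 / wt R j.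

Lemma energy_ge0 n a : 0 <= energy n a.
Proof. by apply: sumr_ge0 => j _; rewrite divr_ge0 ?sqr_ge0// ltW// wt_gt0. Qed.

Lemma sqr_sum_energy M a : (\sum_(j < M.+1) a j) ^+ 2 <= M.*2.+1%:R * energy M.+1 a.
Proof.
rewrite -sum_wt; apply: (@weighted_cauchy_schwarz _ predT (fun j : 'I_M.+1 => a j) (fun j => wt R j)).
by move=> j; exact: wt_gt0.
Qed.

(** For [j, k <= M], [maxn j k] counts the [i < M] at which [j <= i] and [k <= i] do not both hold.
    This is the discrete form of [|x|] being conditionally negative definite. *)
Lemma sum_maxn_kernel M a : \sum_(j < M.+1) a j = 0 ->
  \sum_(j < M.+1) \sum_(k < M.+1) a j * a k * (maxn j k)%:R =
  - \sum_(i < M) (\sum_(j < M.+1 | (j <= i)%N) a j) ^+ 2.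
Proof.
move=> a0.
have E j k : (j <= M)%N -> (k <= M)%N ->
    (maxn j k)%:R = \sum_(i < M) (1 - (j <= i)%N%:R * (k <= i)%N%:R) :> R.
  move=> jM kM.
  have EE m : (maxn j k <= M)%N -> \sum_(i < m) (1 - (j <= i)%N%:R * (k <= i)%N%:R) = (minn m (maxn j k))%:R :> R.
    move=> _; elim: m => [|m IH]; first by rewrite big_ord0 min0n.
    rewrite big_ord_recr/= IH -natrM mulnb -geq_max.
    by case: leqP => h; rewrite ?subrr ?addr0 ?subr0 ?natr1; congr _%:R; lia.
  by rewrite EE; [congr _%:R|]; lia.
transitivity (\sum_(i < M) ((\sum_(j < M.+1) a j) ^+ 2 - (\sum_(j < M.+1 | (j <= i)%N) a j) ^+ 2)); last first.
  by rewrite a0 -sumrN; apply: eq_bigr => i _; rewrite expr0n sub0r.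
transitivity (\sum_(j < M.+1) \sum_(k < M.+1) \sum_(i < M)
   (a j * a k - (j <= i)%N%:R * a j * ((k <= i)%N%:R * a k))).
  apply: eq_bigr => j _; apply: eq_bigr => k _; rewrite E -1?ltnS// mulr_sumr.
  by apply: eq_bigr => i _; ring.
under eq_bigr do rewrite exchange_big/=.
rewrite exchange_big/=; apply: eq_bigr => i _.
rewrite [X in _ - X ^+ 2]big_mkcond/= !expr2 !mulr_suml -sumrB; apply: eq_bigr => j _.
rewrite !mulr_sumr -sumrB; apply: eq_bigr => k _.
by case: (j <= i)%N; case: (k <= i)%N; rewrite ?mul1r ?mul0r ?mulr0.
Qed.

(** As the total is 0, the partial sum is also minus the remaining sum, and Cauchy-Schwarz holds on
    both parts, with total weights P = [i.*2.+1] and Q = [(M - i).*2]. Combining the two bounds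
    gives the factor [P Q / (P + Q)], which vanishes at both ends. *)
Lemma sqr_partial_sum M a i : (i < M)%N -> \sum_(j < M.+1) a j = 0 ->
  M.*2.+1%:R * (\sum_(j < M.+1 | (j <= i)%N) a j) ^+ 2 <=
  i.*2.+1%:R * (M - i).*2%:R * energy M.+1 a.
Proof.
move=> iM a0; set s := \sum_(j < M.+1 | (j <= i)%N) a j.
have s1 : s ^+ 2 <= i.*2.+1%:R * \sum_(j < M.+1 | (j <= i)%N) a j ^+ 2 / wt R j.
  have -> : i.*2.+1%:R = \sum_(j < M.+1 | (j <= i)%N) wt R j.
    by rewrite sum_wt_le.
  apply: (@weighted_cauchy_schwarz _ (fun j : 'I_M.+1 => (j <= i)%N) (fun j => a j) (fun j => wt R j)).
  by move=> j; exact: wt_gt0.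
have sE : s = - \sum_(j < M.+1 | ~~ (j <= i)%N) a j.
  apply/eqP; rewrite -addr_eq0 -[X in _ == X]a0 eq_sym.
  by rewrite [X in X == _](bigID (fun j : 'I_M.+1 => (j <= i)%N)).
have WE : (\sum_(j < M.+1 | ~~ (j <= i)%N) wt R j) = (M - i).*2%:R.
  have := sum_wt M; rewrite (bigID (fun j : 'I_M.+1 => (j <= i)%N))/=.
  rewrite sum_wt_le// => h; apply: (@addrI _ (i.*2.+1%:R : R)).
  by rewrite [LHS]h -natrD; congr _%:R; lia.
have s2 : s ^+ 2 <= (M - i).*2%:R * \sum_(j < M.+1 | ~~ (j <= i)%N) a j ^+ 2 / wt R j.
  rewrite sE sqrrN -WE.
  apply: (@weighted_cauchy_schwarz _ (fun j : 'I_M.+1 => ~~ (j <= i)%N) (fun j => a j) (fun j => wt R j)).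
  by move=> j; exact: wt_gt0.
rewrite /energy (bigID (fun j : 'I_M.+1 => (j <= i)%N))/=.
set e1 := \sum_(j < M.+1 | (j <= i)%N) _ in s1 *; set e2 := \sum_(j < M.+1 | ~~ _) _ in s2 *.
have -> : M.*2.+1%:R = i.*2.+1%:R + (M - i).*2%:R :> R by rewrite -natrD; congr _%:R; lia.
move: s1 s2; move: (i.*2.+1%:R) (ler0n R i.*2.+1) ((M - i).*2%:R) (ler0n R (M - i).*2) => p p0 q q0 s1 s2.
have := ler_wpM2l q0 s1; have := ler_wpM2l p0 s2; lra.
Qed.

Lemma sum_partial M : \sum_(i < M) i.*2.+1%:R * (M - i).*2%:R = (M * M.+1 * M.*2.+1)%:R / 3 :> R.
Proof.
apply: (@mulIf _ 3%:R) => //; rewrite divfK// mulr_suml.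
(* The summand contains [M], so the induction is on the number of terms with [M] fixed. *)
suff H n : (n <= M)%N -> \sum_(i < n) (i.*2.+1%:R * (M - i).*2%:R) * 3 =
    6 * M%:R * n%:R ^+ 2 - n%:R * (n%:R - 1) * (4 * n%:R + 1) :> R.
  rewrite H// !natrM -!natr1 -!mul2n natrM; ring.
elim: n => [|n IH] nM; first by rewrite big_ord0; ring.
rewrite big_ord_recr/= IH 1?ltnW// -!mul2n -!natr1 !natrM natrB 1?ltnW//; ring.
Qed.

Section Weights.
Variables (A k0 k1 k2 : R).

Definition quad_ker x : R := k0 + k1 * `|x| + k2 * x ^+ 2.

(* The values at [cos (n * t)] of the discretised pairing with [A * dirac_0 + quad_ker]. *)
Definition quad_weight N n : R := (n == 0%N)%:R * A + N%:R^-1 * quad_ker (n%:R / N%:R).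

Variable M : nat.
Let N := M.*2.+1.
Let w := quad_weight N.
Let Np : 0 < N%:R :> R. Proof. by []. Qed.
Let NE : N%:R = 2 * M%:R + 1 :> R.
Proof. by rewrite /N -natr1 -mul2n natrM. Qed.

Definition cos_ker j k := 2^-1 * (w ((j - k) + (k - j))%N + w (j + k)%N).

(** For x, y >= 0 the means of [|x - y|, |x + y|] and of their squares are [max x y] and
    [x^2 + y^2]. Dividing [A] by the weight accounts for [j = k = 0], where the sum index also hits
    the Dirac term. *)
Lemma cos_kerE j k : cos_ker j k = (j == k)%:R * (A / wt R j) + N%:R^-1 *
  (k0 + k1 / N%:R * (maxn j k)%:R + k2 / N%:R ^+ 2 * (j%:R ^+ 2 + k%:R ^+ 2)).
Proof.
wlog jk : j k / (j <= k)%N => [hw|].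
  case/orP: (leq_total j k) => [jk|kj]; first exact: hw.
  have := hw k j kj; rewrite /cos_ker addnC (addnC j) => ->.
  rewrite eq_sym maxnC [_ + k%:R ^+ 2]addrC; congr (_ + _).
  by have [->//|jk] := eqVneq j k; rewrite !mul0r.
rewrite /cos_ker (_ : (j - k) + (k - j) = k - j)%N; last by lia.
rewrite (maxn_idPr jk) /w /quad_weight /quad_ker subn_eq0 !ger0_norm ?divr_ge0//.
rewrite natrB// natrD.
have N0 : N%:R != 0 :> R by rewrite gt_eqF.
have [jE|jnk] := eqVneq j k.
  subst k; rewrite leqnn /wt addn_eq0 andbb; case: (j == 0%N) => /=; by field.
rewrite leqNgt (ltn_neqAle j k) jnk jk /= addn_eq0.
have -> : (j == 0%N) && (k == 0%N) = false by lia.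
by rewrite /= !mul0r; field.
Qed.

Lemma sin_ker_diffE j k : 2^-1 * (w ((j - k) + (k - j))%N - w (j + k).+2) =
  (j == k)%:R * (A / 2) - N%:R^-1 * (k1 / N%:R * (minn j k).+1%:R + 2 * k2 / N%:R ^+ 2 * (j.+1%:R * k.+1%:R)).
Proof.
wlog jk : j k / (j <= k)%N => [hw|].
  case/orP: (leq_total j k) => [jk|kj]; first exact: hw.
  have := hw k j kj; rewrite addnC (addnC k j) => ->.
  by rewrite eq_sym minnC [j.+1%:R * _]mulrC.
rewrite (_ : (j - k) + (k - j) = k - j)%N; last by lia.
rewrite (minn_idPl jk) /w /quad_weight /quad_ker subn_eq0 !ger0_norm ?divr_ge0//.
rewrite natrB// -(addn2 (j + k)) !natrD -!natr1.
have N0 : N%:R != 0 :> R by rewrite gt_eqF.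
rewrite (_ : (j + k + 2 == 0)%N = false); last by lia.
have [jE|jnk] := eqVneq j k.
  by subst k; rewrite leqnn /=; field.
by rewrite leqNgt (ltn_neqAle j k) jnk jk /=; field.
Qed.

Hypotheses (k1ge0 : 0 <= k1) (k1A : k1 <= 12 * A).

(** On sequences of total 0 the constant and the quadratic part vanish, leaving [A * energy] minus
    [k1 / N ^ 2] times the sum S of squared partial sums. The bound [12 S <= N ^ 2 * energy] follows
    from [sqr_partial_sum], [sum_partial] and [4 M (M + 1) <= N ^ 2], whence the 12 in the
    hypothesis. *)
Lemma cos_form_ge0 a : \sum_(j < M.+1) a j = 0 ->
  0 <= \sum_(j < M.+1) \sum_(k < M.+1) a j * a k * cos_ker j k.
Proof.
move=> a0.
have sq0 : \sum_(j < M.+1) \sum_(k < M.+1) a j * a k * (j%:R ^+ 2 + k%:R ^+ 2) = 0.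
  rewrite (eq_bigr (fun j : 'I_M.+1 => a j * j%:R ^+ 2 * (\sum_(k < M.+1) a k) + a j * (\sum_(k < M.+1) a k * k%:R ^+ 2))); last first.
    move=> j _; rewrite !mulr_sumr -big_split/=; apply: eq_bigr => k _; ring.
  by rewrite big_split/= -mulr_suml a0 -mulr_suml a0 mul0r mulr0 addr0.
have one0 : \sum_(j < M.+1) \sum_(k < M.+1) a j * a k = 0.
  rewrite (eq_bigr (fun j : 'I_M.+1 => a j * (\sum_(k < M.+1) a k))); last first.
    by move=> j _; rewrite mulr_sumr.
  by rewrite -mulr_suml a0 mul0r.
have diag : \sum_(j < M.+1) \sum_(k < M.+1) a j * a k * ((j == k :> nat)%:R * (A / wt R j)) = A * energy M.+1 a.
  rewrite /energy mulr_sumr; apply: eq_bigr => j _.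
  rewrite (bigD1 j)//= big1 ?addr0; last first.
    move=> k kj; have -> : (j == k :> nat) = false by rewrite eq_sym; exact: negbTE.
    by rewrite mul0r mulr0.
  rewrite eqxx mul1r; ring.
have -> : \sum_(j < M.+1) \sum_(k < M.+1) a j * a k * cos_ker j k =
    \sum_(j < M.+1) \sum_(k < M.+1) a j * a k * ((j == k :> nat)%:R * (A / wt R j)) +
    N%:R^-1 * (k0 * \sum_(j < M.+1) \sum_(k < M.+1) a j * a k +
      k1 / N%:R * (\sum_(j < M.+1) \sum_(k < M.+1) a j * a k * (maxn j k)%:R) +
      k2 / N%:R ^+ 2 * \sum_(j < M.+1) \sum_(k < M.+1) a j * a k * (j%:R ^+ 2 + k%:R ^+ 2)).
  rewrite !mulr_sumr -!big_split/= mulr_sumr -big_split/=.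
  apply: eq_bigr => j _; rewrite !mulr_sumr -!big_split/= mulr_sumr -big_split/=.
  by apply: eq_bigr => k _; rewrite cos_kerE; ring.
rewrite diag one0 sum_maxn_kernel// sq0.
set S := \sum_(i < M) _.
have S3 : 3 * N%:R * S <= (M * M.+1 * N)%:R * energy M.+1 a.
  rewrite -mulrA mulr_sumr.
  apply: (@le_trans _ _ (3 * \sum_(i < M) i.*2.+1%:R * (M - i).*2%:R * energy M.+1 a)).
    by rewrite ler_wpM2l//; apply: ler_sum => i _; exact: sqr_partial_sum.
  by rewrite -mulr_suml sum_partial mulrA mulrC [3 * _]mulrC divfK// mulrC.
have E0 := energy_ge0 M.+1 a.
have S12 : 12 * S <= N%:R ^+ 2 * energy M.+1 a.
  have : 3 * S <= (M * M.+1)%:R * energy M.+1 a.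
    by rewrite -(ler_pM2r Np); move: S3; rewrite natrM; lra.
  move=> h; have : 4 * (3 * S) <= 4 * ((M * M.+1)%:R * energy M.+1 a) by rewrite ler_wpM2l.
  rewrite (_ : 4 * (3 * S) = 12 * S); last by ring.
  move=> /le_trans; apply; rewrite mulrA ler_wpM2r// NE natrM -natr1.
  by rewrite -subr_ge0 (_ : _ - _ = 1)//; ring.
have : k1 * S <= A * (N%:R ^+ 2 * energy M.+1 a).
  have := ler_wpM2l k1ge0 S12; have E2 : 0 <= N%:R ^+ 2 * energy M.+1 a by rewrite mulr_ge0.
  have := ler_wpM2r E2 k1A; lra.
move=> h; have -> : A * energy M.+1 a + N%:R^-1 * (k0 * 0 + k1 / N%:R * - S + k2 / N%:R ^+ 2 * 0) =
    (A * (N%:R ^+ 2 * energy M.+1 a) - k1 * S) / N%:R ^+ 2.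
  by field; rewrite gt_eqF.
by rewrite divr_ge0// subr_ge0.
Qed.

Hypotheses (A0 : 0 < A) (k2le0 : k2 <= 0) (k21 : - k2 <= k1).
Hypothesis k12A : k1 / 2 + k2 / 3 <= 2 * A.

(* The part subtracted from [A / 2 * \sum_j b j ^ 2] has a kernel with
   [ker j k ^ 2 <= ker j j * ker k k], so it is at most its trace times the sum of squares. *)
Lemma sin_form_ge0 b : 0 <=
  \sum_(j < M) \sum_(k < M) b j * b k * (2^-1 * (w ((j - k) + (k - j))%N - w (j + k).+2)).
Proof.
pose d j : R := k1 / N%:R * j.+1%:R + 2 * k2 / N%:R ^+ 2 * (j.+1%:R * j.+1%:R).
pose ker j k : R := k1 / N%:R * (minn j k).+1%:R + 2 * k2 / N%:R ^+ 2 * (j.+1%:R * k.+1%:R).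
(* For [j <= k] the kernel is [x_j * tau k] with [x_j = (j + 1) / N]. Since [x] increases and [tau]
   decreases, its square is at most the product of the diagonal values. As [x_j <= 1 / 2],
   [- k2 <= k1] makes [tau] nonnegative. *)
pose tau j := k1 + 2 * k2 * (j.+1%:R / N%:R).
have jN j : (j < M)%N -> j.+1%:R / N%:R <= 2^-1 :> R.
  move=> jM; rewrite ler_pdivrMr// NE.
  have : j.+1%:R <= M%:R :> R by rewrite ler_nat.
  lra.
have tau0 j : (j < M)%N -> 0 <= tau j.
  move=> jM; have h := jN j jM.
  have h0 : 0 <= j.+1%:R / N%:R :> R by rewrite divr_ge0.
  rewrite /tau; move: (j.+1%:R / N%:R) h => x h.
  have : 0 <= - k2 * (2^-1 - x) by rewrite mulr_ge0 ?subr_ge0// oppr_ge0.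
  by have := k21; rewrite mulrDr mulrN; lra.
have N0 : N%:R != 0 :> R by rewrite gt_eqF.
have dE j : d j = j.+1%:R / N%:R * tau j by rewrite /d /tau; field.
have d0 j : (j < M)%N -> 0 <= d j.
  by move=> jM; rewrite dE mulr_ge0 ?divr_ge0 ?tau0.
have kerB j k : (j < M)%N -> (k < M)%N -> `|ker j k| <= Num.sqrt (d j) * Num.sqrt (d k).
  wlog jk : j k / (j <= k)%N => [hw jM kM|jM kM].
    case/orP: (leq_total j k) => [jk|kj]; first exact: hw.
    have := hw k j kj kM jM; rewrite mulrC => h; apply: le_trans h.
    by rewrite /ker minnC [j.+1%:R * _]mulrC.
  have -> : ker j k = j.+1%:R / N%:R * tau k.
    by rewrite /ker (minn_idPl jk) /tau; field.
  rewrite ger0_norm ?mulr_ge0 ?divr_ge0 ?tau0// -sqrtrM ?d0//.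
  rewrite -[leLHS]ger0_norm ?mulr_ge0 ?divr_ge0 ?tau0// -sqrtr_sqr ler_wsqrtr// !dE expr2.
  have jkR : j.+1%:R / N%:R <= k.+1%:R / N%:R :> R by rewrite ler_wpM2r ?invr_ge0// ler_nat.
  have tjk : tau k <= tau j.
    by rewrite /tau lerD2l -![2 * k2 * _]mulrA ler_pM2l// ler_wnM2l.
  have tk := tau0 k kM; have x0 : 0 <= j.+1%:R / N%:R :> R by rewrite divr_ge0.
  move: (j.+1%:R / N%:R) (k.+1%:R / N%:R) (tau j) (tau k) x0 jkR tk tjk => x y tj tk x0 xy tk0 tkj.
  have : x * tk <= y * tj by apply: ler_pM.
  move=> h; have : x * tk * (x * tk) <= x * tk * (y * tj) by rewrite ler_wpM2l// mulr_ge0.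
  lra.
(* The trace is exactly [M (M + 1) (k1 / 2 + k2 / 3) / N], and [M (M + 1) <= N ^ 2 / 4]; this is
   where [k12A] is used. *)
have sumd : \sum_(j < M) d j <= N%:R * (A / 2).
  have s1 n : \sum_(j < n) j.+1%:R = n%:R * (n%:R + 1) / 2 :> R.
    elim: n => [|n IH]; first by rewrite big_ord0; field.
    by rewrite big_ord_recr/= IH -!natr1; field.
  have s2 n : \sum_(j < n) (j.+1%:R * j.+1%:R) = n%:R * (n%:R + 1) * (2 * n%:R + 1) / 6 :> R.
    elim: n => [|n IH]; first by rewrite big_ord0; field.
    by rewrite big_ord_recr/= IH -!natr1; field.
  rewrite /d big_split/= -!mulr_sumr s1 s2 -NE.
  rewrite (_ : _ + _ = (M%:R * (M%:R + 1)) * (k1 / 2 + k2 / 3) / N%:R); last by field.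
  rewrite ler_pdivrMr//.
  have MN : M%:R * (M%:R + 1) <= N%:R ^+ 2 / 4 :> R.
    by rewrite NE -subr_ge0 (_ : _ - _ = 4^-1)//; field.
  have M0 : 0 <= M%:R * (M%:R + 1) :> R by rewrite mulr_ge0// addr_ge0.
  have := ler_wpM2l M0 k12A; have A2 : 0 <= 2 * A by rewrite mulr_ge0// ltW.
  by have := ler_wpM2r A2 MN; lra.
rewrite (_ : \sum_(j < M) _ = A / 2 * (\sum_(j < M) b j ^+ 2) - N%:R^-1 * \sum_(j < M) \sum_(k < M) b j * b k * ker j k); last first.
  rewrite !mulr_sumr -sumrB; apply: eq_bigr => j _.
  rewrite mulr_sumr (bigD1 j)//= [in RHS](bigD1 j)//= sin_ker_diffE eqxx opprD addrA.
  congr (_ + _); first by rewrite /ker mul1r; ring.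
  rewrite -sumrN; apply: eq_bigr => k kj; rewrite sin_ker_diffE.
  have -> : (j == k :> nat) = false by rewrite eq_sym; exact: negbTE.
  rewrite /ker mul0r; ring.
rewrite subr_ge0 ler_pdivrMl//.
have B0 : 0 <= \sum_(j < M) b j ^+ 2 by apply: sumr_ge0 => j _; exact: sqr_ge0.
apply: (@le_trans _ _ ((\sum_(j < M) Num.sqrt (d j) * `|b j|) ^+ 2)).
  rewrite expr2 mulr_suml; apply: ler_sum => j _; rewrite mulr_sumr; apply: ler_sum => k _.
  apply: le_trans (ler_norm _) _; rewrite normrM normrM [leRHS]mulrACA mulrC.
  by rewrite ler_wpM2r ?mulr_ge0// kerB.
apply: (@le_trans _ _ ((\sum_(j < M) d j) * (\sum_(j < M) b j ^+ 2))); last first.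
  by rewrite mulrA ler_wpM2r.
rewrite [X in _ <= X * _](eq_bigr (fun j : 'I_M => Num.sqrt (d j) ^+ 2)); last first.
  by move=> j _; rewrite sqr_sqrtr//; exact: d0.
rewrite [X in _ <= _ * X](eq_bigr (fun j : 'I_M => `|b j| ^+ 2)); last by move=> j _; rewrite real_normK ?num_real.
exact: cauchy_schwarz_sum.
Qed.

End Weights.
End FiniteForms.

(** * The cosine form and an approximate solution of the equation *)

Section Perturbation.
Variable R : realType.
Implicit Types (x y r t v : R) (a b c w s gam : nat -> R) (M N n d : nat).

Section Form.
Variables (A k0 k1 k2 : R).
Hypotheses (A0 : 0 < A) (k1ge0 : 0 <= k1) (k1A : k1 <= 12 * A).
Variable M : nat.
Notation N := M.*2.+1.
Notation ker := (cos_ker A k0 k1 k2 M).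

Lemma cos_ker_sym j k : ker j k = ker k j.
Proof.
rewrite !cos_kerE maxnC [j%:R ^+ 2 + _]addrC eq_sym; congr (_ + _).
by have [->//|_] := eqVneq j k; rewrite !mul0r.
Qed.

Definition cos_form a := \sum_(j < M.+1) \sum_(k < M.+1) a j * a k * ker j k.

(* [cos_form_ge0] applies to the difference of [a] and the multiple of [gam] with the same sum. *)
Lemma cos_form_lower a gam ep : 0 < \sum_(j < M.+1) gam j ->
  (forall j, (j <= M)%N -> `|\sum_(k < M.+1) ker j k * gam k - A| <= ep) ->
  A * (\sum_(j < M.+1) a j) ^+ 2 / (\sum_(j < M.+1) gam j) <= cos_form a +
   (2 * ep / (\sum_(j < M.+1) gam j) +
    ep * (\sum_(j < M.+1) `|gam j|) / (\sum_(j < M.+1) gam j) ^+ 2) * (N%:R * energy M.+1 a).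
Proof.
set Gam := \sum_(j < M.+1) gam j => Gam0 hb; set I := \sum_(j < M.+1) a j.
set T := \sum_(j < M.+1) `|gam j|.
pose lam := I / Gam; pose b j := \sum_(k < M.+1) ker j k * gam k.
pose e j := b j - A.
have ep0 : 0 <= ep by apply: le_trans (hb 0%N _).
have := @cos_form_ge0 _ A k0 k1 k2 M k1ge0 k1A (fun j => a j - lam * gam j).
rewrite sumrB -mulr_sumr -/Gam -/I /lam divfK ?gt_eqF// subrr => /(_ erefl).
rewrite -/lam.
have -> : \sum_(j < M.+1) \sum_(k < M.+1) (a j - lam * gam j) * (a k - lam * gam k) * ker j k =
    cos_form a - 2 * lam * (\sum_(j < M.+1) a j * b j) + lam ^+ 2 * (\sum_(j < M.+1) gam j * b j).
  have s1 : \sum_(j < M.+1) \sum_(k < M.+1) a j * gam k * ker j k = \sum_(j < M.+1) a j * b j.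
    by apply: eq_bigr => j _; rewrite mulr_sumr; apply: eq_bigr => k _; ring.
  have s2 : \sum_(j < M.+1) \sum_(k < M.+1) gam j * a k * ker j k = \sum_(j < M.+1) a j * b j.
    rewrite exchange_big -s1; apply: eq_bigr => j _; apply: eq_bigr => k _.
    by rewrite cos_ker_sym; ring.
  have s3 : \sum_(j < M.+1) \sum_(k < M.+1) gam j * gam k * ker j k = \sum_(j < M.+1) gam j * b j.
    by apply: eq_bigr => j _; rewrite mulr_sumr; apply: eq_bigr => k _; ring.
  transitivity (cos_form a - lam * (\sum_(j < M.+1) a j * b j) - lam * (\sum_(j < M.+1) a j * b j) + lam ^+ 2 * (\sum_(j < M.+1) gam j * b j)); last by ring.
  rewrite -{1}s1 -s2 -s3 !mulr_sumr -!sumrB -big_split/=; apply: eq_bigr => j _.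
  rewrite !mulr_sumr -!sumrB -big_split/=; apply: eq_bigr => k _; ring.
have ab : \sum_(j < M.+1) a j * b j = A * I + \sum_(j < M.+1) a j * e j.
  by rewrite mulr_sumr -big_split/=; apply: eq_bigr => j _; rewrite /e; ring.
have gb : \sum_(j < M.+1) gam j * b j = A * Gam + \sum_(j < M.+1) gam j * e j.
  by rewrite mulr_sumr -big_split/=; apply: eq_bigr => j _; rewrite /e; ring.
have eB (x : nat -> R) : `|\sum_(j < M.+1) x j * e j| <= ep * \sum_(j < M.+1) `|x j|.
  apply: le_trans (ler_norm_sum _ _ _) _; rewrite mulr_sumr; apply: ler_sum => j _.
  by rewrite normrM mulrC ler_wpM2r// hb// -ltnS.
rewrite ab gb; set ae := \sum_(j < M.+1) a j * e j; set ge := \sum_(j < M.+1) gam j * e j.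
have -> : cos_form a - 2 * lam * (A * I + ae) + lam ^+ 2 * (A * Gam + ge) =
    cos_form a - A * I ^+ 2 / Gam - 2 * (lam * ae) + lam ^+ 2 * ge.
  by rewrite /lam; field; rewrite gt_eqF.
set S := \sum_(j < M.+1) `|a j|.
have S0 : 0 <= S by exact: sumr_ge0.
have SE : S ^+ 2 <= N%:R * energy M.+1 a.
  apply: le_trans (sqr_sum_energy M (fun j => `|a j|)) _.
  by rewrite /energy; under eq_bigr do rewrite real_normK ?num_real//.
have IS : `|I| <= S by exact: ler_norm_sum.
have I2 : I ^+ 2 <= N%:R * energy M.+1 a.
  by apply: le_trans SE; rewrite -real_normK ?num_real// lerXn2r ?nnegrE.
have h1 : `|lam * ae| <= ep / Gam * (N%:R * energy M.+1 a).
  rewrite normrM /lam normrM normfV (gtr0_norm Gam0).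
  apply: (@le_trans _ _ (S / Gam * (ep * S))).
    by apply: ler_pM => //; [rewrite divr_ge0// ltW|rewrite ler_wpM2r// invr_ge0 ltW|exact: eB].
  rewrite (_ : S / Gam * (ep * S) = ep / Gam * S ^+ 2); last by ring.
  by rewrite ler_wpM2l// divr_ge0// ltW.
have T0 : 0 <= T by exact: sumr_ge0.
have h2 : `|lam ^+ 2 * ge| <= ep * T / Gam ^+ 2 * (N%:R * energy M.+1 a).
  rewrite normrM ger0_norm ?sqr_ge0// /lam expr_div_n.
  apply: (@le_trans _ _ (I ^+ 2 / Gam ^+ 2 * (ep * T))).
    by apply: ler_wpM2l; [apply: divr_ge0; exact: sqr_ge0|exact: eB].
  rewrite (_ : I ^+ 2 / Gam ^+ 2 * (ep * T) = ep * T / Gam ^+ 2 * I ^+ 2); last by ring.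
  by apply: ler_wpM2l => //; apply: divr_ge0; [exact: mulr_ge0|exact: sqr_ge0].
move: h1 h2; rewrite !ler_norml => /andP[h1 _] /andP[_ h2].
set X := N%:R * energy M.+1 a in h1 h2 *.
have -> : (2 * ep / Gam + ep * T / Gam ^+ 2) * X = 2 * (ep / Gam * X) + ep * T / Gam ^+ 2 * X by ring.
lra.
Qed.

(** The condition [2 * C2 <= N * ig] gives [N * ig <= 2 * Gam], so [Gam^-1] may be replaced by
    [2 / (N * ig)]. The three error terms then come from the equation, from its pairing with [gam],
    and from exchanging [Gam] for [N * ig]. *)
Lemma cos_form_bound a gam (C1 C2 B ig : R) : 0 < ig -> 0 <= C1 -> 0 <= C2 -> 0 <= B ->
  (forall j, (j <= M)%N -> `|\sum_(k < M.+1) ker j k * gam k - A| <= C1 / N%:R) ->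
  \sum_(j < M.+1) `|gam j| <= N%:R * B ->
  `|\sum_(j < M.+1) gam j - N%:R * ig| <= C2 -> 2 * C2 <= N%:R * ig ->
  A / ig / N%:R * (\sum_(j < M.+1) a j) ^+ 2 <= cos_form a +
    (4 * C1 / ig + 4 * C1 * B / ig ^+ 2 + 2 * A * C2 / ig ^+ 2) / N%:R * energy M.+1 a.
Proof.
set Gam := \sum_(j < M.+1) gam j; set I := \sum_(j < M.+1) a j.
set T := \sum_(j < M.+1) `|gam j| => ig0 C10 C20 B0 hb TB GC NC.
have n0 : 0 < N%:R :> R by [].
have Nig : 0 < N%:R * ig by rewrite mulr_gt0.
have GN : N%:R * ig <= 2 * Gam.
  by move: GC; rewrite ler_norml => /andP[h _]; lra.
have Gam0 : 0 < Gam by lra.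
have := cos_form_lower a Gam0 hb; rewrite -/I -/Gam -/T => h.
have E0 := energy_ge0 M.+1 a.
have I2 : I ^+ 2 <= N%:R * energy M.+1 a by exact: sqr_sum_energy.
have iG : Gam^-1 <= 2 / (N%:R * ig).
  by rewrite -div1r ler_pdivrMr// mulrAC ler_pdivlMr// mul1r.
have iG0 : 0 <= Gam^-1 by rewrite invr_ge0 ltW.
have E1 : 0 <= N%:R * energy M.+1 a by rewrite mulr_ge0.
have t1 : 2 * (C1 / N%:R) / Gam * (N%:R * energy M.+1 a) <= 4 * C1 / ig / N%:R * energy M.+1 a.
  apply: (@le_trans _ _ (2 * (C1 / N%:R) * (2 / (N%:R * ig)) * (N%:R * energy M.+1 a))).
    by rewrite ler_wpM2r// ler_wpM2l// mulr_ge0// divr_ge0.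
  by rewrite le_eqVlt; apply/orP; left; apply/eqP; field; rewrite !gt_eqF.
have t2 : C1 / N%:R * T / Gam ^+ 2 * (N%:R * energy M.+1 a) <= 4 * C1 * B / ig ^+ 2 / N%:R * energy M.+1 a.
  apply: (@le_trans _ _ (C1 / N%:R * (N%:R * B) * (2 / (N%:R * ig)) ^+ 2 * (N%:R * energy M.+1 a))).
    rewrite ler_wpM2r//; apply: ler_pM.
    - by rewrite mulr_ge0 ?divr_ge0// sumr_ge0.
    - by rewrite invr_ge0 sqr_ge0.
    - by rewrite ler_wpM2l// divr_ge0.
    - by rewrite -exprVn lerXn2r ?nnegrE// divr_ge0// ltW.
  by rewrite le_eqVlt; apply/orP; left; apply/eqP; field; rewrite !gt_eqF.
have t3 : A / ig / N%:R * I ^+ 2 - A * I ^+ 2 / Gam <= 2 * A * C2 / ig ^+ 2 / N%:R * energy M.+1 a.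
  have -> : A / ig / N%:R * I ^+ 2 - A * I ^+ 2 / Gam = A * I ^+ 2 / (N%:R * ig) * ((Gam - N%:R * ig) / Gam).
    by field; rewrite !gt_eqF.
  apply: (@le_trans _ _ (A * (N%:R * energy M.+1 a) / (N%:R * ig) * (C2 * (2 / (N%:R * ig))))).
    apply: (@le_trans _ _ (A * I ^+ 2 / (N%:R * ig) * (C2 * (2 / (N%:R * ig))))).
      rewrite ler_wpM2l//; first by apply: divr_ge0; [apply: mulr_ge0; [exact: ltW|exact: sqr_ge0]|exact: ltW].
      apply: (@le_trans _ _ (C2 / Gam)).
        by rewrite ler_wpM2r//; apply: le_trans GC; exact: ler_norm.
      by rewrite ler_wpM2l.
    rewrite ler_wpM2r; first by [].
      by rewrite mulr_ge0// divr_ge0// ltW.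
    by rewrite ler_wpM2r ?invr_ge0 ?(ltW Nig)// ler_wpM2l// ltW.
  by rewrite le_eqVlt; apply/orP; left; apply/eqP; field; rewrite !gt_eqF.
move: h; rewrite (mulrDl (2 * (C1 / N%:R) / Gam)) => h.
have -> : (4 * C1 / ig + 4 * C1 * B / ig ^+ 2 + 2 * A * C2 / ig ^+ 2) / N%:R * energy M.+1 a =
  4 * C1 / ig / N%:R * energy M.+1 a + 4 * C1 * B / ig ^+ 2 / N%:R * energy M.+1 a +
  2 * A * C2 / ig ^+ 2 / N%:R * energy M.+1 a by ring.
move: t1 t2 t3 h.
move: (2 * (C1 / N%:R) / Gam * _) (C1 / N%:R * T / Gam ^+ 2 * _) (A * I ^+ 2 / Gam) => x1 x2 x3.
move: (4 * C1 / ig / N%:R * _) (4 * C1 * B / ig ^+ 2 / N%:R * _) => y1 y2.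
move: (2 * A * C2 / ig ^+ 2 / N%:R * _) (A / ig / N%:R * I ^+ 2) (cos_form a) => y3 z f.
lra.
Qed.

End Form.

(** The error of [cos_form_bound] is a multiple of [energy / N], so it can be absorbed by enlarging
    the Dirac coefficient. *)
Lemma cos_form_shift A k0 k1 k2 M C a : cos_form (A + C) k0 k1 k2 M a =
  cos_form A k0 k1 k2 M a + C * energy M.+1 a.
Proof.
rewrite /cos_form /energy mulr_sumr -big_split/=; apply: eq_bigr => j _.
rewrite (bigD1 j)//= [in RHS](bigD1 j)//= -addrA [X in _ = _ + X]addrC addrA; congr (_ + _).
  by rewrite !cos_kerE eqxx !mul1r; ring.
apply: eq_bigr => k kj; rewrite !cos_kerE.
have -> : (j == k :> nat) = false by rewrite eq_sym; exact: negbTE.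
by rewrite !mul0r.
Qed.

End Perturbation.

(** * Riemann sums with an error bound *)

Section Riemann.
Variable R : realType.
Implicit Types (f : R -> R) (a b h : R).

Lemma zext_split a b c f : a <= b -> b <= c -> continuous f ->
  intR (zext a c f) = intR (zext a b f) + intR (zext b c f).
Proof.
move=> ab bc cf; have L x y : L1 (zext x y f) by exact: L1_zext.
rewrite -intRD//; apply: (@intR_seq _ [:: b]) => //.
  by apply: L1_measurable; exact: L1D.
move=> x; rewrite inE => xb; rewrite /zext.
have [xlb|blx|xE] := ltgtP x b; last by rewrite xE eqxx in xb.
  by rewrite andbT addr0 (le_trans (ltW xlb) bc) andbT.
by rewrite andbF add0r (le_trans ab (ltW blx)).
Qed.

Lemma zext_point a f : measurable_fun setT f -> intR (zext a a f) = 0.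
Proof.
move=> mf; rewrite -[RHS](@intR0 R); apply/esym; apply: (@intR_seq _ [:: a]).
- exact: L1_0.
- exact: measurable_zext.
- move=> x; rewrite inE => xa; rewrite /zext.
  by have [xlta|altx|xE] := ltgtP x a => //; rewrite xE eqxx in xa.
Qed.

Lemma zext_cst a b (k : R) : a <= b -> intR (zext a b (fun=> k)) = k * (b - a).
Proof.
move=> ab; have c1 : continuous (fun _ : R => 1 : R) by exact: cst_continuous.
transitivity (intR (fun x => k * zext a b (fun=> 1) x)).
  by apply: intR_eq => x; rewrite /zext; case: ifP; rewrite ?mulr1 ?mulr0.
by rewrite intRZ; [rewrite (@FTC_zext _ _ _ id)|exact: L1_zext].
Qed.

Lemma zext_sample f a b s (L : R) : a <= b -> continuous f ->
  (forall x, a <= x <= b -> `|f s - f x| <= L) ->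
  `|(b - a) * f s - intR (zext a b f)| <= L * (b - a).
Proof.
move=> ab cf fL; rewrite mulrC -(zext_cst (f s) ab).
have cc (k : R) : continuous (fun _ : R => k) by exact: cst_continuous.
rewrite -intRB; [|exact: L1_zext|exact: L1_zext].
apply: le_trans (intR_norm _) _; first by apply: L1B; exact: L1_zext.
rewrite -(zext_cst L ab); apply: intR_le.
- by apply: L1_norm; apply: L1B; exact: L1_zext.
- exact: L1_zext.
- by move=> x; rewrite /zext; case: ifPn => [/fL//|_]; rewrite subr0 normr0.
Qed.

(** The sample points are free as long as the oscillation on each cell is bounded, so the lemma
    covers midpoints, used for g, and left ends, used for phi^. *)
Lemma riemann_sum f a h Lam (s : nat -> R) n : 0 <= h -> continuous f ->
  (forall i x, (i < n)%N -> a + i%:R * h <= x <= a + i.+1%:R * h ->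
     `|f (s i) - f x| <= Lam) ->
  `|h * \sum_(i < n) f (s i) - intR (zext a (a + n%:R * h) f)| <= n%:R * h * Lam.
Proof.
move=> h0 cf; elim: n => [|n IH] fL.
  rewrite big_ord0 mulr0 sub0r normrN !mul0r addr0 zext_point ?normr0//.
  exact: continuous_measurable_fun.
have IHn := IH (fun i x (i_n : (i < n)%N) => fL i x (ltnW i_n)).
have an : a <= a + n%:R * h by rewrite lerDl mulr_ge0.
have nn : a + n%:R * h <= a + n.+1%:R * h by rewrite lerD2l ler_wpM2r// ler_nat.
rewrite (zext_split an nn cf) big_ord_recr/= mulrDr.
have := zext_sample nn cf (fun x => fL n x (ltnSn n)).
have -> : a + n.+1%:R * h - (a + n%:R * h) = h by rewrite -natr1; ring.
move=> h1; rewrite opprD addrACA; apply: le_trans (ler_normD _ _) _.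
have -> : n.+1%:R * h * Lam = n%:R * h * Lam + Lam * h by rewrite -natr1; ring.
exact: lerD.
Qed.

End Riemann.

(** * The integral equation *)

Section IntegralEquation.
Variable R : realType.
Implicit Types (x y t : R).
Notation half := (2^-1 : R).

Section General.
Variables (A k0 k1 k2 om al be : R).
Let S := sin (om / 2).
Let C := cos (om / 2).
Hypotheses (om0 : om != 0) (k1n0 : k1 != 0) (omA : om ^+ 2 * A = 2 * k1).
Hypothesis h1 : be * (k1 + k2) = - 2 * k2 * al * (S / om).
Hypothesis h2 : A * be + be * (k0 + k1 / 4 + k2 / 12) +
  al * (2 * k0 * (S / om) + k1 * (S / om) + A * C +
        k2 * (S / om / 2 + C * A / k1 - 2 * (A / k1) * (S / om))) = A.

Let g t := al * cos (om * t) + be.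

(** Two integrations by parts of the quadratic against the cosine. The slope [j] is [k1] for t below
    x and [- k1] above, since the kernel contains [|x - t|]. *)
Let prim (j : R) x t :=
  al * ((k0 + j * (x - t) + k2 * (x - t) ^+ 2) * sin (om * t) / om -
        (j + 2 * k2 * (x - t)) * cos (om * t) / om ^+ 2 - 2 * k2 * sin (om * t) / om ^+ 3) -
  be * (k0 * (x - t) + j * (x - t) ^+ 2 / 2 + k2 * (x - t) ^+ 3 / 3).

Let is_derive_prim j x t : is_derive t 1 (prim j x)
  (g t * (k0 + j * (x - t) + k2 * (x - t) ^+ 2)).
Proof. by apply: is_derive_eq; rewrite /GRing.scale /= /g; field. Qed.

Lemma cos_affine_cont : continuous g.
Proof. by rewrite /g; cont. Qed.

Lemma intR_cos_affine : intR (zext (- half) half g) = 2 * al * (S / om) + be.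
Proof.
have d t : is_derive t 1 (fun t => al * (sin (om * t) / om) + be * t) (g t).
  by apply: is_derive_eq; rewrite /GRing.scale /= /g; field.
have hh : - half <= half by lra.
rewrite (FTC_zext hh cos_affine_cont d) !mulrN sinN /S; field.
exact: om0.
Qed.

(** Differentiating twice gives [A g'' + 2 k1 g + 2 k2 int g = 0], so g is a cosine plus a constant.
    [omA] cancels the oscillating part, [h1] is the remaining constant in this differential
    equation, and [h2] is the integral equation at x = 0; the difference of the two sides is [x ^ 2]
    times the first defect plus the second. *)
Lemma integral_equation x : - half <= x -> x <= half ->
  A * g x + intR (zext (- half) half (fun t => g t * quad_ker k0 k1 k2 (x - t))) = A.
Proof.
move=> xl xr.
have cq : continuous (fun t => g t * quad_ker k0 k1 k2 (x - t)).
  by rewrite /quad_ker /g; cont.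
rewrite (zext_split xl xr cq).
have -> : intR (zext (- half) x (fun t => g t * quad_ker k0 k1 k2 (x - t))) =
    prim k1 x x - prim k1 x (- half).
  have c : continuous (fun t => g t * (k0 + k1 * (x - t) + k2 * (x - t) ^+ 2)) by rewrite /g; cont.
  rewrite -(FTC_zext xl c (is_derive_prim k1 x)); apply: intR_eq => t; rewrite /zext.
  by case: ifP => // /andP[_ tx]; rewrite /quad_ker ger0_norm// subr_ge0.
have -> : intR (zext x half (fun t => g t * quad_ker k0 k1 k2 (x - t))) =
    prim (- k1) x half - prim (- k1) x x.
  have c : continuous (fun t => g t * (k0 + - k1 * (x - t) + k2 * (x - t) ^+ 2)) by rewrite /g; cont.
  rewrite -(FTC_zext xr c (is_derive_prim (- k1) x)); apply: intR_eq => t; rewrite /zext.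
  case: ifP => // /andP[xt _]; rewrite /quad_ker ler0_norm ?subr_le0//.
  by rewrite mulrN mulNr.
have AE : A = 2 * k1 / om ^+ 2 by rewrite -omA; field.
apply/eqP; rewrite -subr_eq0; apply/eqP.
transitivity (x ^+ 2 * (be * (k1 + k2) - (- 2 * k2 * al * (S / om))) +
  (A * be + be * (k0 + k1 / 4 + k2 / 12) +
  al * (2 * k0 * (S / om) + k1 * (S / om) + A * C +
        k2 * (S / om / 2 + C * A / k1 - 2 * (A / k1) * (S / om))) - A)); last first.
  by rewrite h1 h2; ring.
rewrite AE /prim /g !subrr mulrN sinN cosN -/S -/C.
move: (sin (om * x)) (cos (om * x)) => s c.
by field; rewrite k1n0 om0.
Qed.

End General.
End IntegralEquation.

(** * The explicit solutions for the five groups *)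

Section Constants.
Variable R : realType.
Implicit Types (x y t : R) (Gr : group).
Notation half := (2^-1 : R).

Lemma cos_lipschitz x y : `|cos x - cos y| <= `|x - y|.
Proof.
wlog xy : x y / x <= y => [hw|].
  by case/orP: (le_total x y) => h; [exact: hw|rewrite distrC (distrC x); exact: hw].
have cs : continuous (fun t : R => - sin t) by cont.
have d t : is_derive t 1 (@cos R) (- sin t) by exact: is_derive_cos.
have := FTC_zext xy cs d; rewrite distrC => <-.
have L : L1 (zext x y (fun t => - sin t)) by exact: L1_zext.
apply: le_trans (intR_norm L) _.
rewrite distrC ger0_norm ?subr_ge0// -[leRHS]mul1r -(zext_cst 1 xy).
apply: intR_le; [exact: L1_norm|by apply: L1_zext; exact: cst_continuous|].
by move=> t; rewrite /zext; case: ifP => _; rewrite ?normr0// normrN sin_max.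
Qed.

Lemma sin_le_id x : 0 <= x -> sin x <= x.
Proof.
move=> x0; have d t : is_derive t 1 (@sin R) (cos t) by exact: is_derive_sin.
have cc : continuous (@cos R) by exact: continuous_cos.
have := FTC_zext x0 cc d; rewrite sin0 subr0 => <-.
rewrite -[leRHS]subr0 -[leRHS]mul1r -(zext_cst 1 x0).
apply: intR_le; [exact: L1_zext|by apply: L1_zext; exact: cst_continuous|].
by move=> t; rewrite /zext; case: ifP => // _; exact: cos_le1.
Qed.

Lemma cos_ge_quad x : 0 <= x -> 0 <= sin (x / 2) -> 1 - x ^+ 2 / 2 <= cos x.
Proof.
move=> x0 s0; have -> : cos x = 1 - 2 * sin (x / 2) ^+ 2.
  rewrite {1}[x]splitr cosD -!expr2 cos2sin2; ring.
have h : sin (x / 2) <= x / 2 by apply: sin_le_id; rewrite divr_ge0.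
have : sin (x / 2) ^+ 2 <= (x / 2) ^+ 2 by rewrite lerXn2r// nnegrE divr_ge0.
rewrite expr_div_n; lra.
Qed.

Lemma s3_gt0 : 0 < s3 R. Proof. by rewrite sqrtr_gt0. Qed.
Lemma s3_sq : s3 R ^+ 2 = 3. Proof. by rewrite sqr_sqrtr. Qed.

Lemma s3_bounds : 17 / 10 < s3 R /\ s3 R < 18 / 10.
Proof. by have := s3_gt0; have := s3_sq; nra. Qed.

Definition freq Gr : R := match Gr with U => 2 | USp => 4 | _ => 4 / s3 R end.

Definition den Gr : R := let S := sin (freq Gr / 2) in let C := cos (freq Gr / 2) in
  match Gr with
  | SOeven => 162 * C - 5 * s3 R * S
  | SOodd => 11 * s3 R * S + 2 * C
  | U => 3 * C + 4 * S
  | O => 18 * C + 13 * s3 R * S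
  | USp => 2 * C + 3 * S
  end.

Definition amp Gr : R := match Gr with
  SOeven => 216 | SOodd => 8 | U => 6 | O => 36 | USp => 8 end / den Gr.

Definition offset Gr : R := let S := sin (freq Gr / 2) in match Gr with
  SOeven => 36 * s3 R * S | SOodd => 12 * s3 R * S | U => 6 * S
  | O => 18 * s3 R * S | USp => 12 * S end / den Gr.

Lemma s3_half : 4 / s3 R / 2 = 2 / s3 R.
Proof. by field; rewrite gt_eqF// s3_gt0. Qed.

Lemma g_funE Gr x : g_fun Gr x = amp Gr * cos (freq Gr * x) + offset Gr.
Proof.
have e x' : 4 * x' / s3 R = 4 / s3 R * x' by ring.
have e1 : 2 / 2 = 1 :> R by rewrite divff.
have e2 : 4 / 2 = 2 :> R by field.
case: Gr; rewrite /amp /offset /den /= ?s3_half ?e ?e1 ?e2; ring.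
Qed.

(** All angles [freq Gr / 2] are at most 2. For sine and cosine at 1 and at [2 / s3] crude bounds
    suffice; [USp] needs more, since the angle 2 exceeds pi / 2 and its cosine is negative. *)
Lemma sin_cos_freq Gr : [/\ 0 < sin (freq Gr / 2), 0 < den Gr & freq Gr != 0].
Proof.
have s0 := s3_gt0; have [sl sr] := s3_bounds; have sq := s3_sq.
have p2 := pi_ge2 R.
have th0 : 0 < 2 / s3 R by rewrite divr_gt0.
have th2 : 2 / s3 R < 2 by rewrite ltr_pdivrMr//; lra.
have thS : 0 < sin (2 / s3 R) by rewrite sin_gt0_pi// th0/=; lra.
have thS1 := sin_le1 (2 / s3 R).
(* The square of [2 / s3] is 4 / 3, so [cos_ge_quad] gives 1 - 2 / 3. *)
have thC : 3^-1 <= cos (2 / s3 R).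
  have : 0 <= sin (2 / s3 R / 2).
    by rewrite ltW// sin_gt0_pi// divr_gt0//= ltr_pdivrMr//; lra.
  move=> /(cos_ge_quad (ltW th0)); apply: le_trans.
  by rewrite expr_div_n sq; lra.
have S1 : 0 < sin (1 : R) by rewrite sin_gt0_pi// ltr01/=; lra.
have C1 : 2^-1 <= cos (1 : R).
  have : 0 <= sin (1 / 2 : R) by rewrite ltW// sin_gt0_pi// divr_gt0//= ltr_pdivrMr//; lra.
  by move=> /(cos_ge_quad ler01); apply: le_trans; lra.
have D2 : sin (2 : R) = 2 * (sin 1 * cos 1).
  by rewrite (_ : 2 = 1 + 1 :> R) ?sinD//; ring.
have E2 : cos (2 : R) = 2 * cos 1 ^+ 2 - 1.
  by rewrite {1}(_ : 2 = 1 + 1 :> R) ?cosD// -!expr2 sin2cos2; ring.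
have e1 : 2 / 2 = 1 :> R by rewrite divff.
have e2 : 4 / 2 = 2 :> R by field.
have fr : 4 / s3 R != 0 by rewrite gt_eqF// divr_gt0.
case: Gr; rewrite /den /= ?s3_half ?e1 ?e2; split => //.
- have : 0 <= s3 R * (1 - sin (2 / s3 R)) by rewrite mulr_ge0 ?subr_ge0// ltW.
  by rewrite -mulrA; lra.
- have : 0 < s3 R * sin (2 / s3 R) by rewrite mulr_gt0.
  by rewrite -mulrA; lra.
- lra.
- have : 0 < s3 R * sin (2 / s3 R) by rewrite mulr_gt0.
  by rewrite -mulrA; lra.
- by rewrite D2 mulr_gt0// mulr_gt0//; lra.
- rewrite D2 E2; have := cos2Dsin2 (1 : R).
  move: (sin 1) (cos 1) S1 C1 => s c S1 C1 sc.
  (* The sign of [cos 2 = 2 c ^ 2 - 1] decides: if it is negative, then [s] exceeds 2 / 3, and with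
     [c >= 1 / 2] the sine term wins. *)
  have [h|h] := leP 1 (2 * c ^+ 2).
    have : 0 < s * c by rewrite mulr_gt0//; lra.
    lra.
  have s23 : 2 / 3 < s by nra.
  have : 0 < s * (c - 2^-1) + s / 2 by rewrite -[s / 2]mulrC -[s * _]mulrC; nra.
  nra.
Qed.

Lemma group_h1 Gr : offset Gr * (m1 R Gr + m2 R Gr) =
  - 2 * m2 R Gr * amp Gr * (sin (freq Gr / 2) / freq Gr).
Proof.
have [S0 d0 f0] := sin_cos_freq Gr; have s0 := s3_gt0.
have dn : den Gr != 0 by rewrite gt_eqF.
rewrite /offset /amp; move: (den Gr) dn => d dn.
case: Gr S0 d0 f0; rewrite /= /m1 /m2 => S0 d0 f0; move: (sin _) S0 => S S0;
  by field; rewrite ?dn ?gt_eqF.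
Qed.

Lemma group_omA Gr : freq Gr ^+ 2 * c_const R Gr = 2 * m1 R Gr.
Proof.
have s0 := s3_gt0; have sq := s3_sq.
by case: Gr; rewrite /= /m1 ?expr_div_n ?sq; field.
Qed.

Lemma group_h2 Gr : c_const R Gr * offset Gr + offset Gr * (m0 R Gr + m1 R Gr / 4 + m2 R Gr / 12) +
  amp Gr * (2 * m0 R Gr * (sin (freq Gr / 2) / freq Gr) + m1 R Gr * (sin (freq Gr / 2) / freq Gr) +
   c_const R Gr * cos (freq Gr / 2) + m2 R Gr * (sin (freq Gr / 2) / freq Gr / 2 +
     cos (freq Gr / 2) * c_const R Gr / m1 R Gr -
     2 * (c_const R Gr / m1 R Gr) * (sin (freq Gr / 2) / freq Gr))) = c_const R Gr.
Proof.
have [S0 d0 f0] := sin_cos_freq Gr; have s0 := s3_gt0.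
have dn : den Gr != 0 by rewrite gt_eqF.
case: Gr S0 d0 f0 dn; rewrite /offset /amp /den /= /m0 /m1 /m2;
  move: (sin _) (cos _) => S C S0 d0 f0 dn; field; rewrite ?dn ?gt_eqF//.
Qed.

End Constants.

(** * The lower bound *)

Section Sampling.
Variable R : realType.
Implicit Types (x y t : R) (Gr : group) (M : nat).
Notation half := (2^-1 : R).

(** Folding the symmetric grid from -M to M onto nonnegative indices produces the weights [wt]. *)
Lemma sym_sum M (F : R -> R) :
  \sum_(k < M.+1) wt R k * (2^-1 * (F k%:R + F (- k%:R))) = \sum_(i < M.*2.+1) F (i%:R - M%:R).
Proof.
elim: M => [|M IH].
  by rewrite !big_ord1 /wt/= subr0 oppr0; field.
rewrite big_ord_recr/= IH doubleS [in RHS]big_ord_recl [in RHS]big_ord_recr/= /wt/=.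
rewrite [X in _ = _ + (X + _)](eq_bigr (fun i : 'I_M.*2.+1 => F (i%:R - M%:R))); last first.
  by move=> i _; congr F; rewrite /bump/= add1n -!natr1; ring.
rewrite sub0r; have -> : (bump 0 M.*2.+1)%:R - M.+1%:R = M.+1%:R :> R.
  by rewrite /bump/= add1n -!natr1 -mul2n natrM; ring.
by field.
Qed.

Let cell_aux (c d x : R) : 0 < d -> 0 <= c -> c + d <= 1 -> - half + c <= x -> x <= - half + (c + d) ->
  [/\ `|- half + c + d / 2 - x| <= d, - half <= x <= half & - half <= - half + c + d / 2 <= half].
Proof.
by move=> d0 c0 cd x1 x2; split; rewrite ?ler_norml; apply/andP; split; lra.
Qed.

Let half_dist x y : - half <= x -> x <= half -> - half <= y -> y <= half -> `|x - y| <= 1.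
Proof. by move=> x1 x2 y1 y2; rewrite ler_norml; apply/andP; split; lra. Qed.

Let Cg_aux (L B i j a l : R) : 0 <= L -> 0 <= B -> 0 <= i -> 0 <= j -> 0 <= a -> 0 <= l ->
  0 <= 4 * L * i + 4 * L * B * j + 2 * a * l * j.
Proof. by move=> *; rewrite !addr_ge0 ?mulr_ge0. Qed.

Lemma quad_ker_bound (k0 k1 k2 : R) u : `|u| <= 1 -> `|quad_ker k0 k1 k2 u| <= `|k0| + `|k1| + `|k2|.
Proof.
move=> u1; rewrite /quad_ker; apply: le_trans (ler_normD _ _) _; apply: lerD.
  apply: le_trans (ler_normD _ _) _; rewrite lerD2l normrM normr_id ler_piMr//.
by rewrite normrM normrX ler_piMr// exprn_ile1.
Qed.

Lemma quad_ker_lipschitz (k0 k1 k2 : R) u v : `|u| <= 1 -> `|v| <= 1 -> `|quad_ker k0 k1 k2 u - quad_ker k0 k1 k2 v| <= (`|k1| + 2 * `|k2|) * `|u - v|.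
Proof.
move=> u1 v1; rewrite /quad_ker.
rewrite (_ : _ - _ = k1 * (`|u| - `|v|) + k2 * ((u + v) * (u - v))); last by ring.
apply: le_trans (ler_normD _ _) _; rewrite !normrM mulrDl; apply: lerD.
  by rewrite ler_wpM2l// ler_dist_dist.
rewrite mulrA [2 * _]mulrC ler_wpM2r// ler_wpM2l//.
by apply: le_trans (ler_normD _ _) _; lra.
Qed.

Section Group.
Variable Gr : group.
Notation A := (c_const R Gr).
Notation k0 := (m0 R Gr).
Notation k1 := (m1 R Gr).
Notation k2 := (m2 R Gr).
Notation g := (@g_fun R Gr).
Notation mk := (quad_ker k0 k1 k2).

Definition g_mass := intR (zext (- half) half g).

Lemma c_const_gt0 : 0 < A. Proof. by case: Gr => /=. Qed.

(** These are the hypotheses of the cosine and sine forms. For [USp] the last one is an equality, so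
    the trace bound has no room to spare there. *)
Lemma m_bounds : [/\ 0 < k1, k2 <= 0, - k2 <= k1, k1 <= 12 * A & k1 / 2 + k2 / 3 <= 2 * A].
Proof. by case: Gr; rewrite /m1 /m2 /=; split; lra. Qed.

Lemma g_cont : continuous g.
Proof.
have -> : g = fun x => amp R Gr * cos (freq R Gr * x) + offset R Gr.
  by apply/funext => x; exact: g_funE.
exact: cos_affine_cont.
Qed.

Lemma g_even x : g (- x) = g x.
Proof. by rewrite !g_funE mulrN cosN. Qed.

Lemma amp_offset_gt0 : 0 < amp R Gr /\ 0 < offset R Gr.
Proof.
have [S0 d0 f0] := sin_cos_freq R Gr; have s0 := s3_gt0 R.
rewrite /amp /offset; split; first by case: Gr d0 => d0; rewrite divr_gt0.
by case: Gr S0 d0 {f0} => S0 d0; rewrite divr_gt0// !mulr_gt0.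
Qed.

Lemma freq_gt0 : 0 < freq R Gr.
Proof. by have s0 := s3_gt0 R; case: Gr; rewrite /= ?divr_gt0. Qed.

Lemma g_mass_gt0 : 0 < g_mass.
Proof.
have [S0 d0 f0] := sin_cos_freq R Gr; have [a0 o0] := amp_offset_gt0.
rewrite /g_mass (_ : g = fun x => amp R Gr * cos (freq R Gr * x) + offset R Gr); last first.
  by apply/funext => x; exact: g_funE.
rewrite intR_cos_affine//; apply: addr_gt0 => //; apply: mulr_gt0; first exact: mulr_gt0.
by apply: divr_gt0 => //; exact: freq_gt0.
Qed.

Lemma g_integral_equation x : - half <= x -> x <= half ->
  A * g x + intR (zext (- half) half (fun t => g t * mk (x - t))) = A.
Proof.
move=> xl xr; have [S0 d0 f0] := sin_cos_freq R Gr.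
have k1n0 : k1 != 0 by have [h _ _ _ _] := m_bounds; rewrite gt_eqF.
rewrite g_funE (_ : g = fun x => amp R Gr * cos (freq R Gr * x) + offset R Gr); last first.
  by apply/funext => t; exact: g_funE.
exact: (integral_equation f0 k1n0 (group_omA R Gr) (group_h1 R Gr) (group_h2 R Gr)).
Qed.

Let Bg := amp R Gr + offset R Gr.
Let Lg := amp R Gr * freq R Gr.
Let Bm := `|k0| + `|k1| + `|k2|.
Let Lm := `|k1| + 2 * `|k2|.

Let Bg0 : 0 <= Bg. Proof. by have [a0 o0] := amp_offset_gt0; rewrite addr_ge0// ltW. Qed.
Let Lg0 : 0 <= Lg. Proof. by have [a0 o0] := amp_offset_gt0; have := freq_gt0; rewrite /Lg; nra. Qed.
Let Bm0 : 0 <= Bm. Proof. by rewrite !addr_ge0. Qed.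
Let Lm0 : 0 <= Lm. Proof. by rewrite addr_ge0// mulr_ge0. Qed.

Lemma g_bound x : `|g x| <= Bg.
Proof.
have [a0 o0] := amp_offset_gt0; rewrite g_funE; apply: le_trans (ler_normD _ _) _.
rewrite normrM (gtr0_norm a0) (gtr0_norm o0) lerD2r ler_piMr ?cos_max// ltW//.
Qed.

Lemma g_lipschitz x y : `|g x - g y| <= Lg * `|x - y|.
Proof.
have [a0 o0] := amp_offset_gt0; have f0 := freq_gt0; rewrite !g_funE opprD addrACA subrr addr0 -mulrBr.
rewrite normrM (gtr0_norm a0) /Lg -mulrA ler_wpM2l ?(ltW a0)//.
apply: le_trans (cos_lipschitz _ _) _.
by rewrite -mulrBr normrM (gtr0_norm f0).
Qed.

Let Lam := Bg * Lm + Lg * Bm.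

Let f_lipschitz x s t : `|x - s| <= 1 -> `|x - t| <= 1 ->
  `|g s * mk (x - s) - g t * mk (x - t)| <= Lam * `|s - t|.
Proof.
move=> xs xt.
rewrite (_ : g s * mk (x - s) - g t * mk (x - t) = g s * (mk (x - s) - mk (x - t)) + (g s - g t) * mk (x - t)); last by ring.
apply: le_trans (ler_normD _ _) _; rewrite !normrM /Lam mulrDl; apply: lerD.
  rewrite -(mulrA Bg); apply: ler_pM => //; first exact: g_bound.
  apply: le_trans (quad_ker_lipschitz _ _ _ xs xt) _.
  by rewrite (_ : x - s - (x - t) = - (s - t)) ?normrN//; ring.
rewrite (mulrAC Lg); apply: ler_pM => //; first exact: g_lipschitz.
exact: quad_ker_bound.
Qed.

(** The error constant of [cos_form_bound] with [C1 = Lam], [C2 = Lg], [B = Bg] and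
    [ig = g_mass]. *)
Let Cg := 4 * Lam / g_mass + 4 * Lam * Bg / g_mass ^+ 2 + 2 * A * Lg / g_mass ^+ 2.

Section Nodes.
Variable M : nat.
Notation N := M.*2.+1.
Let h : R := N%:R^-1.
Let N0 : 0 < N%:R :> R. Proof. by []. Qed.
Let NE : N%:R = 2 * M%:R + 1 :> R. Proof. by rewrite -natr1 -mul2n natrM. Qed.
Let h0 : 0 < h. Proof. by rewrite invr_gt0. Qed.
Let hN : h * N%:R = 1. Proof. by rewrite mulVf// gt_eqF. Qed.

(** Because [N = 2 M + 1] is odd, the points [(i - M) / N] are the midpoints of the [N] equal cells
    of [-1/2, 1/2]. *)
Let cell (i : nat) x : (i < N)%N -> - half + i%:R * h <= x <= - half + i.+1%:R * h ->
  [/\ `|(i%:R - M%:R) / N%:R - x| <= h, - half <= x <= half & - half <= (i%:R - M%:R) / N%:R <= half].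
Proof.
move=> iN; rewrite -[i.+1%:R]natr1 -/h => /andP[x1 x2].
have i0 : 0 <= i%:R :> R by [].
have iN' : i%:R + 1 <= N%:R :> R by rewrite natr1 ler_nat.
have e : (i%:R - M%:R) / N%:R = - half + i%:R * h + h / 2.
  rewrite -/h (_ : M%:R = (N%:R - 1) / 2); last by rewrite NE; field.
  rewrite (_ : - half = - (h * N%:R) / 2); last by rewrite hN; field.
  by field.
have a1 : 0 <= i%:R * h by rewrite mulr_ge0// ltW.
have a2 : (i%:R + 1) * h <= 1.
  by apply: le_trans (ler_wpM2r (ltW h0) iN') _; rewrite mulrC hN.
move: a2 x2; rewrite mulrDl mul1r e => a2 x2; exact: cell_aux.
Qed.

Let right_end : - half + N%:R * h = half. Proof. by rewrite mulrC hN; field. Qed.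

Definition g_sample k := wt R k * g (k%:R / N%:R).

Lemma sum_g_sample : `|\sum_(k < M.+1) g_sample k - N%:R * g_mass| <= Lg.
Proof.
rewrite (eq_bigr (fun k : 'I_M.+1 => wt R k * (2^-1 * (g (k%:R / N%:R) + g (- k%:R / N%:R))))); last first.
  by move=> k _; rewrite /g_sample mulNr g_even; field.
rewrite (sym_sum M (fun x => g (x / N%:R))).
have := @riemann_sum R g (- half) h (Lg * h) (fun i => (i%:R - M%:R) / N%:R) N (ltW h0) g_cont.
rewrite right_end -/g_mass => H.
have {}H : `|h * \sum_(i < N) g ((i%:R - M%:R) / N%:R) - g_mass| <= N%:R * h * (Lg * h).
  apply: H => i x iN xc; have [c1 _ _] := cell iN xc.
  by apply: le_trans (g_lipschitz _ _) _; rewrite ler_wpM2l.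
have -> : \sum_(i < N) g ((i%:R - M%:R) / N%:R) - N%:R * g_mass =
    N%:R * (h * \sum_(i < N) g ((i%:R - M%:R) / N%:R) - g_mass).
  by rewrite mulrBr mulrA (mulrC _ h) hN mul1r.
rewrite normrM (gtr0_norm N0); apply: le_trans (ler_wpM2l (ltW N0) H) _.
by rewrite (mulrC _ h) hN mul1r mulrCA (mulrC _ h) hN mulr1.
Qed.

Lemma sum_norm_g_sample : \sum_(k < M.+1) `|g_sample k| <= N%:R * Bg.
Proof.
rewrite -sum_wt mulr_suml; apply: ler_sum => k _.
rewrite normrM (gtr0_norm (wt_gt0 R k)) ler_wpM2l ?g_bound//.
exact/ltW/wt_gt0.
Qed.

(** Unfolding the weights by evenness turns the sum into [A g(x)] plus a midpoint sum for the
    integral of [g t * mk (x - t)] at x = j / N, to which the integral equation applies. *)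
Lemma cos_ker_g_sample j : (j <= M)%N ->
  `|\sum_(k < M.+1) cos_ker A k0 k1 k2 M j k * g_sample k - A| <= Lam / N%:R.
Proof.
move=> jM; set x : R := j%:R / N%:R.
have x0 : 0 <= x by rewrite divr_ge0.
have jMR : j%:R <= M%:R :> R by rewrite ler_nat.
have xh : x <= half by rewrite ler_pdivrMr// NE; lra.
have xl : - half <= x by lra.
pose f t := g t * mk (x - t).
have cf : continuous f.
  by rewrite /f /quad_ker; apply: contM; [exact: g_cont|cont].
have E : \sum_(k < M.+1) cos_ker A k0 k1 k2 M j k * g_sample k =
    A * g x + h * \sum_(i < N) f ((i%:R - M%:R) / N%:R).
  rewrite -(sym_sum M (fun y => f (y / N%:R))).
  have -> : A * g x = \sum_(k < M.+1) (j == k)%:R * (A / wt R j) * g_sample k.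
    rewrite (bigD1 (Ordinal (jM : (j < M.+1)%N)))//= eqxx mul1r big1 ?addr0.
      by rewrite /g_sample -/x; field; rewrite gt_eqF// wt_gt0.
    move=> k; rewrite -val_eqE /= eq_sym => /negPf ->; by rewrite !mul0r.
  rewrite mulr_sumr -big_split/=; apply: eq_bigr => k _.
  rewrite cos_kerE mulrDl; congr (_ + _).
  rewrite /g_sample /f mulNr g_even opprK.
  set y : R := k%:R / N%:R.
  have -> : k0 + k1 / N%:R * (maxn j k)%:R + k2 / N%:R ^+ 2 * (j%:R ^+ 2 + k%:R ^+ 2) =
     2^-1 * (mk (x - y) + mk (x + y)).
    rewrite /x /y /quad_ker -mulrBl -mulrDl !normrM [`|N%:R^-1|]gtr0_norm//.
    rewrite [`|j%:R + k%:R|]ger0_norm ?addr_ge0//.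
    have [jk|kj] := orP (leq_total j k).
      rewrite (maxn_idPr jk) ler0_norm; last by rewrite subr_le0 ler_nat.
      by field; rewrite gt_eqF.
    rewrite (maxn_idPl kj) ger0_norm; last by rewrite subr_ge0 ler_nat.
    by field; rewrite gt_eqF.
  rewrite -/x -/h; ring.
rewrite E -[in X in _ - X](g_integral_equation xl xh) opprD addrACA subrr add0r.
have := @riemann_sum R f (- half) h (Lam * h) (fun i => (i%:R - M%:R) / N%:R) N (ltW h0) cf.
rewrite right_end => H; apply: le_trans (H _) _.
  move=> i y iN yc; have [c1 /andP[c2 c2'] /andP[c3 c3']] := cell iN yc.
  apply: le_trans (f_lipschitz _ _) _.
  - exact: half_dist.
  - exact: half_dist.
  by rewrite ler_wpM2l// /Lam addr_ge0// mulr_ge0.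
by rewrite (mulrC _ h) hN mul1r.
Qed.

Lemma cos_form_group (a : nat -> R) : 2 * Lg <= N%:R * g_mass ->
  A / g_mass / N%:R * (\sum_(j < M.+1) a j) ^+ 2 <= cos_form (A + Cg / N%:R) k0 k1 k2 M a.
Proof.
move=> NL; have [k10 _ _ k1A _] := m_bounds.
rewrite cos_form_shift /Cg.
have := @cos_form_bound R A k0 k1 k2 c_const_gt0 (ltW k10) k1A M a g_sample Lam Lg Bg g_mass.
apply => //.
- exact: g_mass_gt0.
- by rewrite /Lam addr_ge0// mulr_ge0.
- exact: cos_ker_g_sample.
- exact: sum_norm_g_sample.
- exact: sum_g_sample.
Qed.

Lemma nodes_bound (c : nat -> R) : 2 * Lg <= N%:R * g_mass ->
  (forall t, 0 <= \sum_(n < N) wt R n * c n * cos (n%:R * t)) ->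
  A / g_mass / N%:R * (\sum_(n < N) wt R n * c n) <=
  \sum_(n < N) wt R n * c n * quad_weight (A + Cg / N%:R) k0 k1 k2 N n.
Proof.
move=> NL pos; have [k10 k2le k21 k1A k12A] := m_bounds.
have A0 := c_const_gt0.
have C0 : 0 <= Cg / N%:R.
  have i0 : 0 <= g_mass^-1 by rewrite invr_ge0 ltW// g_mass_gt0.
  have i2 : 0 <= (g_mass ^+ 2)^-1 by rewrite invr_ge0 sqr_ge0.
  have L0 : 0 <= Lam by apply: addr_ge0; apply: mulr_ge0.
  have A0' := ltW A0.
  by rewrite divr_ge0//; exact: Cg_aux.
apply: trig_bound pos => [a|b].
  exact: cos_form_group.
apply: sin_form_ge0 => //; first exact: ltr_pwDl.
by apply: le_trans k12A _; rewrite ler_wpM2l// lerDl.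
Qed.

End Nodes.

Lemma sampled_bound : exists C L : R, forall M (c : nat -> R), L <= M%:R ->
  (forall t, 0 <= \sum_(n < M.*2.+1) wt R n * c n * cos (n%:R * t)) ->
  A / g_mass / M.*2.+1%:R * (\sum_(n < M.*2.+1) wt R n * c n) <=
  \sum_(n < M.*2.+1) wt R n * c n * quad_weight (A + C / M.*2.+1%:R) k0 k1 k2 M.*2.+1 n.
Proof.
exists Cg, (Lg / g_mass) => M c LM pos; apply: nodes_bound => //.
move: LM; rewrite ler_pdivrMr ?g_mass_gt0// -[M.*2.+1%:R]natr1 -mul2n natrM => LM.
have := g_mass_gt0; lra.
Qed.

End Group.
End Sampling.

(** * Fejer's kernel and positivity of the samples *)

Section Fejer.
Variable R : realType.
Implicit Types (t x y u : R) (J n : nat).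

(** The right side is the square modulus of the sum of [exp (i k t)] over [k < J]. *)
Lemma fejer_identity J t : \sum_(n < J) wt R n * (J - n)%:R * cos (n%:R * t) =
  (\sum_(k < J) cos (k%:R * t)) ^+ 2 + (\sum_(k < J) sin (k%:R * t)) ^+ 2.
Proof.
elim: J => [|J IH]; first by rewrite !big_ord0 expr0n/= addr0.
rewrite (eq_bigr (fun n : 'I_J.+1 => wt R n * (J - n)%:R * cos (n%:R * t) + wt R n * cos (n%:R * t))); last first.
  by move=> n _; rewrite subSn -1?ltnS// -natr1; ring.
rewrite big_split/= big_ord_recr/= subnn mulr0 mul0r addr0 IH.
rewrite [in RHS]big_ord_recr [in X in _ = _ + X]big_ord_recr/=.
rewrite big_ord_recl/= /wt/= mul1r mul0r cos0.
rewrite [X in _ + (1 + X) = _](eq_bigr (fun n : 'I_J => 2 * cos (n.+1%:R * t))); last by move=> n _; rewrite /bump/=.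
have E : \sum_(i < J) cos (i.+1%:R * t) =
    \sum_(k < J) (cos (k%:R * t) * cos (J%:R * t) + sin (k%:R * t) * sin (J%:R * t)).
  rewrite (reindex_inj rev_ord_inj)/=; apply: eq_bigr => k _.
  by rewrite -subSn// subSS natrB ?(ltnW (ltn_ord k))// mulrBl cosB; ring.
rewrite -mulr_sumr E big_split/= -!mulr_suml.
by have := cos2Dsin2 (J%:R * t); lra.
Qed.

Lemma fejer_ge0 J t : 0 <= \sum_(n < J) wt R n * (J - n)%:R * cos (n%:R * t).
Proof. by rewrite fejer_identity addr_ge0// sqr_ge0. Qed.

End Fejer.

Section Samples.
Variable R : realType.
Implicit Types (t x y u : R) (J n N : nat) (phi : R -> R).

(** The sum is the integral of [phi] against Fejer's kernel at the angle [2 pi x h + t]; evenness of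
    [phi] splits off [cos (n t)]. *)
Lemma fejer_fourier_ge0 phi (h t : R) J : L1 phi -> (forall x, 0 <= phi x) -> (forall x, phi (- x) = phi x) ->
  0 <= \sum_(n < J) wt R n * (J - n)%:R * (fourier_re phi (n%:R * h) * cos (n%:R * t)).
Proof.
move=> Lp p0 ep.
have L n : L1 (fun x => phi x * cos (2 * pi * x * (n%:R * h) + n%:R * t)).
  apply: L1_bm => //; apply: (@bm_cont _ _ 1); last by move=> x; exact: cos_max.
  cont.
rewrite (eq_bigr (fun n : 'I_J => intR (fun x => (wt R n * (J - n)%:R) * (phi x * cos (2 * pi * x * (n%:R * h) + n%:R * t))))); last first.
  by move=> n _; rewrite intRZ// cosD_even//; ring.
rewrite -(@intR_sum R 'I_J (index_enum 'I_J) (fun (n : 'I_J) x => (wt R n * (J - n)%:R) * (phi x * cos (2 * pi * x * (n%:R * h) + n%:R * t)))); last first.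
  by move=> n; exact: L1Z.
apply: intR_ge0 => x.
rewrite (eq_bigr (fun n : 'I_J => phi x * (wt R n * (J - n)%:R * cos (n%:R * (2 * pi * x * h + t))))); last first.
  move=> n _; rewrite (_ : n%:R * (2 * pi * x * h + t) = 2 * pi * x * (n%:R * h) + n%:R * t); last by ring.
  by ring.
by rewrite -mulr_sumr mulr_ge0// fejer_ge0.
Qed.

(* The Fejer means over [J >= N] terms are nonnegative and tend to the sum. *)
Lemma sample_positive phi (h t : R) N : L1 phi -> (forall x, 0 <= phi x) -> (forall x, phi (- x) = phi x) ->
  (forall n, (N <= n)%N -> fourier_re phi (n%:R * h) = 0) ->
  0 <= \sum_(n < N) wt R n * fourier_re phi (n%:R * h) * cos (n%:R * t).
Proof.
move=> Lp p0 ep supp.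
set c := fun n => fourier_re phi (n%:R * h) * cos (n%:R * t).
pose S1 := \sum_(n < N) wt R n * c n; pose S2 := \sum_(n < N) wt R n * n%:R * c n.
have -> : \sum_(n < N) wt R n * fourier_re phi (n%:R * h) * cos (n%:R * t) = S1.
  by apply: eq_bigr => n _; rewrite mulrA.
have key J : (N <= J)%N -> 0 <= J%:R * S1 - S2.
  move=> NJ; have := @fejer_fourier_ge0 phi h t J Lp p0 ep.
  rewrite (_ : \sum_(n < J) _ = J%:R * S1 - S2)//.
  rewrite -(subnKC NJ) big_split_ord/= [X in _ + X]big1 ?addr0; last first.
    by move=> k _; rewrite supp ?leq_addr// mul0r mulr0.
  rewrite subnKC// /S1 /S2 mulr_sumr -sumrB; apply: eq_bigr => n _.
  by rewrite natrB ?(leq_trans (ltnW (ltn_ord n)))// /c; ring.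
rewrite leNgt; apply/negP => S10.
have N1 : 0 <= `|S2| / - S1 by rewrite divr_ge0// oppr_ge0 ltW.
have := archi_boundP N1; set j := Num.bound _; rewrite ltr_pdivrMr ?oppr_gt0// => jS.
have := key (j + N)%N (leq_addl _ _); rewrite natrD => k0.
have := ler_norm (- S2); rewrite normrN => S2n.
have : N%:R * S1 <= 0 by rewrite mulr_ge0_le0// ltW.
by move: k0 jS; rewrite mulrDl mulrN; lra.
Qed.

End Samples.

(** * From samples to the bound for test functions *)

Section TestFunctions.
Variable R : realType.
Implicit Types (t x y u : R) (J n N M : nat) (phi : R -> R) (Gr : group).

Lemma schwartz_cont phi : schwartz phi -> continuous phi.
Proof. by move=> [d _]; apply: derive_cont => x; exact: (d 0%N x). Qed.

Lemma schwartz_moment phi k : schwartz phi -> L1 (fun x => x ^+ k * phi x).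
Proof.
move=> sp; have cp := schwartz_cont sp; have [_ b] := sp.
have [C1 h1] := b 0%N k; have [C2 h2] := b 0%N k.+2.
apply: (@L1_dom _ _ (fun x => (C1 + C2) * (1 + x ^+ 2)^-1)).
- by apply: continuous_measurable_fun; apply: contM => //; cont.
- move=> x; have q0 : 0 < 1 + x ^+ 2 by rewrite ltr_pwDl// sqr_ge0.
  rewrite ler_pdivlMr// normrM normrX mulrDr mulr1; apply: lerD; first exact: h1.
  rewrite -[x ^+ 2]real_normK ?num_real// mulrAC -exprD addn2; exact: h2.
- exact/L1Z/L1_cauchy.
Qed.

Lemma L1_schwartz phi : schwartz phi -> L1 phi.
Proof. by move=> /(schwartz_moment 0); apply: L1_eq => x; rewrite expr0 mul1r. Qed.

Lemma schwartz_bounded phi : schwartz phi -> exists B, forall x, `|phi x| <= B.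
Proof.
move=> [_ /(_ 0%N 0%N) [C h]]; exists C => x.
by have := h x; rewrite expr0 mul1r.
Qed.

Lemma fourier_re_lipschitz phi : schwartz phi ->
  exists2 L, 0 <= L & forall u v, `|fourier_re phi u - fourier_re phi v| <= L * `|u - v|.
Proof.
move=> sp; have Lp := L1_schwartz sp; have L1p := L1_norm (schwartz_moment 1 sp).
exists (2 * pi * intR (fun x => `|x ^+ 1 * phi x|)).
  by rewrite !mulr_ge0 ?pi_ge0// intR_ge0.
move=> u v; rewrite /fourier_re -intRB; [|exact: L1_cosx|exact: L1_cosx].
apply: le_trans (intR_norm _) _; first by apply: L1B; exact: L1_cosx.
rewrite mulrAC -intRZ//; apply: intR_le.
- by apply: L1_norm; apply: L1B; exact: L1_cosx.
- exact: L1Z.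
- move=> x; rewrite -mulrBr !normrM expr1 (mulrC `|x|) mulrCA ler_wpM2l//.
  apply: le_trans (cos_lipschitz _ _) _.
  by rewrite -mulrBr !normrM (ger0_norm (pi_ge0 R)) ger0_norm// le_eqVlt; apply/orP; left; apply/eqP; ring.
Qed.

Variable phi : R -> R.
Hypotheses (tphi : test_function phi) (sphi : fourier_supp_in phi 1).
Notation f := (fourier_re phi).

Let p0 x : 0 <= phi x. Proof. by case: tphi. Qed.
Let ep x : phi (- x) = phi x. Proof. by case: tphi => _ []. Qed.
Let sp : schwartz phi. Proof. by case: tphi => _ [_ []]. Qed.
Let Lp : L1 phi. Proof. exact: L1_schwartz. Qed.
Let f_out u : 1 < `|u| -> f u = 0. Proof. by case/sphi. Qed.

Lemma test_bandlimited : bandlimited phi.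
Proof.
split => // x; have [B pB] := schwartz_bounded sp.
apply: (fourier_inversion x Lp pB ep (schwartz_cont sp)).
have : L1 (zext (- 1) 1 f) by apply: L1_zext; exact: fourier_re_cont.
apply: L1_eq => u; rewrite /zext -ler_norml; case: leP => // u1.
by rewrite f_out.
Qed.

(** The support condition speaks of u > 1 only. The end point is needed, as the sample with n = N
    falls on u = 1, and it follows by continuity. *)
Lemma hat_out u : 1 <= u -> f u = 0.
Proof.
rewrite le_eqVlt => /orP[/eqP <-|u1]; last by rewrite f_out// (lt_le_trans u1)// ler_norm.
have [L L0 fL] := fourier_re_lipschitz sp.
apply/eqP; rewrite -normr_le0; apply/ler_addgt0Pr => e e0; rewrite add0r.
have L1 : 0 < L + 1 by rewrite ltr_wpDl.
have d0 : 0 < e / (L + 1) by rewrite divr_gt0.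
have := fL 1 (1 + e / (L + 1)); rewrite (@f_out (1 + _)) ?subr0; last first.
  by rewrite ger0_norm ?addr_ge0 ?(ltW d0)// ltrDl.
move=> /le_trans; apply; rewrite opprD addrA subrr add0r normrN (gtr0_norm d0).
by rewrite mulrA ler_pdivrMr//; nra.
Qed.

Lemma sum_wt_double (F : nat -> R) N : (0 < N)%N ->
  \sum_(n < N) wt R n * F n = 2 * (\sum_(n < N) F n) - F 0%N.
Proof.
case: N => // N _; rewrite !big_ord_recl /wt/= mul1r mulrDr mulr_sumr; ring.
Qed.

Section Riemann.
Variables (k0 k1 k2 : R).
Notation mk := (quad_ker k0 k1 k2).

Lemma quad_hat_lipschitz : exists2 L, 0 <= L &
  forall u v, `|u| <= 1 -> `|v| <= 1 -> `|f u * mk u - f v * mk v| <= L * `|u - v|.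
Proof.
have [L L0 fL] := fourier_re_lipschitz sp.
pose B := intR (fun x => `|phi x|).
have B0 : 0 <= B by exact: intR_ge0.
exists (B * (`|k1| + 2 * `|k2|) + L * (`|k0| + `|k1| + `|k2|)).
  by rewrite addr_ge0 ?mulr_ge0 ?addr_ge0 ?mulr_ge0.
move=> u v u1 v1.
rewrite (_ : _ - _ = f u * (mk u - mk v) + (f u - f v) * mk v); last by ring.
apply: le_trans (ler_normD _ _) _; rewrite !normrM mulrDl; apply: lerD.
  by rewrite -mulrA; apply: ler_pM => //; [exact: fourier_re_le|exact: quad_ker_lipschitz].
by rewrite mulrAC; apply: ler_pM => //; exact: quad_ker_bound.
Qed.

Lemma intR_quad_hat : intR (fun u => mk u * f u) = 2 * intR (zext 0 1 (fun u => f u * mk u)).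
Proof.
have cm : continuous mk by rewrite /quad_ker; cont.
rewrite intR_even; last 2 first.
- exact: (L1_bandlimited_hat test_bandlimited).
- by move=> u; rewrite fourier_re_even /quad_ker normrN sqrrN.
congr (2 * _); apply: intR_eq => u; rewrite /zext; case: leP => //= u0.
case: leP => u1; first by rewrite mulrC.
by rewrite hat_out ?mulr0// ltW.
Qed.

(** By evenness the integral is twice that over [0, 1]. The left sum doubles every sample, so the
    sample at 0, whose weight is 1, must be removed once; this adds the second term to the error
    constant. *)
Lemma sample_cvg : exists E, forall N, (0 < N)%N ->
  `|N%:R^-1 * (\sum_(n < N) wt R n * (f (n%:R / N%:R) * mk (n%:R / N%:R))) -
    intR (fun u => mk u * f u)| <= E / N%:R.
Proof.
have [L L0 fL] := quad_hat_lipschitz.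
have cF : continuous (fun u => f u * mk u).
  by apply: contM; [exact: fourier_re_cont|rewrite /quad_ker; cont].
exists (2 * L + `|f 0 * mk 0|) => N N0.
have n0 : 0 < N%:R :> R by rewrite ltr0n.
set h : R := N%:R^-1; have h0 : 0 < h by rewrite invr_gt0.
have hN : N%:R * h = 1 by rewrite mulfV// gt_eqF.
have := @riemann_sum R (fun u => f u * mk u) 0 h (L * h) (fun i => i%:R * h) N (ltW h0) cF.
rewrite add0r hN mul1r => rs.
have {}rs : `|h * (\sum_(i < N) f (i%:R * h) * mk (i%:R * h)) - intR (zext 0 1 (fun u => f u * mk u))| <= L * h.
  apply: rs => i x iN; rewrite !add0r -[i.+1%:R]natr1 mulrDl mul1r => /andP[x1 x2].
  have i0 : 0 <= i%:R * h by rewrite mulr_ge0// ltW.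
  have i1 : i%:R * h + h <= 1.
    by rewrite -[X in _ + X]mul1r -mulrDl natr1 -[leRHS]hN ler_wpM2r ?ler_nat// ltW.
  apply: le_trans (fL _ _ _ _) _; rewrite ?ler_norml; [apply/andP; split; lra|apply/andP; split; lra|].
  by rewrite ler_wpM2l// ler_norml; apply/andP; split; lra.
rewrite intR_quad_hat.
have -> : \sum_(n < N) wt R n * (f (n%:R / N%:R) * mk (n%:R / N%:R)) =
    2 * (\sum_(i < N) f (i%:R * h) * mk (i%:R * h)) - f 0 * mk 0.
  by rewrite (sum_wt_double (fun n => f (n%:R / N%:R) * mk (n%:R / N%:R)) N0) mul0r.
rewrite (_ : _ - _ = 2 * (h * (\sum_(i < N) f (i%:R * h) * mk (i%:R * h)) - intR (zext 0 1 (fun u => f u * mk u))) - h * (f 0 * mk 0)); last by ring.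
apply: le_trans (ler_normB _ _) _; rewrite [leRHS]mulrDl; apply: lerD.
  by rewrite normrM ger0_norm// -mulrA ler_wpM2l.
by rewrite normrM (gtr0_norm h0) mulrC.
Qed.

End Riemann.

Lemma two_level_ge Gr : c_const R Gr / g_mass R Gr * phi 0 <= two_level Gr phi (@psi_sinc2 R).
Proof.
rewrite (two_level_fourier test_bandlimited) -(bandlimited0 test_bandlimited).
have [C [L bound]] := sampled_bound R Gr.
set A := c_const R Gr; set v := A / g_mass R Gr.
have v0 : 0 < v by rewrite divr_gt0// ?c_const_gt0// g_mass_gt0.
(* The kernel [quad_ker 1 0 0] is constantly 1, so the first instance approximates [phi 0] and the
   second the pairing with [m_ker]. *)
have [E1 s1] := sample_cvg 1 0 0; have [E2 s2] := sample_cvg (m0 R Gr) (m1 R Gr) (m2 R Gr).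
have one u : quad_ker 1 0 0 u = 1 by rewrite /quad_ker !mul0r !addr0.
apply/ler_addgt0Pr => e e0.
(* The three errors of order 1/N: in [phi 0], in the Dirac coefficient, and in the pairing. [M] is
   then taken beyond both the threshold [L] and [|E| / e]. *)
pose E := v * E1 + C * f 0 + E2.
have LE0 : 0 <= `|L| + `|E| / e by rewrite addr_ge0// divr_ge0// ltW.
have := archi_boundP LE0; set M := Num.bound _ => LM.
have Ee0 : 0 <= `|E| / e by rewrite divr_ge0// ltW.
pose c n := f (n%:R / M.*2.+1%:R).
have n0 : 0 < M.*2.+1%:R :> R by [].
have EN : E / M.*2.+1%:R <= e.
  rewrite ler_pdivrMr//; apply: le_trans (ler_norm _) _; rewrite mulrC -ler_pdivrMr//.
  rewrite -[M.*2.+1%:R]natr1 -mul2n natrM; have := normr_ge0 L; lra.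
have /bound : L <= M%:R by have := ler_norm L; lra.
move=> /(_ c); rewrite -/A -/v.
have pos t : 0 <= \sum_(n < M.*2.+1) wt R n * c n * cos (n%:R * t).
  apply: sample_positive => // n Nn; apply: hat_out.
  by rewrite ler_pdivlMr// mul1r ler_nat.
move=> /(_ pos).
have := s1 M.*2.+1 erefl; have := s2 M.*2.+1 erefl.
set N := M.*2.+1 in n0 EN c pos *.
rewrite (_ : intR (fun u => quad_ker 1 0 0 u * f u) = intR f); last first.
  by apply: intR_eq => u; rewrite one mul1r.
rewrite (_ : \sum_(n < N) wt R n * (f (n%:R / N%:R) * quad_ker 1 0 0 (n%:R / N%:R)) =
  \sum_(n < N) wt R n * c n); last by apply: eq_bigr => n _; rewrite one mulr1.
have -> : \sum_(n < N) wt R n * c n * quad_weight (A + C / N%:R) (m0 R Gr) (m1 R Gr) (m2 R Gr) N n =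
    (A + C / N%:R) * f 0 + N%:R^-1 * (\sum_(n < N) wt R n *
      (c n * quad_ker (m0 R Gr) (m1 R Gr) (m2 R Gr) (n%:R / N%:R))).
  rewrite mulr_sumr (_ : (A + C / N%:R) * f 0 = \sum_(n < N) (n == 0%N :> nat)%:R * (A + C / N%:R) * c n); last first.
    by rewrite /N big_ord_recl/= mul1r big1 ?addr0 /c ?mul0r// => i _; rewrite !mul0r.
  rewrite -big_split/=; apply: eq_bigr => n _; rewrite /quad_weight /wt.
  by case: eqP => [->|_]; rewrite ?mul1r ?mul0r; ring.
rewrite -/(m_ker Gr) (_ : (fun u => quad_ker (m0 R Gr) (m1 R Gr) (m2 R Gr) u * f u) = fun u => m_ker Gr u * f u)//.
move: (\sum_(n < N) wt R n * c n) (\sum_(n < N) wt R n * (c n * _)) => S T.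
move: (intR f) (intR _) => I1 I2; rewrite !ler_norml => /andP[_ h2] /andP[h1 _].
move: EN; rewrite /E mulrC -/N; move: (N%:R^-1) (f 0) h1 h2 => h f0 h1 h2 h3 h4.
have := ler_wpM2l (ltW v0) h1.
lra.
Qed.

Lemma level_ratio_ge Gr : c_const R Gr / g_mass R Gr <= level_ratio Gr phi (@psi_sinc2 R).
Proof.
have [_ [_ [_ [_ p00]]]] := tphi.
by rewrite /level_ratio psi0 mulr1 [leRHS]mulrC ler_pdivlMr// two_level_ge.
Qed.

End TestFunctions.

(** * Smooth test functions *)

Section Smooth.
Variable R : realType.
Implicit Types (x y t c d : R) (f g h q : R -> R) (n k : nat).

(** Each level carries an explicit derivative, so closure under products and composition is a plain
    induction without formulas for higher derivatives. *)
Fixpoint smooth n f : Prop :=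
  if n is n'.+1 then exists f', (forall x, is_derive x (1 : R) f (f' x)) /\ smooth n' f'
  else continuous f.

Lemma is_derive_cont f f' : (forall x, is_derive x (1 : R) f (f' x)) -> continuous f.
Proof. by move=> d; apply: derive_cont => x; exact: ex_derive. Qed.

Lemma smooth_cont n f : smooth n f -> continuous f.
Proof. by case: n => //= n [f' [d _]]; exact: is_derive_cont d. Qed.

Lemma smoothS n f : smooth n.+1 f -> smooth n f.
Proof.
elim: n f => [|n IH] f; first exact: smooth_cont.
by move=> [f' [d s]]; exists f'; split => //; exact: IH.
Qed.

Lemma smooth_cst n (c : R) : smooth n (fun=> c).
Proof.
elim: n c => [|n IH] c /=; first exact: cont_cst.
by exists (fun=> 0); split => // x; exact: is_derive_cst.
Qed.

Lemma smoothD n f g : smooth n f -> smooth n g -> smooth n (fun x => f x + g x).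
Proof.
elim: n f g => [|n IH] f g /=; first exact: contD.
move=> [f' [df sf]] [g' [dg sg]]; exists (fun x => f' x + g' x); split; last exact: IH.
by move=> x; exact: is_deriveD.
Qed.

Lemma smoothM n f g : smooth n f -> smooth n g -> smooth n (fun x => f x * g x).
Proof.
elim: n f g => [|n IH] f g; first exact: contM.
move=> sf sg; have [f' [df sf']] := sf; have [g' [dg sg']] := sg.
exists (fun x => f' x * g x + f x * g' x); split.
  by move=> x; apply: is_derive_eq; rewrite addrC /GRing.scale/= mulrC.
by apply: smoothD; apply: IH => //; exact: smoothS.
Qed.

Lemma smooth_comp n f q : smooth n f -> smooth n q -> smooth n (fun x => f (q x)).
Proof.
elim: n f => [|n IH] f.
  by move=> cf cq; exact: cont_comp.
move=> [f' [df sf']] sq; have [q' [dq sq']] := sq.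
exists (fun x => f' (q x) * q' x); split; last by apply: smoothM => //; apply: IH => //; exact: smoothS.
by move=> x; exact: (is_derive1_comp (df (q x)) (dq x)).
Qed.

Lemma smooth_id n : smooth n (fun x : R => x).
Proof.
case: n => [|n] /=; first exact: cont_id.
by exists (fun=> 1); split; [move=> x; exact: is_derive_id|exact: smooth_cst].
Qed.

Lemma smooth_cos n : smooth n (@cos R) /\ smooth n (@sin R).
Proof.
elim: n => [|n [IHc IHs]] /=; first by split; [exact: continuous_cos|exact: continuous_sin].
split; last by exists (@cos R); split => // x; exact: is_derive_sin.
exists (fun x => -1 * sin x); split; last exact: smoothM (smooth_cst _ _) IHs.
by move=> x; rewrite mulN1r; exact: is_derive_cos.
Qed.

(** A quadratic remainder is all that is known in two places: at the flat point of the bump and when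
    differentiating under the integral sign. *)
Lemma quadratic_is_derive f x (l C : R) :
  (forall h : R, `|f (x + h) - f x - l * h| <= C * h ^+ 2) -> is_derive x (1 : R) f l.
Proof.
move=> fq.
suff H : (fun h : R => h^-1 *: (f (h *: 1 + x) - f x)) @ 0^' --> l.
  by split; [apply/cvg_ex; exists l|exact/cvg_lim].
apply/cvgrPdist_le => e e0; near=> h.
have h0 : h != 0 by near: h; exact: nbhs_dnbhs_neq.
have C0 : 0 < `|C| + 1 by rewrite ltr_wpDl.
have hC : `|h| <= e / (`|C| + 1).
  near: h; apply: dnbhs0_le; exact: divr_gt0.
rewrite /GRing.scale/= mulr1 [h + x]addrC.
rewrite (_ : _ - _ = - (h^-1 * (f (x + h) - f x - l * h))); last by field.
rewrite normrN normrM normfV ler_pdivrMl ?normr_gt0//.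
apply: le_trans (fq h) _; rewrite -[h ^+ 2]real_normK ?num_real// expr2 mulrA mulrC.
rewrite ler_wpM2l//; move: hC; rewrite ler_pdivlMr// => hC.
by apply: le_trans hC; rewrite mulrC ler_wpM2l//; have := ler_norm C; lra.
Unshelve. all: by end_near. Qed.

Lemma is_derive_mul f g (x df dg : R) : is_derive x (1 : R) f df -> is_derive x (1 : R) g dg ->
  is_derive x (1 : R) (fun y => f y * g y) (df * g x + f x * dg).
Proof.
by move=> hf hg; apply: is_derive_eq (is_deriveM hf hg) _; rewrite /GRing.scale/= addrC mulrC.
Qed.

Lemma is_derive_inv_pow t k : t != 0 ->
  is_derive t (1 : R) (fun y => y^-1 ^+ k) (- k%:R * t^-1 ^+ k.+1).
Proof.
move=> t0; elim: k => [|k IH].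
  rewrite oppr0 mul0r (_ : (fun y : R => _) = fun=> 1); first exact: is_derive_cst.
  by apply/funext => y; rewrite expr0.
have dV : is_derive t (1 : R) (fun t => t^-1) (- t^-1 ^+ 2).
  by apply: is_derive_eq (@is_deriveV R id t 1 1 t0 (is_derive_id _ _)) _; rewrite /GRing.scale/= mulr1 exprVn.
rewrite (_ : (fun y : R => _) = fun y => y^-1 * y^-1 ^+ k); last by apply/funext => y; rewrite exprS.
by apply: is_derive_eq (is_derive_mul dV IH) _; rewrite -natr1 !exprS expr0; ring.
Qed.

Section Flat.
Variable d : R.
Hypothesis d0 : 0 < d.

(** The powers of [t^-1] make the family closed under differentiation: the derivative of [flat k] is
    a combination of [flat k.+1] and [flat k.+2]. *)
Definition flat k t : R := if 0 < t then t^-1 ^+ k * expR (- (d * t^-1)) else 0.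

(** With [m = k + 2], [expR s >= (s / m) ^ m] at [s = d / t] beats [t ^ (- k)] by exactly [t ^ 2],
    the remainder that [quadratic_is_derive] needs at 0. *)
Lemma flat_le k : exists2 C, 0 <= C & forall t, `|flat k t| <= C * t ^+ 2.
Proof.
pose C := ((k.+2)%:R / d) ^+ k.+2.
exists C => [|t]; first by rewrite exprn_ge0// divr_ge0// ltW.
rewrite /flat; case: ifP => t0; last by rewrite normr0 mulr_ge0 ?sqr_ge0// exprn_ge0// divr_ge0// ltW.
have i0 : 0 < t^-1 by rewrite invr_gt0.
rewrite ger0_norm ?mulr_ge0 ?exprn_ge0 ?expR_ge0 ?(ltW i0)//.
have e1 : expR (- (d * t^-1)) <= (k.+2%:R / d * t) ^+ k.+2.
  have H : (d * t^-1 / k.+2%:R) ^+ k.+2 <= expR (d * t^-1).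
    rewrite -[in leRHS](@divfK _ k.+2%:R (_ : k.+2%:R != 0) (d * t^-1)) ?pnatr_eq0// [in leRHS]mulrC expRM_natl.
    have q0 : 0 <= d * t^-1 / k.+2%:R by rewrite divr_ge0// mulr_ge0 ?(ltW d0) ?(ltW i0).
    rewrite lerXn2r ?nnegrE ?expR_ge0//.
    by apply: le_trans (expR_ge1Dx _); rewrite lerDr.
  rewrite expRN -[leRHS]invrK lef_pV2 ?posrE ?expR_gt0 ?invr_gt0 ?exprn_gt0 ?mulr_gt0 ?invr_gt0//.
  apply: le_trans H; rewrite -exprVn !invfM invrK le_eqVlt; apply/orP; left; apply/eqP; congr (_ ^+ _); ring.
apply: le_trans (ler_wpM2l _ e1) _; first by rewrite exprn_ge0// ltW.
rewrite exprMn -/C mulrCA le_eqVlt; apply/orP; left; apply/eqP; congr (_ * _).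
by rewrite -addn2 exprD mulrA -exprMn mulVf ?gt_eqF// expr1n mul1r.
Qed.

Lemma is_derive_flat k t : is_derive t (1 : R) (flat k) (d * flat k.+2 t - k%:R * flat k.+1 t).
Proof.
have [t0|t0|<-] := ltgtP 0 t.
- have tn0 : t != 0 by rewrite gt_eqF.
  have dE : is_derive t (1 : R) (fun y => expR (- (d * y^-1))) (expR (- (d * t^-1)) * (d * t^-1 ^+ 2)).
    have e (y : R) : - (d * y^-1) = - d * y^-1 ^+ 1 by rewrite expr1 mulNr.
    rewrite (_ : (fun y : R => _) = fun y => expR (- d * y^-1 ^+ 1)); last by apply/funext => y; rewrite e.
    rewrite e; have dL := is_derive_mul (is_derive_cst (- d) t (1 : R)) (is_derive_inv_pow 1 tn0).
    apply: is_derive_eq (@is_derive1_comp _ expR (fun y => - d * y^-1 ^+ 1) _ _ _ (is_derive_expR _) dL) _.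
    by rewrite /cst; ring.
  apply: (@near_eq_is_derive R R^o R^o (fun t => t^-1 ^+ k * expR (- (d * t^-1))) _ t 1).
  + by near=> y; rewrite /flat ifT//; near: y; exact: lt_nbhsr.
  + apply: is_derive_eq (is_derive_mul (is_derive_inv_pow k tn0) dE) _.
    by rewrite /flat t0 !exprS; ring.
- apply: (@near_eq_is_derive R R^o R^o (fun=> 0) _ t 1).
  + by near=> y; rewrite /flat ifF//; apply/negbTE; rewrite -leNgt; near: y; exact: lt_le_nbhsl.
  + apply: is_derive_eq (is_derive_cst 0 t (1 : R)) _.
    by rewrite /flat !ltNge (ltW t0)/= !mulr0 subr0.
- have [C C0 fC] := flat_le k.
  have z j : flat j 0 = 0 by rewrite /flat ltxx.
  rewrite !z !mulr0 subr0; apply: (@quadratic_is_derive _ _ _ C) => h.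
  by rewrite add0r mul0r subr0 z subr0.
Unshelve. all: by end_near. Qed.

Lemma smooth_flat n k : smooth n (flat k).
Proof.
elim: n k => [|n IH] k; first by apply: is_derive_cont => t; exact: is_derive_flat.
exists (fun t => d * flat k.+2 t + - k%:R * flat k.+1 t); split.
  by move=> t; rewrite mulNr; exact: is_derive_flat.
by apply: smoothD; apply: smoothM => //; exact: smooth_cst.
Qed.

End Flat.
End Smooth.

(** * Oscillatory integrals of smooth functions are Schwartz *)

Section Oscillatory.
Variable R : realType.
Implicit Types (x y t s a c u : R) (f g h q : R -> R) (n k : nat).

Lemma sin_lipschitz x y : `|sin x - sin y| <= `|x - y|.
Proof.
rewrite -!cosBpihalf; apply: le_trans (cos_lipschitz _ _) _.
by rewrite opprB addrA subrK.
Qed.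

Lemma cos_taylor a s : `|cos (a + s) - cos a + s * sin a| <= s ^+ 2.
Proof.
have cs : continuous (fun t : R => - sin t) by cont.
have d t : is_derive t 1 (@cos R) (- sin t) by exact: is_derive_cos.
have [s0|/ltW s0] := leP 0 s.
  have as0 : a <= a + s by rewrite lerDl.
  have := @zext_sample _ (fun t => - sin t) a (a + s) a s as0 cs.
  rewrite (FTC_zext as0 cs d) (addrC a s) addrK => H.
  rewrite -normrN expr2 (_ : - (cos (s + a) - cos a + s * sin a) = s * - sin a - (cos (s + a) - cos a)); last by ring.
  apply: H => x /andP[ax xs]; rewrite -opprD normrN.
  apply: le_trans (sin_lipschitz _ _) _; rewrite distrC ger0_norm ?subr_ge0//; lra.
have as0 : a + s <= a by rewrite gerDl.
have := @zext_sample _ (fun t => - sin t) (a + s) a a (- s) as0 cs.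
rewrite (FTC_zext as0 cs d) (_ : a - (a + s) = - s); last by ring.
rewrite (_ : - s * - sin a - (cos a - cos (a + s)) = cos (a + s) - cos a + s * sin a); last by ring.
rewrite mulrNN -expr2.
apply=> x /andP[ax xs]; rewrite -opprD normrN.
apply: le_trans (sin_lipschitz _ _) _; rewrite ger0_norm ?subr_ge0//; lra.
Qed.

Definition supported h := forall u, 1 < `|u| -> h u = 0.

(** The strict inequality makes the complement open, so [h] vanishes near each such point. *)
Lemma supported_derive h h' : supported h -> (forall x, is_derive x (1 : R) h (h' x)) -> supported h'.
Proof.
move=> sh dh u u1.
have d0 : is_derive u (1 : R) h 0.
  apply: (@near_eq_is_derive R R^o R^o (fun=> 0) _ u 1).
  near=> y; rewrite sh//; near: y.
  by apply: (cvgr_gt `|u|) => //; exact: norm_continuous.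
by have /@derive_val <- := dh u; have /@derive_val := d0.
Unshelve. all: by end_near. Qed.

Lemma L1_supported h : continuous h -> supported h -> L1 h.
Proof.
move=> ch sh; have : L1 (zext (- 1) 1 h) by exact: L1_zext.
apply: L1_eq => u; rewrite /zext -ler_norml; case: leP => // u1.
by rewrite sh.
Qed.

(* With the phase [c], both integration by parts and differentiation in [x] add [pi / 2]. *)
Definition phase h c x := intR (fun u => h u * cos (2 * pi * u * x + c)).

Lemma L1_phase h c x : continuous h -> supported h -> L1 (fun u => h u * cos (2 * pi * u * x + c)).
Proof.
move=> ch sh; apply: L1_supported; first by apply: contM => //; cont.
by move=> u /sh ->; rewrite mul0r.
Qed.

Lemma phase_le h c x : continuous h -> supported h -> `|phase h c x| <= intR (fun u => `|h u|).
Proof.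
move=> ch sh; apply: le_trans (intR_norm (L1_phase c x ch sh)) _; apply: intR_le.
- exact/L1_norm/L1_phase.
- exact/L1_norm/L1_supported.
- by move=> u; rewrite normrM ler_piMr// cos_max.
Qed.

Lemma phase_by_parts h h' c x : supported h -> (forall x, is_derive x (1 : R) h (h' x)) -> continuous h' ->
  2 * pi * x * phase h c x = phase h' (c + pi / 2) x.
Proof.
move=> sh dh ch'; have ch := is_derive_cont dh; have sh' := supported_derive sh dh.
apply/eqP; rewrite -subr_eq0; apply/eqP.
rewrite /phase -intRZ; last exact: L1_phase.
rewrite -intRB; [|exact/L1Z/L1_phase|exact: L1_phase].
pose H u := h u * sin (2 * pi * x * u + c).
pose H' u := h' u * sin (2 * pi * x * u + c) + h u * (2 * pi * x * cos (2 * pi * x * u + c)).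
have dH u : is_derive u (1 : R) H (H' u).
  have dl : is_derive u (1 : R) (fun u => 2 * pi * x * u + c) (2 * pi * x).
    by apply: is_derive_eq; rewrite /GRing.scale/= addr0 mulr1.
  have dS := @is_derive1_comp _ sin (fun u => 2 * pi * x * u + c) _ _ _ (is_derive_sin _) dl.
  by apply: is_derive_eq (is_derive_mul (dh u) dS) _; rewrite /H' [cos _ * _]mulrC.
have cH : continuous H' by apply: contD; apply: contM => //; cont.
(* Integrating over [-2, 2], strictly beyond the support, makes the boundary terms vanish. *)
have n2 : - 2 <= 2 :> R by lra.
rewrite -[RHS](_ : intR (zext (- 2) 2 H') = 0); last first.
  by rewrite (FTC_zext n2 cH dH) /H !sh ?mul0r ?subrr// ?normrN ger0_norm//; lra.
apply: intR_eq => u; rewrite /zext -ler_norml /H'; case: leP => [_|u2].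
  by rewrite addrA cosDpihalf (_ : 2 * pi * u * x = 2 * pi * x * u); ring.
by rewrite sh ?sh' ?mul0r ?mulr0 ?subrr//; lra.
Qed.

Lemma phase_decay n h c : smooth n h -> supported h ->
  exists C, forall x, `|x| ^+ n * `|phase h c x| <= C.
Proof.
elim: n h c => [|n IH] h c.
  by move=> ch sh; exists (intR (fun u => `|h u|)) => x; rewrite mul1r phase_le.
move=> [h' [dh s]] sh; have [C hC] := IH _ (c + pi / 2) s (supported_derive sh dh).
exists C => x; apply: le_trans (hC x).
rewrite -(phase_by_parts _ _ sh dh (smooth_cont s)) exprSr -mulrA ler_wpM2l ?exprn_ge0//.
rewrite !normrM -mulrA ler_peMl ?mulr_ge0// ger0_norm// ger0_norm ?pi_ge0//.
by have := pi_ge2 R; lra.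
Qed.

(** The Taylor bound for cosine integrates to a remainder quadratic in the increment; the phase
    shift by [pi / 2] turns minus sine into cosine. *)
Lemma is_derive_phase h c x : continuous h -> supported h ->
  is_derive x (1 : R) (phase h c) (phase (fun u => 2 * pi * u * h u) (c + pi / 2) x).
Proof.
move=> ch sh.
have ch1 : continuous (fun u => 2 * pi * u * h u) by apply: contM => //; cont.
have sh1 : supported (fun u => 2 * pi * u * h u) by move=> u /sh ->; rewrite mulr0.
have ch2 : continuous (fun u => `|h u| * (2 * pi * u) ^+ 2).
  by apply: contM; [exact: cont_norm|cont].
have sh2 : supported (fun u => `|h u| * (2 * pi * u) ^+ 2) by move=> u /sh ->; rewrite normr0 mul0r.
apply: (@quadratic_is_derive _ _ _ _ (intR (fun u => `|h u| * (2 * pi * u) ^+ 2))) => y.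
have la := L1_phase c (x + y) ch sh; have lb := L1_phase c x ch sh.
have lc := L1_phase (c + pi / 2) x ch1 sh1; have lcy := L1Z y lc.
have lab := L1B la lb; have l2 := L1_supported ch2 sh2.
rewrite mulrC /phase -(intRZ y lc) -(intRB la lb) -(intRB lab lcy).
apply: le_trans (intR_norm (L1B lab lcy)) _.
rewrite [leRHS]mulrC -(intRZ _ l2); apply: intR_le; [exact/L1_norm/L1B|exact: L1Z|].
move=> u; rewrite addrA cosDpihalf.
rewrite (_ : _ - _ - _ = h u * (cos (2 * pi * u * x + c + 2 * pi * u * y) - cos (2 * pi * u * x + c) +
    2 * pi * u * y * sin (2 * pi * u * x + c))); last first.
  by rewrite (_ : 2 * pi * u * (x + y) + c = 2 * pi * u * x + c + 2 * pi * u * y); ring.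
rewrite normrM mulrCA -exprMn ler_wpM2l//.
by rewrite [y * _]mulrC; exact: cos_taylor.
Qed.

(* Products are included so that the class contains squares and is closed under differentiation. *)
Inductive band : (R -> R) -> Prop :=
| BandPhase h c : (forall n, smooth n h) -> supported h -> band (phase h c)
| BandD f g : band f -> band g -> band (fun x => f x + g x)
| BandM f g : band f -> band g -> band (fun x => f x * g x).

Lemma band_derive f : band f -> exists f', (forall x, is_derive x (1 : R) f (f' x)) /\ band f'.
Proof.
elim=> {f} [h c sh sph|f g bf [f' [df bf']] bg [g' [dg bg']]|f g bf [f' [df bf']] bg [g' [dg bg']]].
- exists (phase (fun u => 2 * pi * u * h u) (c + pi / 2)); split.
    by move=> x; apply: is_derive_phase => //; exact: smooth_cont (sh 0%N).
  apply: BandPhase; last by move=> u /sph ->; rewrite mulr0.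
  by move=> n; apply: smoothM => //; apply: smoothM (smooth_cst _ _) (smooth_id _ _).
- exists (fun x => f' x + g' x); split; last exact: BandD.
  by move=> x; exact: is_deriveD.
- exists (fun x => f' x * g x + f x * g' x); split; first by move=> x; exact: is_derive_mul.
  by apply: BandD; exact: BandM.
Qed.

(** In a product one factor takes all the decay, the other only its boundedness (k = 0). *)
Lemma band_decay f k : band f -> exists C, forall x, `|x| ^+ k * `|f x| <= C.
Proof.
move=> bf; elim: bf k => {f} [h c sh sph|f g _ IHf _ IHg|f g _ IHf _ IHg] k.
- exact: phase_decay.
- have [C1 h1] := IHf k; have [C2 h2] := IHg k; exists (C1 + C2) => x.
  apply: le_trans (lerD (h1 x) (h2 x)); rewrite -mulrDr ler_wpM2l ?exprn_ge0//.
  exact: ler_normD.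
- have [C1 h1] := IHf k; have [C2 h2] := IHg 0%N; exists (C1 * C2) => x.
  rewrite normrM mulrA; apply: ler_pM => //.
  by have := h2 x; rewrite mul1r.
Qed.

Lemma band_schwartz f : band f -> schwartz f.
Proof.
move=> bf; have bn n : band (derive1n n f).
  elim: n => // n /band_derive[f' [df bf']]; rewrite derive1nS.
  suff -> : derive1 (derive1n n f) = f' by [].
  by apply/funext => x; rewrite derive1E; have := df x; case.
split=> [n x|n k]; last exact: band_decay.
by have [f' [df _]] := band_derive (bn n); have := df x; case.
Qed.

End Oscillatory.

(** * Attainment and approximation *)

Section Squares.
Variable R : realType.
Implicit Types (x y t s u : R) (G : R -> R) (n : nat) (Gr : group).
Notation half := (2^-1 : R).
Notation trunc := (zext (- half) half).
Notation con G := (convol (trunc G) (trunc G)).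
Notation sq G := (fun x => fourier_re (trunc G) x ^+ 2).

Lemma bandlimited_sq G : continuous G -> (forall x, G (- x) = G x) -> bandlimited (sq G).
Proof.
move=> cG eG; split.
- exact: L1_fourier_sq.
- by move=> x; rewrite fourier_re_even.
- by move=> u u1; rewrite fourier_fourier_sq// convol_out.
- move=> x; rewrite -fourier_convol//; apply: intR_eq => u.
  by rewrite fourier_fourier_sq.
Qed.

Lemma fourier_re0 G : fourier_re G 0 = intR G.
Proof. by apply: intR_eq => x; rewrite mulr0 cos0 mulr1. Qed.

Lemma two_level_sq Gr G : continuous G -> (forall x, G (- x) = G x) ->
  two_level Gr (sq G) (@psi_sinc2 R) =
  c_const R Gr * con G 0 + intR (fun u => m_ker Gr u * con G u).
Proof.
move=> cG eG; rewrite (two_level_fourier (bandlimited_sq cG eG)) fourier_fourier_sq//.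
by congr (_ + _); apply: intR_eq => u; rewrite fourier_fourier_sq.
Qed.

Lemma level_ratio_sq Gr G : continuous G -> (forall x, G (- x) = G x) ->
  level_ratio Gr (sq G) (@psi_sinc2 R) =
  (intR (trunc G) ^+ 2)^-1 * (c_const R Gr * con G 0 + intR (fun u => m_ker Gr u * con G u)).
Proof. by move=> cG eG; rewrite /level_ratio two_level_sq// psi0 mulr1 fourier_re0. Qed.

Lemma m_ker_cont Gr : continuous (@m_ker R Gr).
Proof. by rewrite /m_ker; cont. Qed.

Lemma m_ker_con Gr G u : m_ker Gr u * con G u = zext (- 1) 1 (@m_ker R Gr) u * con G u.
Proof.
rewrite /zext -ler_norml; case: leP => // u1.
by rewrite convol_out// !mulr0.
Qed.

(** Unfolding the autocorrelation gives the form with kernel [m (t - s)] that meets the integral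
    equation. Cutting [m_ker] to [-1, 1], where the autocorrelation lives, makes it integrable for
    Fubini. *)
Lemma intR_m_con Gr G : continuous G -> (forall x, G (- x) = G x) ->
  intR (fun u => m_ker Gr u * con G u) =
  intR (fun t => trunc G t * intR (trunc (fun s => G s * m_ker Gr (t - s)))).
Proof.
move=> cG eG; under intR_eq do rewrite m_ker_con.
have [B gB] : exists B, forall x, `|trunc G x| <= B by apply: zext_bounded => //; lra.
have mG : measurable_fun setT (trunc G) by apply: L1_measurable; exact: L1_zext.
have Lm : L1 (zext (- 1) 1 (@m_ker R Gr)) by apply: L1_zext; exact: m_ker_cont.
rewrite /convol (@fubini_swap _ _ _ (fun u t => trunc G (u - t)) B) => //; [|exact: L1_zext|].
  apply: intR_eq => t; have [t1|t1] := leP `|t| half; last first.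
    by rewrite zext_out -?ler_norml -?ltNge// !mul0r.
  congr (_ * _).
  have L2 : L1 (fun u => zext (- 1) 1 (m_ker Gr) u * trunc G (u - t)).
    apply: L1_bm => //; split; last by exists B.
    by apply: measurableT_comp => //; exact: measurable_funB.
  (* Translation by [t] and then reflection bring the argument to [t - s]. For [s] and [t] in
     [-1/2, 1/2] the cut at 1 has no effect. *)
  have [L3 <-] := intR_shift t L2; have [_ <-] := intR_opp L3.
  apply: intR_eq => s; rewrite addrK zext_sym_even// mulrC {1 3}/zext -!ler_norml.
  case: leP => s1; last by rewrite mul0r.
  rewrite /zext -ler_norml ifT; first by rewrite addrC.
  by apply: le_trans (ler_normD _ _) _; rewrite normrN; lra.
apply: (measurableT_comp mG); apply: measurable_funB; [exact: measurable_fst|exact: measurable_snd].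
Qed.

Section Limit.
Variables (Gr : group) (G : R -> R) (Gn : nat -> R -> R).
Hypotheses (cG : continuous G) (eG : forall x, G (- x) = G x).
Hypotheses (cGn : forall n, continuous (Gn n)) (eGn : forall n x, Gn n (- x) = Gn n x).
Hypothesis dom : forall n x, `|Gn n x| <= `|G x|.
Hypothesis lim : forall x, `|x| < half -> Gn n x @[n --> \oo] --> G x.

Let tdom n x : `|trunc (Gn n) x| <= `|trunc G x|.
Proof. by rewrite /zext; case: ifP; rewrite ?normr0. Qed.

Let tlim x : `|x| != half -> trunc (Gn n) x @[n --> \oo] --> trunc G x.
Proof.
move=> xn; have [x1|x1|xE] := ltgtP `|x| half; last by rewrite xE eqxx in xn.
  rewrite /zext -ler_norml ltW//; exact: lim.
under eq_fun do rewrite zext_out -?ler_norml -?ltNge//.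
by rewrite zext_out -?ler_norml -?ltNge//; exact: cvg_cst.
Qed.

Let notin x : x \notin [:: - half; half] -> `|x| != half.
Proof.
rewrite !inE; apply: contra => /eqP xE; have [x0|x0] := leP 0 x.
  by rewrite ger0_norm// in xE; rewrite xE eqxx orbT.
by rewrite ltr0_norm// in xE; rewrite -xE opprK eqxx.
Qed.

Let Lt n : L1 (trunc (Gn n)). Proof. exact: L1_zext. Qed.
Let LG : L1 (trunc G). Proof. exact: L1_zext. Qed.

Lemma intR_trunc_cvg : intR (trunc (Gn n)) @[n --> \oo] --> intR (trunc G).
Proof.
apply: (dct (g := fun x => `|trunc G x|)).
- by move=> n; exact: L1_measurable.
- by apply: (@ae_seq _ [:: - half; half]) => x /notin; exact: tlim.
- exact: L1_measurable.
- exact: L1_norm.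
- exact: tdom.
Qed.

Let L1_conv (F H : R -> R) x : continuous F -> continuous H -> L1 (fun t => trunc F t * trunc H (x - t)).
Proof.
move=> cF cH; have [B gB] : exists B, forall x, `|trunc H x| <= B by apply: zext_bounded => //; lra.
apply: L1_bm; first exact: L1_zext.
split; last by exists B.
apply: measurableT_comp; last exact: measurable_funB.
by apply: L1_measurable; exact: L1_zext.
Qed.

Lemma con_cvg x : con (Gn n) x @[n --> \oo] --> con G x.
Proof.
apply: (dct (g := fun t => `|trunc G t * trunc G (x - t)|)).
- by move=> n; apply: L1_measurable; exact: L1_conv.
(* Nothing is assumed about the limit at the ends of the interval, so the points where either factor
   meets an end are excluded. *)
- apply: (@ae_seq _ [:: - half; half; x - half; x + half]) => t.
  rewrite !inE !negb_or => /and4P[t1 t2 t3 t4].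
  apply: cvgM; apply: tlim; apply: notin; rewrite !inE negb_or; first by rewrite t1.
  apply/andP; split; [move: t4|move: t3]; apply: contra => /eqP h; apply/eqP; lra.
- by apply: L1_measurable; exact: L1_conv.
- by apply: L1_norm; exact: L1_conv.
- by move=> n t; rewrite !normrM ler_pM.
Qed.

Lemma level_ratio_sq_cvg : 0 < intR (trunc G) ->
  level_ratio Gr (sq (Gn n)) (@psi_sinc2 R) @[n --> \oo] --> level_ratio Gr (sq G) (@psi_sinc2 R).
Proof.
move=> G0; rewrite level_ratio_sq//.
under eq_fun do rewrite level_ratio_sq//.
apply: cvgM.
  apply: cvgV; first by rewrite expf_neq0// gt_eqF.
  by rewrite expr2; under eq_fun do rewrite expr2; apply: cvgM; exact: intR_trunc_cvg.
apply: cvgD; first by apply: cvgM; [exact: cvg_cst|exact: con_cvg].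
have [B gB] : exists B, forall x, `|trunc G x| <= B by apply: zext_bounded => //; lra.
have Lm : L1 (zext (- 1) 1 (@m_ker R Gr)) by apply: L1_zext; exact: m_ker_cont.
have meas F : continuous F -> measurable_fun setT (fun u => m_ker Gr u * con F u).
  move=> cF; apply: continuous_measurable_fun; apply: contM; first exact: m_ker_cont.
  exact: convol_continuous.
apply: (dct (g := fun u => intR (fun t => `|trunc G t|) * B * `|zext (- 1) 1 (@m_ker R Gr) u|)).
- by move=> n; exact: meas.
- by apply: aeW => u; apply: cvgM; [exact: cvg_cst|exact: con_cvg].
- exact: meas.
- exact/L1Z/L1_norm.
- move=> n u; rewrite m_ker_con normrM mulrC ler_wpM2r//.
  apply: le_trans (_ : intR (fun t => `|trunc (Gn n) t * trunc (Gn n) (u - t)|) <= _).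
    by apply: intR_norm; exact: L1_conv.
  rewrite -intRZr; last exact: L1_norm.
  apply: intR_le; [exact/L1_norm/L1_conv| |].
    by apply: L1_eq (L1Z B (L1_norm LG)) => t; rewrite mulrC.
  by move=> t; rewrite normrM ler_pM// (le_trans (tdom _ _)).
Qed.

End Limit.
End Squares.

Section Optimum.
Variable R : realType.
Implicit Types (x y t s u : R) (G : R -> R) (n : nat) (Gr : group).
Notation half := (2^-1 : R).
Notation trunc := (zext (- half) half).
Notation sq G := (fun x => fourier_re (trunc G) x ^+ 2).

(** Integrating the integral equation against g turns the numerator into [c_const] times the mass of
    g, while the denominator is the squared mass. *)
Lemma level_ratio_optimum Gr :
  level_ratio Gr (sq (g_fun Gr)) (@psi_sinc2 R) = c_const R Gr / g_mass R Gr.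
Proof.
have cg := @g_cont R Gr; have eg := @g_even R Gr; have m0 := g_mass_gt0 R Gr.
have Lg : L1 (trunc (g_fun Gr)) by exact: L1_zext.
have [B gB] : exists B, forall x, `|trunc (g_fun Gr) x| <= B by apply: zext_bounded => //; lra.
have Lg2 : L1 (fun t => trunc (g_fun Gr) t ^+ 2).
  apply: L1_eq (L1_bm Lg (_ : bounded_measurable (trunc (g_fun Gr)))); first by move=> t; rewrite expr2.
  by split; [exact: L1_measurable|exists B].
rewrite level_ratio_sq// convol0// intR_m_con// -/(g_mass R Gr).
have -> : intR (fun t => trunc (g_fun Gr) t * intR (trunc (fun s => g_fun Gr s * m_ker Gr (t - s)))) =
    intR (fun t => c_const R Gr * trunc (g_fun Gr) t - c_const R Gr * trunc (g_fun Gr) t ^+ 2).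
  apply: intR_eq => t; have [t1|t1] := leP `|t| half; last first.
    by rewrite zext_out -?ler_norml -?ltNge// mul0r mulr0 expr0n/= mulr0 subr0.
  move: (t1); rewrite ler_norml => /andP[tl tr].
  have -> : trunc (g_fun Gr) t = g_fun Gr t by rewrite /zext -ler_norml t1.
  have := g_integral_equation Gr tl tr.
  rewrite -[trunc (fun s => _ * m_ker _ _)]/(trunc (fun s => g_fun Gr s * quad_ker _ _ _ (t - s))).
  move: (intR _) => I e; have -> : I = c_const R Gr - c_const R Gr * g_fun Gr t by rewrite -[X in X - _]e; ring.
  by ring.
rewrite intRB; [|exact: L1Z|exact: L1Z]; rewrite !intRZ//.
rewrite addrC subrK -/(g_mass R Gr).
by field; rewrite gt_eqF.
Qed.

(** Since [4^-1 - u ^+ 2] is positive exactly for [|u| < 1 / 2], the bump needs no separate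
    truncation; its parameter is [d = 1 / (n + 1)]. *)
Definition mollified Gr n u : R := g_fun Gr u * flat n.+1%:R^-1 0 (4^-1 - u ^+ 2).

Lemma smooth_mollified Gr n k : smooth k (mollified Gr n).
Proof.
apply: smoothM.
  rewrite (_ : g_fun Gr = fun x => amp R Gr * cos (freq R Gr * x) + offset R Gr); last first.
    by apply/funext => x; exact: g_funE.
  apply: smoothD; last exact: smooth_cst.
  apply: smoothM; first exact: smooth_cst.
  apply: (smooth_comp (smooth_cos R k).1); apply: smoothM; [exact: smooth_cst|exact: smooth_id].
apply: (@smooth_comp _ _ (flat n.+1%:R^-1 0)); first by apply: smooth_flat; rewrite invr_gt0.
apply: (@smoothD _ _ (fun=> 4^-1) (fun u => - u ^+ 2)); first exact: smooth_cst.
rewrite (_ : (fun u : R => - u ^+ 2) = fun u => (- 1 * u) * u); last first.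
  by apply/funext => u; rewrite expr2; ring.
apply: smoothM (smooth_id _ _); apply: smoothM (smooth_id _ _); exact: smooth_cst.
Qed.

Lemma mollified_out Gr n u : half <= `|u| -> mollified Gr n u = 0.
Proof.
move=> u1; rewrite /mollified /flat ifF ?mulr0//; apply/negbTE; rewrite -leNgt subr_le0.
rewrite -[u ^+ 2]real_normK ?num_real//.
rewrite (_ : 4^-1 = half ^+ 2); last by field.
by rewrite lerXn2r ?nnegrE.
Qed.

Lemma mollified_even Gr n u : mollified Gr n (- u) = mollified Gr n u.
Proof. by rewrite /mollified g_even sqrrN. Qed.

Lemma trunc_mollified Gr n : trunc (mollified Gr n) = mollified Gr n.
Proof.
apply/funext => u; rewrite /zext -ler_norml; case: leP => // u1.
by rewrite mollified_out// ltW.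
Qed.

Lemma norm_mollified Gr n u : `|mollified Gr n u| <= `|g_fun Gr u|.
Proof.
rewrite normrM ler_piMr// /flat; case: ifP => [q0|_]; last by rewrite normr0.
rewrite expr0 mul1r ger0_norm ?expR_ge0// -[leRHS]expR0 ler_expR oppr_le0.
by rewrite mulr_ge0// invr_ge0// ltW.
Qed.

Lemma mollified_cvg Gr u : `|u| < half -> mollified Gr n u @[n --> \oo] --> g_fun Gr u.
Proof.
move=> u1; rewrite -[X in _ --> X]mulr1; apply: cvgM; first exact: cvg_cst.
have q0 : 0 < 4^-1 - u ^+ 2.
  rewrite subr_gt0 -[u ^+ 2]real_normK ?num_real// (_ : 4^-1 = half ^+ 2); last by field.
  by rewrite ltrXn2r// ?nnegrE.
rewrite /flat q0; under eq_fun do rewrite expr0 mul1r.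
have ce : continuous (fun d : R => expR (- (d * (4^-1 - u ^+ 2)^-1))) by cont.
have := cvg_comp _ _ (@cvg_harmonic R) (ce 0).
by rewrite mul0r oppr0 expR0.
Qed.

(** The transform is a [phase] with c = 0, so its square lies in [band]. The positive integral is
    what makes the square positive at 0. *)
Lemma mollified_test Gr n : 0 < intR (trunc (mollified Gr n)) -> 
  test_function (sq (mollified Gr n)) /\ fourier_supp_in (sq (mollified Gr n)) 1.
Proof.
move=> m0; have cm : continuous (mollified Gr n) by exact: (smooth_cont (smooth_mollified Gr n 0)).
have em := @mollified_even Gr n.
have supp1 : fourier_supp_in (sq (mollified Gr n)) 1.
  move=> xi xi1; split; first by rewrite fourier_fourier_sq// convol_out.
  by apply: fourier_im_even; [exact: L1_fourier_sq|move=> x; rewrite fourier_re_even].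
split => //; split; first by move=> x; exact: sqr_ge0.
split; first by move=> x; rewrite fourier_re_even.
split; last first.
  by split; [exists 1|rewrite fourier_re0 exprn_gt0].
apply: band_schwartz; rewrite (_ : (fun x => _) = fun x => phase (mollified Gr n) 0 x * phase (mollified Gr n) 0 x).
  by apply: BandM; apply: BandPhase; [exact: smooth_mollified| |exact: smooth_mollified|];
    move=> u u1; rewrite mollified_out//; lra.
apply/funext => x; rewrite expr2 trunc_mollified; congr (_ * _); apply: intR_eq => u; by rewrite addr0.
Qed.

End Optimum.

(** Since g does not vanish at the ends of [-1/2, 1/2], its truncation jumps there, its transform
    decays only like 1 / x, and the optimiser is continuous and integrable but not Schwartz. Hence
    the infimum over Schwartz functions is reached only in the limit. *)
Theorem theorem1p1 (R : realType) (G : group) :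
  let v := @c_const R G /
           Rintegral (@lebesgue_measure R) `[- 2^-1, 2^-1] (@g_fun R G) in
  is_infimum [set r | exists phi : R -> R,
                 test_function phi /\ fourier_supp_in phi 1 /\
                 r = level_ratio G phi (@psi_sinc2 R)] v /\
  exists phi0 : R -> R,
    continuous phi0 /\ (@lebesgue_measure R).-integrable setT (EFin \o phi0) /\
    (forall xi, fourier_re phi0 xi = convol (@g_ext R G) (@g_ext R G) xi /\
                fourier_im phi0 xi = 0) /\
    level_ratio G phi0 (@psi_sinc2 R) = v.
Proof.
rewrite -intR_zext -/(g_mass R G) => v; have cg := @g_cont R G; have eg := @g_even R G.
have Lg2 := L1_fourier_sq cg eg; split; last first.
  exists (fun x => fourier_re (zext (- 2^-1) 2^-1 (g_fun G)) x ^+ 2); split.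
    by apply: contX; apply: fourier_re_cont; exact: L1_zext.
  split; first exact: Lg2.
  split; last exact: level_ratio_optimum.
  (* Here [g_ext G] is convertible to the truncation by [zext]. *)
  move=> xi; split; first exact: (fourier_fourier_sq cg eg).
  by apply: fourier_im_even => // x; rewrite fourier_re_even.
split=> [_ [phi [tphi [sphi ->]]]|w wle]; first exact: level_ratio_ge.
have m0 := g_mass_gt0 R G.
have cm n : continuous (@mollified R G n) by exact: (smooth_cont (@smooth_mollified R G n 0)).
have dom n (x : R) : `|mollified G n x| <= `|g_fun G x| by exact: norm_mollified.
have em n (x : R) : mollified G n (- x) = mollified G n x by exact: mollified_even.
have lim := @mollified_cvg R G.
rewrite /v -level_ratio_optimum.
have H := level_ratio_sq_cvg (Gr := G) cg eg cm em dom (@lim) m0.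
apply: (ler_cvg_to (cvg_cst w) H).
have C := intR_trunc_cvg cg cm dom (@lim).
near=> n; apply: wle.
have mn : 0 < intR (zext (- 2^-1) 2^-1 (@mollified R G n)).
  (* The masses of the mollified functions converge to that of g, which is positive, so they are
     eventually positive. *)
  by near: n; exact: (cvgr_gt (g_mass R G) C 0 m0).
have [t s] := mollified_test mn.
by exists (fun x => fourier_re (zext (- 2^-1) 2^-1 (mollified G n)) x ^+ 2).
Unshelve. all: by end_near. Qed.
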